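(* Let $n\ge 1$ be a natural number or $n=\infty$, and let $\Sigma$ be an $(n,1)$-polygraph. The following assertions are equivalent: (i) $\Sigma$ is acyclic; (ii) $\Sigma$ is normalising; (iii) $\Sigma$ is left normalising; (iv) $\Sigma$ is right normalising.
   Context: All higher categories are strict and globular. $f\star_i g$ is the $i$-composite of $f$ and $g$, defined when $t_i(f)=s_i(g)$; $\star_0$ is written as concatenation; an identity composed with higher cells is written as the underlying cell. An $(n,1)$-category is an $n$-category whose $k$-cells are invertible (for $\star_{k-1}$, inverse written $f^-$) for all $k>1$. A $k$-sphere is a pair of parallel $k$-cells. A cellular extension of a $k$-category $\mathcal{C}$ is a set $\Gamma$ with a map to the $k$-spheres of $\mathcal{C}$; if $\mathcal{C}$ is a $(k,1)$-category, $\mathcal{C}(\Gamma)$ is the $(k+1,1)$-category obtained by freely adjoining the elements of $\Gamma$ as invertible $(k+1)$-cells. A homotopy basis of a $(k,1)$-category $\mathcal{C}$ ($k>1$) is a cellular extension $\Gamma$ such that every $k$-sphere of $\mathcal{C}$ is the boundary of some $(k+1)$-cell of $\mathcal{C}(\Gamma)$. An $(n,1)$-polygraph $\Sigma$ consists of a set $\Sigma_0$ of $0$-cells, a set $\Sigma_1$ of generating $1$-cells (a graph over $\Sigma_0$) with free category $\Sigma_1^*=\Sigma_1^{\top}$ and, for $1\le k<n$, a cellular extension $\Sigma_{k+1}$ of the free $(k,1)$-category $\Sigma^{\top}_k=\Sigma_1^*(\Sigma_2)\cdots(\Sigma_k)$. The free $(n,1)$-category is $\Sigma^{\top}$. The category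 presented by $\Sigma$ is $\overline{\Sigma}=\Sigma_1^*/\Sigma_2$ (with $\overline{\Sigma}=\Sigma_1^*$ if $n=1$); $\overline{u}$ is the image of $u$ in $\overline\Sigma$. $\Sigma$ is acyclic when $\Sigma_{k+1}$ is a homotopy basis of $\Sigma^{\top}_k$ for every $1<k<n$. Section: a choice, for each $1$-cell $u:x\to y$ of $\overline{\Sigma}$, of a representative $1$-cell $\widehat{u}:x\to y$ of $\Sigma_1^*$, with $\widehat{1_x}=1_x$ for every $0$-cell $x$ (no functoriality is required). For a $1$-cell $u$ of $\Sigma_1^*$ one writes $\widehat{u}$ for $\widehat{\overline{u}}$. Every polygraph is assumed to come with an implicitly chosen section. Normalisation strategy for $\Sigma$: a mapping $\sigma$ assigning to each $k$-cell $f$ of $\Sigma^{\top}$, $1\le k<n$, a $(k+1)$-cell $\sigma_f:f\to\widehat{f}$ of $\Sigma^{\top}$, where for $k>1$ one sets $\widehat{f}=\sigma_{s(f)}\star_{k-1}\sigma_{t(f)}^-$, such that $\sigma_{\widehat{f}}=1_{\widehat{f}}$ for every such $f$, and $\sigma_{f\star_i g}=\sigma_f\star_i\sigma_g$ for all $i$-composable $k$-cells $f,g$ with $1\le i<k<n$. $\Sigma$ is normalising when it admits a normalisation strategy. A normalisation strategy $\sigma$ is a left one when $\sigma_{uv}=\sigma_u v\star_1\sigma_{\widehat{u}v}$ for all $0$-composable $1$-cells $u,v$, and $\sigma_{fg}=\sigma_f v\star_1\sigma_{u'g}$ for all $0$-composable $k$-cells $f,g$, $2\le k<n$, where $u'=t_1(f)$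 and $v=s_1(g)$. It is a right one when $\sigma_{uv}=u\sigma_v\star_1\sigma_{u\widehat{v}}$ and $\sigma_{fg}=u\sigma_g\star_1\sigma_{fv'}$, where $u=s_1(f)$ and $v'=t_1(g)$. $\Sigma$ is left (resp. right) normalising when it admits a left (resp. right) normalisation strategy. *)

(* Defs.v *)
From Stdlib Require Import ClassicalEpsilon.
From mathcomp Require Import all_boot.

Set Implicit Arguments.
Unset Strict Implicit.
Unset Printing Implicit Defensive.

(* A dimension is a natural number ([Some n]) or infinity ([None]). *)
Definition edim := option nat.

Definition leD (k : nat) (n : edim) : bool := if n is Some m then k <= m else true.

Definition ltD (k : nat) (n : edim) : bool := if n is Some m then k < m else true.

(** * Strict globular higher categories *)

(* Data of a strict globular category.
   - [src i f] and [tgt i f] are the i-source and i-target of a k-cell f; they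
     are meaningful for i < k only.
   - [idc l f] is the iterated identity of dimension l on a k-cell f, for
     k <= l; thus [idc k.+1 f] is 1_f and [idc k f] is f.
   - [compo i f g] is the i-composite of two k-cells, in diagrammatic order; it
     is meaningful for i < k and [tgt i f = src i g] only.
   The operations are total functions; nothing is assumed on, and nothing is
   made of, their other values. *)
Record globcat := GlobCat {
  cell :> nat -> Type;
  src : forall k i : nat, cell k -> cell i;
  tgt : forall k i : nat, cell k -> cell i;
  idc : forall k l : nat, cell k -> cell l;
  compo : forall k i : nat, cell k -> cell k -> cell k }.

Arguments src {g k} i _.
Arguments tgt {g k} i _.
Arguments idc {g k} l _.
Arguments compo {g k} i _ _.

(* [is_ncat n C]: the cells of dimension at most n of C form a strict
   n-category.  When n is finite, the cells of C of dimension greater than n are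
   not considered, so that the same C also denotes its underlying k-category
   for every k <= n. *)
Record is_ncat (n : edim) (C : globcat) : Prop := IsNCat {
  src_src : forall (i j k : nat) (f : C k), i < j < k -> leD k n ->
    src i (src j f) = src i f;
  src_tgt : forall (i j k : nat) (f : C k), i < j < k -> leD k n ->
    src i (tgt j f) = src i f;
  tgt_src : forall (i j k : nat) (f : C k), i < j < k -> leD k n ->
    tgt i (src j f) = tgt i f;
  tgt_tgt : forall (i j k : nat) (f : C k), i < j < k -> leD k n ->
    tgt i (tgt j f) = tgt i f;
  idc_refl : forall (k : nat) (f : C k), leD k n -> idc k f = f;
  idc_idc : forall (k j l : nat) (f : C k), k <= j <= l -> leD l n ->
    idc l (idc j f) = idc l f;
  src_idc : forall (k j l : nat) (f : C k), k <= j < l -> leD l n ->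
    src j (idc l f) = idc j f;
  tgt_idc : forall (k j l : nat) (f : C k), k <= j < l -> leD l n ->
    tgt j (idc l f) = idc j f;
  src_comp : forall (i k : nat) (f g : C k), i < k -> leD k n ->
    tgt i f = src i g -> src i (compo i f g) = src i f;
  tgt_comp : forall (i k : nat) (f g : C k), i < k -> leD k n ->
    tgt i f = src i g -> tgt i (compo i f g) = tgt i g;
  src_comp_lt : forall (i j k : nat) (f g : C k), i < j < k -> leD k n ->
    tgt i f = src i g -> src j (compo i f g) = compo i (src j f) (src j g);
  tgt_comp_lt : forall (i j k : nat) (f g : C k), i < j < k -> leD k n ->
    tgt i f = src i g -> tgt j (compo i f g) = compo i (tgt j f) (tgt j g);
  comp_assoc : forall (i k : nat) (f g h : C k), i < k -> leD k n ->
    tgt i f = src i g -> tgt i g = src i h ->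
    compo i (compo i f g) h = compo i f (compo i g h);
  comp_idl : forall (i k : nat) (f : C k), i < k -> leD k n ->
    compo i (idc k (src i f)) f = f;
  comp_idr : forall (i k : nat) (f : C k), i < k -> leD k n ->
    compo i f (idc k (tgt i f)) = f;
  idc_comp : forall (i k l : nat) (f g : C k), i < k <= l -> leD l n ->
    tgt i f = src i g -> idc l (compo i f g) = compo i (idc l f) (idc l g);
  exchange : forall (i j k : nat) (f f' g g' : C k), i < j < k -> leD k n ->
    tgt j f = src j g -> tgt j f' = src j g' -> tgt i f = src i f' ->
    compo j (compo i f f') (compo i g g') = compo i (compo j f g) (compo j f' g') }.

(* Inverses of k-cells are for the (k-1)-composition. *)
Definition is_inverse (C : globcat) (k : nat) (f g : C k) : Prop :=
  [/\ src k.-1 g = tgt k.-1 f,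
      tgt k.-1 g = src k.-1 f,
      compo k.-1 f g = idc k (src k.-1 f) &
      compo k.-1 g f = idc k (tgt k.-1 f)].

(* The inverse of f, which is unique when it exists (an arbitrary cell
   otherwise). *)
Definition invert (C : globcat) (k : nat) (f : C k) : C k :=
  epsilon (inhabits f) (is_inverse f).

Definition is_n1cat (n : edim) (C : globcat) : Prop :=
  is_ncat n C /\
  forall (k : nat) (f : C k), 1 < k -> leD k n -> exists g, is_inverse f g.

(* [F] is a functor from the k-category underlying C to the one underlying D:
   its values on cells of dimension greater than k are not considered. *)
Record is_functor (k : nat) (C D : globcat) (F : forall j : nat, C j -> D j) : Prop :=
  IsFunctor {
  fun_src : forall (i j : nat) (f : C j), i < j <= k -> F i (src i f) = src i (F j f);
  fun_tgt : forall (i j : nat) (f : C j), i < j <= k -> F i (tgt i f) = tgt i (F j f);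
  fun_idc : forall (j l : nat) (f : C j), j <= l <= k -> F l (idc l f) = idc l (F j f);
  fun_comp : forall (i j : nat) (f g : C j), i < j <= k -> tgt i f = src i g ->
    F j (compo i f g) = compo i (F j f) (F j g) }.

Definition parallel (C : globcat) (k : nat) (f g : C k) : Prop :=
  forall i : nat, i < k -> src i f = src i g /\ tgt i f = tgt i g.

(** * Cellular extensions *)

Record cellext (k : nat) (C : globcat) := CellExt {
  gen :> Type;
  gsrc : gen -> C k;
  gtgt : gen -> C k;
  gpar : forall x : gen, parallel (gsrc x) (gtgt x) }.

Arguments gsrc {k C c} _.
Arguments gtgt {k C c} _.

(* [is_free_ext G J inc]: the (k+1,1)-category E, together with the functor J
   from the k-category C and the map inc from G to the (k+1)-cells of E, is the
   (k+1,1)-category C(G) obtained from C by freely adjoining the elements of G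
   as (invertible, if k > 0) (k+1)-cells.  For k = 0, C is a set, G is a graph
   over it, and a (1,1)-category is merely a category, so that C(G) is the free
   category on the graph G. *)
Record is_free_ext (k : nat) (C : globcat) (G : cellext k C) (E : globcat)
    (J : forall j : nat, C j -> E j) (inc : G -> E k.+1) : Prop := IsFreeExt {
  free_n1cat : is_n1cat (Some k.+1) E;
  free_functor : is_functor k J;
  free_src : forall x : G, src k (inc x) = J k (gsrc x);
  free_tgt : forall x : G, tgt k (inc x) = J k (gtgt x);
  free_univ : forall (D : globcat) (F : forall j : nat, C j -> D j) (phi : G -> D k.+1),
    is_n1cat (Some k.+1) D -> is_functor k F ->
    (forall x : G, src k (phi x) = F k (gsrc x)) ->
    (forall x : G, tgt k (phi x) = F k (gtgt x)) ->
    exists H : forall j : nat, E j -> D j,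
      [/\ is_functor k.+1 H,
          (forall (j : nat) (f : C j), j <= k -> H j (J j f) = F j f) &
          (forall x : G, H k.+1 (inc x) = phi x)] /\
      (forall H' : forall j : nat, E j -> D j,
        is_functor k.+1 H' ->
        (forall (j : nat) (f : C j), j <= k -> H' j (J j f) = F j f) ->
        (forall x : G, H' k.+1 (inc x) = phi x) ->
        forall (j : nat) (f : E j), j <= k.+1 -> H' j f = H j f) }.

(* The extension C(G) being defined up to isomorphism only, the condition is
   asked in every model of it. *)
Definition homotopy_basis (k : nat) (C : globcat) (G : cellext k C) : Prop :=
  forall (E : globcat) (J : forall j : nat, C j -> E j) (inc : G -> E k.+1),
    is_free_ext J inc ->
    forall f g : C k, parallel f g ->
    exists a : E k.+1, src k a = J k f /\ tgt k a = J k g.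

(** * Polygraphs *)

(* An (n,1)-polygraph S is given together with (a model of) the free
   (n,1)-category S^T that it generates, whose underlying k-category is S^T_k.
   S_0 is the set of 0-cells of [top S] and, for k < n, [gens S k] is S_{k+1},
   seen as a cellular extension of S^T_k; the last two fields state that
   S^T_{k+1} = S^T_k(S_{k+1}) for every k < n, starting from S^T_0 = S_0. *)
Record polygraph (n : edim) := Polygraph {
  top :> globcat;
  top_n1cat : is_n1cat n top;
  gens : forall k : nat, cellext k top;
  gens_empty : forall k : nat, ~~ ltD k n -> gens k -> False;
  incl : forall k : nat, gens k -> top k.+1;
  top_free : forall k : nat, ltD k n ->
    is_free_ext (fun (j : nat) (f : top j) => f) (@incl k) }.

Definition acyclic (n : edim) (S : polygraph n) : Prop :=
  forall k : nat, 1 < k -> ltD k n -> homotopy_basis (gens S k).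

(* The congruence on the 1-cells generated by a cellular extension. *)
Inductive congr1 (C : globcat) (G : cellext 1 C) : C 1 -> C 1 -> Prop :=
| congr1_gen (x : G) : congr1 G (gsrc x) (gtgt x)
| congr1_refl (u : C 1) : congr1 G u u
| congr1_sym (u v : C 1) : congr1 G u v -> congr1 G v u
| congr1_trans (u v w : C 1) : congr1 G u v -> congr1 G v w -> congr1 G u w
| congr1_comp (u u' v v' : C 1) : tgt 0 u = src 0 v ->
    congr1 G u u' -> congr1 G v v' -> congr1 G (compo 0 u v) (compo 0 u' v').

Section Strategies.

Variables (n : edim) (S : polygraph n).

(* The 1-cells of the category S_1^*/S_2 presented by S, as congruence classes
   of 1-cells of S_1^*.  If n = 1 then S_2 is empty, the congruence is equality
   and the presented category is S_1^*. *)
Definition pcell : Type :=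
  {A : S 1 -> Prop | exists u : S 1, A = congr1 (gens S 1) u}.

Definition pclass (u : S 1) : pcell := exist _ (congr1 (gens S 1) u) (ex_intro _ u erefl).

Record section := MkSection {
  rep : pcell -> S 1;
  rep_class : forall a : pcell, pclass (rep a) = a;
  rep_id : forall x : S 0, rep (pclass (idc 1 x)) = idc 1 x }.

Variable s : section.

Definition hat1 (u : S 1) : S 1 := rep s (pclass u).

(* Dimension 0 is irrelevant. *)
Definition hat (sigma : forall k : nat, S k -> S k.+1) (k : nat) : S k -> S k :=
  match k return S k -> S k with
  | 0 => fun x => x
  | 1 => hat1
  | m.+2 => fun f => compo m.+1 (sigma m.+1 (src m.+1 f)) (invert (sigma m.+1 (tgt m.+1 f)))
  end.

(* The values of [sigma] on k-cells are considered for 1 <= k < n only. *)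
Record is_strategy (sigma : forall k : nat, S k -> S k.+1) : Prop := IsStrategy {
  strat_src : forall (k : nat) (f : S k), 0 < k -> ltD k n ->
    src k (sigma k f) = f;
  strat_tgt : forall (k : nat) (f : S k), 0 < k -> ltD k n ->
    tgt k (sigma k f) = hat sigma f;
  strat_hat : forall (k : nat) (f : S k), 0 < k -> ltD k n ->
    sigma k (hat sigma f) = idc k.+1 (hat sigma f);
  strat_comp : forall (i k : nat) (f g : S k), 0 < i < k -> ltD k n ->
    tgt i f = src i g -> sigma k (compo i f g) = compo i (sigma k f) (sigma k g) }.

Record is_left_strategy (sigma : forall k : nat, S k -> S k.+1) : Prop := IsLeftStrategy {
  left_strat : is_strategy sigma;
  left_comp1 : forall u v : S 1, ltD 1 n -> tgt 0 u = src 0 v ->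
    sigma 1 (compo 0 u v) =
    compo 1 (compo 0 (sigma 1 u) (idc 2 v)) (sigma 1 (compo 0 (hat1 u) v));
  left_comp : forall (k : nat) (f g : S k), 1 < k -> ltD k n -> tgt 0 f = src 0 g ->
    let u' : S 1 := tgt 1 f in
    let v : S 1 := src 1 g in
    sigma k (compo 0 f g) =
    compo 1 (compo 0 (sigma k f) (idc k.+1 v)) (sigma k (compo 0 (idc k u') g)) }.

Record is_right_strategy (sigma : forall k : nat, S k -> S k.+1) : Prop := IsRightStrategy {
  right_strat : is_strategy sigma;
  right_comp1 : forall u v : S 1, ltD 1 n -> tgt 0 u = src 0 v ->
    sigma 1 (compo 0 u v) =
    compo 1 (compo 0 (idc 2 u) (sigma 1 v)) (sigma 1 (compo 0 u (hat1 v)));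
  right_comp : forall (k : nat) (f g : S k), 1 < k -> ltD k n -> tgt 0 f = src 0 g ->
    let u : S 1 := src 1 f in
    let v' : S 1 := tgt 1 g in
    sigma k (compo 0 f g) =
    compo 1 (compo 0 (idc k.+1 u) (sigma k g)) (sigma k (compo 0 f (idc k v'))) }.

Definition normalising : Prop :=
  exists sigma : forall k : nat, S k -> S k.+1, is_strategy sigma.

Definition left_normalising : Prop :=
  exists sigma : forall k : nat, S k -> S k.+1, is_left_strategy sigma.

Definition right_normalising : Prop :=
  exists sigma : forall k : nat, S k -> S k.+1, is_right_strategy sigma.

End Strategies.

(* Main.v *)
(* A strategy gives back a filler of a sphere [(f, g)]: since [\hat f = \hat g],
   it is [\sigma_f] followed by the inverse of [\sigma_g].

   Conversely, in an acyclic polygraph a left strategy is built one dimension at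
   a time.  Over [\Sigma^T_k] one considers the category whose [k]-cells are
   pairs of a [k]-cell [f : u -> u'] and a family [T_w : w f -> \hat{w f}]
   indexed by the 1-cells [w] composable with [f] and natural with respect to
   [\sigma_w : w -> \hat w]; the 0-composite of [(f, T)] and
   [(g : v -> v', U)] is [(f g, w |-> T_w v *_1 U_{w u'})].  The exchange law
   between the compositions 0 and 1 reduces to the fact that [T_w] commutes with
   a loop [X] of 2-cells, true because [X] can be filled down to an identity.
   Acyclicity produces a family over each generator, from fillers over the
   normal forms [\hat w]; freeness then extends these choices to a section, and
   [\tau_f := T_1] satisfies all the laws of a left strategy except that it may
   be nontrivial on the [\hat f], which is corrected by
   [\sigma_f := \tau_f *_k \tau_{\hat f}^-].  The right case follows by
   reversing the 0-composition. *)

Require Import Defs.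
From mathcomp Require Import all_boot zify.
From Stdlib Require Import ClassicalEpsilon FunctionalExtensionality PropExtensionality.

Set Implicit Arguments.
Unset Strict Implicit.
Unset Printing Implicit Defensive.

(** * Strict categories presented by their top cells *)

(** The left rule forces the use of families: it expresses $\sigma_{fg}$ through $\sigma_{u'g}$,
    which $\sigma_g$ does not determine, so the value on $g$ must be chosen together with the values
    on all $wg$. Naturality in $\sigma_w$ reduces a family to its values at normal forms. The loop
    $X$ is $U_w$ conjugated by the strategy on 1-cells. What contracts it depends on the dimension:
    over 2-cells, the prescribed target of $U_w$ already makes the 2-target of $X$ an identity;
    above that, a 3-cell given by acyclicity does. Dimension 1 is treated apart because no
    $\sigma_w$ exists yet: the families there start at $\hat w f$ and depend on $w$ only through
    $\hat w$. The universal property speaks of $(k+1,1)$-categories, so the pairs are first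
    assembled into a total category; its uniqueness clause then turns the induced functor into a
    section. Calculations take place among the $K$-cells alone, lower cells being replaced by their
    identities, so that whiskering is plain composition and no transport between dimensions
    appears. *)

Definition is_inv (A : Type) (s t : nat -> A -> A) (c : nat -> A -> A -> A)
    (i : nat) (x y : A) : Prop :=
  [/\ s i y = t i x, t i y = s i x, c i x y = s i x & c i y x = t i x].

(* A strict [od]-category presented by its [od]-cells alone, a lower cell being
   identified with its iterated identity: [so i] and [to i] are the identities
   of the [i]-source and of the [i]-target.  In [top_inv], which makes the
   [j.+1]-cells invertible, the condition is void for the top [j]. *)
Record ocat := OCat {
  car :> Type;
  od : nat;
  so : nat -> car -> car;
  to : nat -> car -> car;
  co : nat -> car -> car -> car;
  ss_le : forall i j x, i <= j < od -> so i (so j x) = so i x;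
  st_lt : forall i j x, i < j < od -> so i (to j x) = so i x;
  ts_lt : forall i j x, i < j < od -> to i (so j x) = to i x;
  tt_le : forall i j x, i <= j < od -> to i (to j x) = to i x;
  ss_ge : forall i j x, i <= j < od -> so j (so i x) = so i x;
  st_ge : forall i j x, i <= j < od -> so j (to i x) = to i x;
  ts_ge : forall i j x, i <= j < od -> to j (so i x) = so i x;
  tt_ge : forall i j x, i <= j < od -> to j (to i x) = to i x;
  sc_eq : forall i x y, i < od -> to i x = so i y -> so i (co i x y) = so i x;
  tc_eq : forall i x y, i < od -> to i x = so i y -> to i (co i x y) = to i y;
  sc_lt : forall i j x y, i < j < od -> to i x = so i y ->
    so j (co i x y) = co i (so j x) (so j y);
  tc_lt : forall i j x y, i < j < od -> to i x = so i y ->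
    to j (co i x y) = co i (to j x) (to j y);
  coA : forall i x y z, i < od -> to i x = so i y -> to i y = so i z ->
    co i (co i x y) z = co i x (co i y z);
  co_sl : forall i x, i < od -> co i (so i x) x = x;
  co_tr : forall i x, i < od -> co i x (to i x) = x;
  co_exch : forall i j x x' y y', i < j < od ->
    to j x = so j y -> to j x' = so j y' -> to i x = so i x' ->
    co j (co i x x') (co i y y') = co i (co j x y) (co j x' y');
  top_inv : forall j x, 0 < j < od -> (j.+1 < od -> so j.+1 x = x) ->
    exists y, is_inv so to co j x y }.

Arguments so {o} i x.
Arguments to {o} i x.
Arguments co {o} i x y.
Arguments od : clear implicits.

Section OneSorted.

Variable A : ocat.
Local Notation K := (od A).
Implicit Types x y z : A.

Definition dim j x := so j x = x.

Lemma dim_s i j x : dim i x -> i <= j < K -> so j x = x.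
Proof. by move=> d ij; rewrite -d ss_ge. Qed.

Lemma dim_t i j x : dim i x -> i <= j < K -> to j x = x.
Proof. by move=> d ij; rewrite -d ts_ge. Qed.

Lemma dim_so i x : i < K -> dim i (so i x).
Proof. by move=> ij; rewrite /dim ss_le //; lia. Qed.

Lemma dim_to i x : i < K -> dim i (to i x).
Proof. by move=> ij; rewrite /dim st_ge //; lia. Qed.

Lemma sc_gt i j x y : j < i < K -> to i x = so i y -> so j (co i x y) = so j x.
Proof. by move=> ij e; rewrite -(@ss_le _ j i) ?sc_eq ?ss_le //; lia. Qed.

Lemma tc_gt i j x y : j < i < K -> to i x = so i y -> to j (co i x y) = to j x.
Proof.
by move=> ij e; rewrite -(@ts_lt _ j i) ?sc_eq ?ts_lt //; lia.
Qed.

Lemma comp_s0 i j x y : j < i < K -> to i x = so i y -> so j x = so j y.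
Proof. by move=> ij e; rewrite -(@st_lt _ j i) // e ss_le //; lia. Qed.

Lemma comp_t0 i j x y : j < i < K -> to i x = so i y -> to j x = to j y.
Proof. by move=> ij e; rewrite -(@tt_le _ j i) ?e ?ts_lt //; lia. Qed.

(** This records in the context that [x] is a filler with source [y]: [bd] then reads the boundaries
    of [x] below [m] from those of [y]. The bound on [m] is included because the rewriting rules ask
    for it. *)
Definition sim m x y := so m x = y /\ m < K.

Lemma sim_s m x y j : sim m x y -> j <= m -> so j x = so j y.
Proof. by move=> [<- mK] jm; rewrite ss_le //; lia. Qed.

Lemma sim_t m x y j : sim m x y -> j < m -> to j x = to j y.
Proof. by move=> [<- mK] jm; rewrite ts_lt //; lia. Qed.

End OneSorted.

Ltac ar := solve [done | lia].

(** A hook called by [bstep]; it is redefined to compute the boundaries of inverses once these have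
    been constructed. *)
Ltac bstep_inv := fail.

(* [bd] proves equations between boundaries, by pushing [so] and [to] towards
   the variables; its calls to [congruence] must not instantiate quantified
   hypotheses, which may diverge. *)
Ltac bstep :=
  match goal with
  | d : dim ?j ?x |- context [@so _ ?i ?x] => rewrite (@dim_s _ j i x d); [|ar]
  | d : dim ?j ?x |- context [@to _ ?i ?x] => rewrite (@dim_t _ j i x d); [|ar]
  | d : sim ?j ?x ?y |- context [@so _ ?i ?x] => rewrite (@sim_s _ j x y i d); [|ar]
  | d : sim ?j ?x ?y |- context [@to _ ?i ?x] => rewrite (@sim_t _ j x y i d); [|ar]
  | _ => bstep_inv
  | |- context [@so _ ?i (@so _ ?j ?x)] =>
      first [rewrite (@ss_le _ i j x); [|ar] | rewrite (@ss_ge _ j i x); [|ar]]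
  | |- context [@so _ ?i (@to _ ?j ?x)] =>
      first [rewrite (@st_lt _ i j x); [|ar] | rewrite (@st_ge _ j i x); [|ar]]
  | |- context [@to _ ?i (@so _ ?j ?x)] =>
      first [rewrite (@ts_lt _ i j x); [|ar] | rewrite (@ts_ge _ j i x); [|ar]]
  | |- context [@to _ ?i (@to _ ?j ?x)] =>
      first [rewrite (@tt_le _ i j x); [|ar] | rewrite (@tt_ge _ j i x); [|ar]]
  | |- context [@so _ ?j (@co _ ?i ?x ?y)] =>
      first [ rewrite (@sc_eq _ i x y); [|ar|bd]
            | rewrite (@sc_lt _ i j x y); [|ar|bd]
            | rewrite (@sc_gt _ i j x y); [|ar|bd] ]
  | |- context [@to _ ?j (@co _ ?i ?x ?y)] =>
      first [ rewrite (@tc_eq _ i x y); [|ar|bd]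
            | rewrite (@tc_lt _ i j x y); [|ar|bd]
            | rewrite (@tc_gt _ i j x y); [|ar|bd] ]
  end
with bd := first [assumption | solve [repeat bstep; congruence]].

Ltac bds := repeat bstep.

(** * Inverses for every composition of positive dimension *)

Section Inverses.

Variable A : ocat.
Local Notation K := (od A).
Implicit Types x y z : A.
Local Notation inverse := (@is_inv A so to co).

Lemma inverse_uniq i x y z : i < K -> inverse i x y -> inverse i x z -> y = z.
Proof.
move=> ik [a b c d] [a' b' c' d'].
have -> : y = co i y (co i x z) by rewrite c' -b co_tr.
rewrite -coA //; [|bd..]; by rewrite d -a' co_sl.
Qed.

(** [so j] preserves the equations of an inverse of [x], so [so j y] is another inverse and
    uniqueness applies. *)
Lemma inverse_dim i j x y : i < j < K -> inverse i x y -> dim j x -> dim j y.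
Proof.
move=> ij h dx; have [a b c d] := h.
apply: (@inverse_uniq i x (so j y) y) => //; first lia.
have e1 : so i (so j y) = to i x by bd.
have e2 : to i (so j y) = so i x by bd.
split=> //.
  by rewrite -[x in LHS]dx -(@sc_lt _ i j) // c; bd.
by rewrite -[x in LHS]dx -(@sc_lt _ i j) // d; bd.
Qed.

(** Exchange writes the left side as a [j]-composite. Its first factor is [so j x] followed by
    [a' *_i x'], where [so j x] cancels against [a'] and leaves [x']; its second factor is [x]. The
    two cancel along [j]. Both unit laws of the next lemma rest on this. *)
Lemma inv_half i j x x' a' : i < j < K ->
  inverse j x x' -> inverse i (so j x) a' -> dim j a' ->
  co i x (co i a' x') = so j x'.
Proof.
move=> ij [xa xb xc xd] [a1 a2 a3 a4] da.
have e1 : to i (so j x) = to i x by bd.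
have e2 : so i (so j x) = so i x by bd.
rewrite e1 e2 in a1 a2 a3 a4.
have si : so i x' = so i x by rewrite -(@ss_le _ i j) ?xa ?st_lt //; lia.
have ti : to i x' = to i x by rewrite -(@tt_le _ i j) ?xb ?ts_lt //; lia.
have h1 : so j (to i x) = to i x by bd.
have hi : i < K by lia.
have hj : j < K by lia.
have eZ : to j (co i a' x') = to i x.
  by rewrite tc_lt //; [rewrite xb (dim_t da) //; lia|congruence].
have cax : co i (so j x) (co i a' x') = x'.
  by rewrite -coA //; try bd; rewrite a3 -si co_sl.
have -> : co i x (co i a' x') =
    co j (co i (so j x) (co i a' x')) (co i x (to i x)).
  rewrite co_exch //; try by rewrite ?h1 ?eZ //; bd.
  by rewrite co_sl // -[X in co j _ X]eZ co_tr.
by rewrite cax co_tr // xd -xa.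
Qed.

(* For [j+1] the dimension of [x : a -> b], the [i]-inverse for [i < j] is
   [a' * x^- * b'], where [x^-] is the [j]-inverse of [x] and [a'], [b'] are
   the [i]-inverses of [a], [b]. *)
Lemma ex_inv_dim j i x : 0 < i < j -> j <= K -> (j < K -> dim j x) ->
  exists y, inverse i x y.
Proof.
elim: j i x => [|j IH] i x; first lia.
move=> ij jK dx; have [x' hx] : exists y, inverse j x y.
  by apply: top_inv => [|h]; [lia | apply: dx].
have [->|nij] := eqVneq i j; first by exists x'.
have ijK : i < j < K by lia.
have [|||a' ha] := IH i (so j x); [lia|lia|by move=> *; apply: dim_so|].
have [|||b' hb] := IH i (to j x); [lia|lia|by move=> *; apply: dim_to|].
have da : dim j a' by apply: (inverse_dim ijK ha); apply: dim_so; lia.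
have db : dim j b' by apply: (inverse_dim ijK hb); apply: dim_to; lia.
have [xa xb xc xd] := hx; have [a1 a2 a3 a4] := ha; have [b1 b2 b3 b4] := hb.
have e1 : to i (so j x) = to i x by bd.
have e2 : so i (so j x) = so i x by bd.
have e3 : to i (to j x) = to i x by bd.
have e4 : so i (to j x) = so i x by bd.
have si : so i x' = so i x by rewrite -(@ss_le _ i j) ?xa //; lia.
have ti : to i x' = to i x by rewrite -(@ts_lt _ i j) ?xa ?e3 //; lia.
have xax := inv_half ijK hx ha da.
have hx' : inverse j x' x by split; congruence.
have xbx : co i x' (co i b' x) = so j x.
  by apply: (inv_half ijK hx') => //; rewrite xa.
rewrite ?e1 ?e2 ?e3 ?e4 in a1 a2 a3 a4 b1 b2 b3 b4.
have hi : i < K by lia.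
exists (co i a' (co i x' b')); split; [bd|bd|..].
  have -> : co i a' (co i x' b') = co i (co i a' x') b' by rewrite coA //; bd.
  by rewrite -coA //; [rewrite xax xa|bd|bd].
have -> : co i (co i a' (co i x' b')) x = co i a' (co i x' (co i b' x)).
  by rewrite coA //; [congr co; rewrite coA //; bd|bd|bd].
by rewrite xbx.
Qed.

Lemma ex_inv i x : 0 < i < K -> exists y, inverse i x y.
Proof.
move=> iK; have [e|ne] := eqVneq i.+1 K; last by apply: (@ex_inv_dim K) => //; lia.
by apply: top_inv => // h; lia.
Qed.

Definition invo i x : A := epsilon (inhabits x) (inverse i x).

Lemma invoP i x : 0 < i < K -> inverse i x (invo i x).
Proof. by move=> iK; apply: epsilon_spec; apply: ex_inv. Qed.

Lemma s_invo i x : 0 < i < K -> so i (invo i x) = to i x.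
Proof. by move=> /(invoP x)[]. Qed.

Lemma t_invo i x : 0 < i < K -> to i (invo i x) = so i x.
Proof. by move=> /(invoP x)[]. Qed.

Lemma co_xV i x : 0 < i < K -> co i x (invo i x) = so i x.
Proof. by move=> /(invoP x)[]. Qed.

Lemma co_Vx i x : 0 < i < K -> co i (invo i x) x = to i x.
Proof. by move=> /(invoP x)[]. Qed.

Lemma invo_eq i x y : 0 < i < K -> inverse i x y -> invo i x = y.
Proof. by move=> iK; apply: inverse_uniq (invoP x iK); lia. Qed.

Lemma dim_invo i j x : 0 < i < j -> j < K -> dim j x -> dim j (invo i x).
Proof. by move=> ij jK; apply: (@inverse_dim i); [lia|apply: invoP; lia]. Qed.

Lemma invo_id i x : 0 < i < K -> dim i x -> invo i x = x.
Proof.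
move=> iK d; apply: invo_eq => //; split; try bd.
  by rewrite -{1}d co_sl ?d //; lia.
by rewrite -{1}d co_sl ?(dim_t d) //; lia.
Qed.

Lemma s_invo_gt i j x : 0 < i < K -> j < i -> so j (invo i x) = so j x.
Proof. by move=> iK ji; rewrite -(@ss_le _ j i) ?s_invo ?st_lt //; lia. Qed.

Lemma t_invo_gt i j x : 0 < i < K -> j < i -> to j (invo i x) = to j x.
Proof. by move=> iK ji; rewrite -(@ts_lt _ j i) ?s_invo ?tt_le //; lia. Qed.

Lemma s_invo_lt i j x : 0 < i < j -> j < K -> so j (invo i x) = invo i (so j x).
Proof.
move=> ij jK; have iK : 0 < i < K by lia.
have [a b c d] := invoP x iK; symmetry; apply: invo_eq => //.
split; try bd; first by rewrite -sc_lt ?c //; [bd|lia].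
by rewrite -sc_lt ?d //; [bd|lia].
Qed.

Lemma t_invo_lt i j x : 0 < i < j -> j < K -> to j (invo i x) = invo i (to j x).
Proof.
move=> ij jK; have iK : 0 < i < K by lia.
have [a b c d] := invoP x iK; symmetry; apply: invo_eq => //.
split; try bd; first by rewrite -tc_lt ?c //; [bd|lia].
by rewrite -tc_lt ?d //; [bd|lia].
Qed.

End Inverses.

Ltac bstep_inv ::=
  match goal with
  | |- context [@so _ ?j (@invo _ ?i ?x)] =>
      first [ rewrite (@s_invo _ i x); [|ar] | rewrite (@s_invo_gt _ i j x); [|ar|ar]
            | rewrite (@s_invo_lt _ i j x); [|ar|ar] ]
  | |- context [@to _ ?j (@invo _ ?i ?x)] =>
      first [ rewrite (@t_invo _ i x); [|ar] | rewrite (@t_invo_gt _ i j x); [|ar|ar]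
            | rewrite (@t_invo_lt _ i j x); [|ar|ar] ]
  end.

Notation "x *_ i y" := (co i x y) (at level 40, i at level 2, left associativity,
  format "x  *_ i  y").

(** * Whiskering and interchange *)

Section Whiskers.

Variable A : ocat.
Local Notation K := (od A).
Implicit Types x y z w : A.

Lemma dimW i j x : dim i x -> i <= j < K -> dim j x.
Proof. by move=> d ij; rewrite /dim; apply: dim_s ij. Qed.

Lemma dim_co i j x y : i < j < K -> to i x = so i y -> dim j x -> dim j y ->
  dim j (x *_i y).
Proof. by move=> ij e dx dy; rewrite /dim; bds. Qed.

Lemma co_dd i x : i < K -> dim i x -> x *_i x = x.
Proof. by move=> iK d; rewrite -{1}d co_sl. Qed.

Lemma wl_co i w x y : 0 < i < K -> dim i w -> to 0 w = so 0 x -> to i x = so i y ->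
  w *_0 (x *_i y) = (w *_0 x) *_i (w *_0 y).
Proof.
move=> iK dw e e'; rewrite co_exch ?co_dd //; try bd; lia.
Qed.

Lemma wr_co i w x y : 0 < i < K -> dim i w -> to 0 x = so 0 w -> to i x = so i y ->
  (x *_i y) *_0 w = (x *_0 w) *_i (y *_0 w).
Proof.
move=> iK dw e e'; rewrite co_exch ?co_dd //; try bd; lia.
Qed.

(** Here and in [int_l], a 0-composite is performed as two whiskered cells in sequence, in either
    order; comparing the two orders is what moves one cell past another. *)
Lemma int_r x y : 1 < K -> to 0 x = so 0 y ->
  x *_0 y = (x *_0 so 1 y) *_1 (to 1 x *_0 y).
Proof. by move=> K1 e; rewrite co_exch ?co_tr ?co_sl //; bd. Qed.

Lemma int_l x y : 1 < K -> to 0 x = so 0 y ->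
  x *_0 y = (so 1 x *_0 y) *_1 (x *_0 to 1 y).
Proof. by move=> K1 e; rewrite co_exch ?co_tr ?co_sl //; bd. Qed.

Lemma co_injl i x y z : 0 < i < K -> to i x = so i z -> to i y = so i z ->
  x *_i z = y *_i z -> x = y.
Proof.
move=> iK ex ey /(f_equal (fun a : A => a *_i invo i z)); have iK' : i < K by lia.
by rewrite !coA ?co_xV -?ex ?co_tr //; [rewrite ex -ey co_tr | bd..].
Qed.

Lemma invo_co i j x y : i < j < K -> 0 < j -> to i x = so i y ->
  invo j (x *_i y) = invo j x *_i invo j y.
Proof.
move=> ij j0 e; apply: invo_eq; first lia.
have jK : 0 < j < K by lia.
have e' : to i (invo j x) = so i (invo j y) by bd.
split; try bd.
  by rewrite co_exch ?co_xV; try bd.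
by rewrite co_exch ?co_Vx; try bd.
Qed.

End Whiskers.

Ltac sc := first [done | lia | bd].

Lemma leD_trans i j n : i <= j -> leD j n -> leD i n.
Proof. by case: n => //= m; lia. Qed.

Ltac arD := solve [done | lia | eapply leD_trans; [|eassumption]; lia].

(** * The one-sorted presentation of the underlying K-category *)

Section Ambient.

Variables (n : edim) (C : globcat) (HC : is_n1cat n C) (K : nat) (HK : leD K n).

Let Cn : is_ncat n C := proj1 HC.

Let sK i (x : C K) : C K := idc K (src i x).
Let tK i (x : C K) : C K := idc K (tgt i x).

Lemma src_idcK i j (a : C j) : i < j <= K -> src i (idc K a) = src i a.
Proof.
move=> ij; have [e|jK] := eqVneq j K; first by subst j; rewrite (idc_refl Cn).
rewrite -(src_src Cn (j := j)) //; last by lia.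
by rewrite (src_idc Cn) ?(idc_refl Cn) //; arD.
Qed.

Lemma tgt_idcK i j (a : C j) : i < j <= K -> tgt i (idc K a) = tgt i a.
Proof.
move=> ij; have [e|jK] := eqVneq j K; first by subst j; rewrite (idc_refl Cn).
rewrite -(tgt_tgt Cn (j := j)) //; last by lia.
by rewrite (tgt_idc Cn) ?(idc_refl Cn) //; arD.
Qed.

Lemma src_idcK_ge i j (a : C j) : j <= i < K -> src i (idc K a) = idc i a.
Proof. by move=> ij; rewrite (src_idc Cn). Qed.

Lemma tgt_idcK_ge i j (a : C j) : j <= i < K -> tgt i (idc K a) = idc i a.
Proof. by move=> ij; rewrite (tgt_idc Cn). Qed.

Lemma idcK_idc i j (a : C i) : i <= j <= K -> idc K (idc j a) = idc K a.
Proof. by move=> ij; rewrite (idc_idc Cn). Qed.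

Lemma idcK_inj j (a b : C j) : j <= K -> idc K a = idc K b -> a = b.
Proof.
move=> jK; have [e|ne] := eqVneq j K.
  by subst j; rewrite !(idc_refl Cn).
by move=> /(f_equal (src j)); rewrite !src_idcK_ge ?(idc_refl Cn) //; first [lia|arD].
Qed.

Lemma idcK_comp i j (f g : C j) : i < j <= K -> tgt i f = src i g ->
  idc K (compo i f g) = compo i (idc K f) (idc K g).
Proof. by move=> ij e; rewrite (idc_comp Cn). Qed.

Lemma tK_sK i x y : i < K -> tK i x = sK i y -> tgt i x = src i y.
Proof. by move=> iK /idcK_inj; apply; lia. Qed.

Lemma amb_inv j x : 0 < j < K -> (j.+1 < K -> sK j.+1 x = x) ->
  exists y, is_inv sK tK (@compo C K) j x y.
Proof.
move=> jK dx.
(* By [dx], [x] is the identity on a [j.+1]-cell, which is the dimension where [C] provides a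
   [j]-inverse. *)
have [f ->] : exists f : C j.+1, x = idc K f.
  have [e|ne] := eqVneq j.+1 K; last by exists (src j.+1 x); symmetry; apply: dx; lia.
  by move: x {dx}; rewrite /sK -e => x; exists x; rewrite (idc_refl Cn) // e.
have [||g [/= ga gb gc gd]] := HC.2 _ f; [lia|by apply: leD_trans HK; lia|].
exists (idc K g).
rewrite /is_inv /sK /tK !src_idcK ?tgt_idcK ?ga ?gb -?idcK_comp ?ga ?gb ?gc ?gd //; try lia.
by split; rewrite ?idcK_idc //; lia.
Qed.

(** Left transparent, since later proofs use by conversion that the carrier is [C K] and that
    [so i x] is [idc K (src i x)]. *)
Definition amb : ocat.
Proof.
apply: (@OCat (C K) K sK tK (fun i => compo i) _ _ _ _ _ _ _ _ _ _ _ _ _ _ _ _ amb_inv).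
all: rewrite /sK /tK.
- move=> i j x ij; have [e|nij] := eqVneq i j; first subst j.
    by rewrite src_idcK_ge ?(idc_refl Cn) //; arD.
  by rewrite src_idcK ?(src_src Cn) //; lia.
- by move=> i j x ij; rewrite src_idcK ?(src_tgt Cn) //; lia.
- by move=> i j x ij; rewrite tgt_idcK ?(tgt_src Cn) //; lia.
- move=> i j x ij; have [e|nij] := eqVneq i j; first subst j.
    by rewrite tgt_idcK_ge ?(idc_refl Cn) //; arD.
  by rewrite tgt_idcK ?(tgt_tgt Cn) //; lia.
- by move=> i j x ij; rewrite src_idcK_ge ?idcK_idc //; lia.
- by move=> i j x ij; rewrite src_idcK_ge ?idcK_idc //; lia.
- by move=> i j x ij; rewrite tgt_idcK_ge ?idcK_idc //; lia.
- by move=> i j x ij; rewrite tgt_idcK_ge ?idcK_idc //; lia.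
- by move=> i x y iK /tK_sK e; rewrite (src_comp Cn) ?e.
- by move=> i x y iK /tK_sK e; rewrite (tgt_comp Cn) ?e.
- move=> i j x y ij /tK_sK e; rewrite (src_comp_lt Cn) ?e //; try lia.
  rewrite idcK_comp //; first lia.
  by rewrite (tgt_src Cn) ?(src_src Cn) ?e //; lia.
- move=> i j x y ij /tK_sK e; rewrite (tgt_comp_lt Cn) ?e //; try lia.
  rewrite idcK_comp //; first lia.
  by rewrite (tgt_tgt Cn) ?(src_tgt Cn) ?e //; lia.
- by move=> i x y z iK /tK_sK e /tK_sK e'; rewrite (comp_assoc Cn) ?e ?e'.
- by move=> i x iK; rewrite (comp_idl Cn).
- by move=> i x iK; rewrite (comp_idr Cn).
- move=> i j x x' y y' ij /tK_sK e1 /tK_sK e2 /tK_sK e3.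
  by rewrite (exchange Cn) ?e1 ?e2 ?e3 //; lia.
Defined.

End Ambient.

(** * Displayed categories and freeness *)

(* A category over the [k.+1]-category underlying [C], given by its
   [k.+1]-cells [X] only: below dimension [k.+1], it coincides with [C]. *)
Record displayed (C : globcat) (k : nat) (X : Type) (p : X -> C k.+1)
    (u : C k -> X) (m : nat -> X -> X -> X) : Prop := Displayed {
  dis_unit : forall a, p (u a) = idc k.+1 a;
  dis_comp : forall i x y, i <= k -> tgt i (p x) = src i (p y) ->
    p (m i x y) = compo i (p x) (p y);
  dis_assoc : forall i x y z, i <= k -> tgt i (p x) = src i (p y) ->
    tgt i (p y) = src i (p z) -> m i (m i x y) z = m i x (m i y z);
  dis_idl : forall i x, i <= k -> m i (u (idc k (src i (p x)))) x = x;
  dis_idr : forall i x, i <= k -> m i x (u (idc k (tgt i (p x)))) = x;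
  dis_unit_comp : forall i a b, i < k -> tgt i a = src i b ->
    u (compo i a b) = m i (u a) (u b);
  dis_exch : forall i j x x' y y', i < j <= k ->
    tgt j (p x) = src j (p y) -> tgt j (p x') = src j (p y') ->
    tgt i (p x) = src i (p x') ->
    m j (m i x x') (m i y y') = m i (m j x y) (m j x' y');
  dis_inv : 0 < k -> forall x, exists y,
    [/\ src k (p y) = tgt k (p x), tgt k (p y) = src k (p x),
        m k x y = u (src k (p x)) & m k y x = u (tgt k (p x))] }.

(** * The total category of a displayed category *)

Section Total.

Variables (n : edim) (C : globcat) (HC : is_n1cat n C) (k : nat).
Hypothesis (HK : leD k.+1 n).
Variables (X : Type) (p : X -> C k.+1) (u : C k -> X) (m : nat -> X -> X -> X).
Hypothesis HX : displayed p u m.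

Let Cn : is_ncat n C := proj1 HC.

(* The [j]-cells of the total category, for [j <= k.+1], are encoded as pairs
   so as to avoid casts; the second component is redundant for [j <= k]. *)
Definition tot_ok j (q : C j * X) : Prop :=
  (j <= k.+1 -> p q.2 = idc k.+1 q.1) /\ (j <= k -> q.2 = u (idc k q.1)).

Definition tot_cell j : Type := {q : C j * X | tot_ok q}.

Definition tot_def j (a : C k) : tot_cell j.
Proof.
exists (if j <= k then (idc j a, u (idc k (idc j a))) else (idc j a, u a)).
rewrite /tot_ok; case: (leqP j k) => jk /=; split=> //; rewrite ?(dis_unit HX).
  by move=> _; rewrite (idc_idc Cn) //; lia.
move=> jk'; have -> : j = k.+1 by lia.
by rewrite (idc_refl Cn).
Defined.

(** The operations of a [globcat] are total, so pairs violating [tot_ok] must also be sent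
    somewhere: the pair itself is returned when it is valid, an unspecified cell otherwise. The
    argument [a] serves only to inhabit the type. *)
Definition mk j (g : C j) (x : X) (a : C k) : tot_cell j :=
  epsilon (inhabits (tot_def j a)) (fun q => sval q = (g, x)).

Lemma mkP j (g : C j) x a : tot_ok (g, x) -> sval (mk g x a) = (g, x).
Proof.
move=> h; rewrite /mk.
by apply: (epsilon_spec (inhabits (tot_def j a)) (fun q => sval q = (g, x))); exists (exist _ _ h).
Qed.

Lemma tot_eq j (q r : tot_cell j) : sval q = sval r -> q = r.
Proof.
case: q r => [q hq] [r hr] /= e; subst r.
by rewrite (proof_irrelevance _ hq hr).
Qed.

Definition fst_t j (q : tot_cell j) : C j := (sval q).1.
Definition snd_t j (q : tot_cell j) : X := (sval q).2.

Definition tot : globcat := @GlobCat tot_cell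
  (fun j i q => mk (src i (fst_t q)) (u (idc k (src i (fst_t q)))) (idc k (fst_t q)))
  (fun j i q => mk (tgt i (fst_t q)) (u (idc k (tgt i (fst_t q)))) (idc k (fst_t q)))
  (fun j l q => mk (idc l (fst_t q)) (snd_t q) (idc k (fst_t q)))
  (fun j i q r => mk (compo i (fst_t q) (fst_t r)) (m i (snd_t q) (snd_t r)) (idc k (fst_t q))).

Lemma tot_p j (q : tot j) : j <= k.+1 -> p (snd_t q) = idc k.+1 (fst_t q).
Proof. exact: (proj1 (proj2_sig q)). Qed.

Lemma tot_u j (q : tot j) : j <= k -> snd_t q = u (idc k (fst_t q)).
Proof. exact: (proj2 (proj2_sig q)). Qed.

Lemma ok_u i (g : C i) : i <= k -> tot_ok (g, u (idc k g)).
Proof. by move=> ik; split=> //= _; rewrite (dis_unit HX) (idc_idc Cn) //; lia. Qed.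

Lemma tot_src j i (q : tot j) : i <= k ->
  sval (src i q) = (src i (fst_t q), u (idc k (src i (fst_t q)))).
Proof. by move=> ik; apply: mkP; apply: ok_u. Qed.

Lemma tot_tgt j i (q : tot j) : i <= k ->
  sval (tgt i q) = (tgt i (fst_t q), u (idc k (tgt i (fst_t q)))).
Proof. by move=> ik; apply: mkP; apply: ok_u. Qed.

Lemma tot_idc j l (q : tot j) : j <= l <= k.+1 ->
  sval (idc l q) = (idc l (fst_t q), snd_t q).
Proof.
move=> jl; apply: mkP; split=> /= h.
  by rewrite tot_p ?(idc_idc Cn) //; lia.
rewrite tot_u ?(idc_idc Cn) //; first [lia|arD].
Qed.

Lemma fst_src j i (q : tot j) : i <= k -> fst_t (src i q) = src i (fst_t q).
Proof. by move=> ik; rewrite /fst_t tot_src. Qed.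

Lemma fst_tgt j i (q : tot j) : i <= k -> fst_t (tgt i q) = tgt i (fst_t q).
Proof. by move=> ik; rewrite /fst_t tot_tgt. Qed.

Lemma tot_tgt_src i j (q r : tot j) : i <= k -> tgt i q = src i r ->
  tgt i (fst_t q) = src i (fst_t r).
Proof. by move=> ik e; rewrite -fst_src // -fst_tgt // e. Qed.

Lemma tot_comp_ok i j (q r : tot j) : i < j <= k.+1 ->
  tgt i (fst_t q) = src i (fst_t r) ->
  tot_ok (compo i (fst_t q) (fst_t r), m i (snd_t q) (snd_t r)).
Proof.
move=> ij e; split=> /= h.
  rewrite (dis_comp HX) ?tot_p ?(idc_comp Cn) //; first by lia.
  by rewrite (tgt_idcK HC) ?(src_idcK HC).
rewrite !tot_u // (idc_comp Cn) ?e //; [|lia|arD].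
have [ek|nk] := eqVneq j k.
  subst j; rewrite !(idc_refl Cn) ?(dis_unit_comp HX) //; first [lia|arD].
rewrite (dis_unit_comp HX) //; first lia.
by rewrite (tgt_idcK HC) ?(src_idcK HC) //; first [lia|arD].
Qed.

Lemma tot_comp i j (q r : tot j) : i < j <= k.+1 ->
  tgt i (fst_t q) = src i (fst_t r) ->
  sval (compo i q r) = (compo i (fst_t q) (fst_t r), m i (snd_t q) (snd_t r)).
Proof. by move=> ij e; apply: mkP; apply: tot_comp_ok. Qed.

Lemma totE j (q : tot j) : sval q = (fst_t q, snd_t q).
Proof. by rewrite /fst_t /snd_t; case: (sval q). Qed.

Lemma tot_eq_lt j (q r : tot j) : j <= k -> fst_t q = fst_t r -> q = r.
Proof. by move=> jk e; apply: tot_eq; rewrite !totE !tot_u // e. Qed.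

Lemma fst_idc j l (q : tot j) : j <= l <= k.+1 -> fst_t (idc l q) = idc l (fst_t q).
Proof. by move=> jl; rewrite /fst_t tot_idc. Qed.

Lemma snd_idc j l (q : tot j) : j <= l <= k.+1 -> snd_t (idc l q) = snd_t q.
Proof. by move=> jl; rewrite /snd_t tot_idc. Qed.

Lemma fst_comp i j (q r : tot j) : i < j <= k.+1 ->
  tgt i (fst_t q) = src i (fst_t r) ->
  fst_t (compo i q r) = compo i (fst_t q) (fst_t r).
Proof. by move=> ij e; rewrite /fst_t tot_comp. Qed.

Lemma snd_comp i j (q r : tot j) : i < j <= k.+1 ->
  tgt i (fst_t q) = src i (fst_t r) ->
  snd_t (compo i q r) = m i (snd_t q) (snd_t r).
Proof. by move=> ij e; rewrite /snd_t tot_comp. Qed.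

Lemma tot_snd_comp i j (q r : tot j) : i < j <= k.+1 ->
  tgt i (fst_t q) = src i (fst_t r) -> tgt i (p (snd_t q)) = src i (p (snd_t r)).
Proof.
move=> ij e; rewrite !tot_p; try lia.
by rewrite (tgt_idcK HC) ?(src_idcK HC) //; lia.
Qed.

(** Up to dimension [k] the second component is determined by the first, so an equation between such
    cells is one in [C] ([tot_eq_lt]). The remaining laws combine those of [C] with those of
    [displayed]. *)
Lemma tot_ncat : is_ncat (Some k.+1) tot.
Proof.
have leDk j : leD j (Some k.+1) -> leD j n by move=> /= jk; arD.
split.
- move=> i j l f ij lk; rewrite /= in lk; apply: tot_eq_lt; first lia.
  by rewrite !fst_src ?(src_src Cn)//; first [lia | apply: leDk => /=; lia].
- move=> i j l f ij lk; rewrite /= in lk; apply: tot_eq_lt; first lia.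
  by rewrite !(fst_src, fst_tgt) ?(src_tgt Cn)//; first [lia | apply: leDk => /=; lia].
- move=> i j l f ij lk; rewrite /= in lk; apply: tot_eq_lt; first lia.
  by rewrite !(fst_src, fst_tgt) ?(tgt_src Cn)//; first [lia | apply: leDk => /=; lia].
- move=> i j l f ij lk; rewrite /= in lk; apply: tot_eq_lt; first lia.
  by rewrite !(fst_src, fst_tgt) ?(tgt_tgt Cn)//; first [lia | apply: leDk => /=; lia].
- move=> l f lk; rewrite /= in lk; apply: tot_eq; rewrite totE fst_idc ?snd_idc ?leqnn //.
  by rewrite (idc_refl Cn) -?totE //; apply: leDk.
- move=> l j l' f jl lk; rewrite /= in lk; apply: tot_eq; rewrite !totE.
  rewrite !fst_idc ?snd_idc ?(idc_idc Cn) ?snd_idc //; first [lia | apply: leDk => /=; lia].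
- move=> l j l' f jl lk; rewrite /= in lk; apply: tot_eq_lt; first lia.
  rewrite fst_src ?fst_idc ?(src_idc Cn) //; first [lia | apply: leDk => /=; lia].
- move=> l j l' f jl lk; rewrite /= in lk; apply: tot_eq_lt; first lia.
  rewrite fst_tgt ?fst_idc ?(tgt_idc Cn) //; first [lia | apply: leDk => /=; lia].
- move=> i l f g il lk /tot_tgt_src e; rewrite /= in lk; have {}e := e ltac:(lia).
  apply: tot_eq_lt; first lia.
  rewrite !fst_src ?fst_comp ?(src_comp Cn) ?e //; first [lia | apply: leDk => /=; lia].
- move=> i l f g il lk /tot_tgt_src e; rewrite /= in lk; have {}e := e ltac:(lia).
  apply: tot_eq_lt; first lia.
  rewrite !fst_tgt ?fst_comp ?(tgt_comp Cn) ?e //; first [lia | apply: leDk => /=; lia].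
- move=> i j l f g il lk /tot_tgt_src e; rewrite /= in lk; have {}e := e ltac:(lia).
  have e1 : tgt i (src j (fst_t f)) = src i (src j (fst_t g)).
    by rewrite (tgt_src Cn) ?(src_src Cn) //; apply: leDk.
  apply: tot_eq_lt; first lia.
  rewrite !fst_src ?fst_comp ?(src_comp_lt Cn) ?fst_src //; first [lia | apply: leDk => /=; lia].
- move=> i j l f g il lk /tot_tgt_src e; rewrite /= in lk; have {}e := e ltac:(lia).
  have e1 : tgt i (tgt j (fst_t f)) = src i (tgt j (fst_t g)).
    by rewrite (tgt_tgt Cn) ?(src_tgt Cn) //; apply: leDk.
  apply: tot_eq_lt; first lia.
  rewrite !fst_tgt ?fst_comp ?(tgt_comp_lt Cn) ?fst_tgt //; first [lia | apply: leDk => /=; lia].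
- move=> i l f g h il lk /tot_tgt_src e /tot_tgt_src e'; rewrite /= in lk.
  have {}e := e ltac:(lia); have {}e' := e' ltac:(lia).
  have ln := leDk _ lk.
  have e1 : tgt i (compo i (fst_t f) (fst_t g)) = src i (fst_t h).
    by rewrite (tgt_comp Cn).
  have e2 : tgt i (fst_t f) = src i (compo i (fst_t g) (fst_t h)).
    by rewrite (src_comp Cn).
  have il' : i < l <= k.+1 by rewrite il.
  have ik : i <= k by lia.
  apply: tot_eq; rewrite !totE !fst_comp ?fst_comp //.
  rewrite !snd_comp ?fst_comp ?snd_comp //.
  by rewrite (comp_assoc Cn) // (dis_assoc HX) //; apply: tot_snd_comp.
- move=> i l f il lk; rewrite /= in lk; have ln := leDk _ lk; rewrite /= in lk; have ik : i <= k by lia.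
  have e : tgt i (fst_t (idc l (src i f))) = src i (fst_t f).
    rewrite fst_idc ?fst_src //; last lia.
    rewrite (tgt_idc Cn) ?(idc_refl Cn) //; try lia; by arD.
  apply: tot_eq; rewrite totE fst_comp ?snd_comp //; try lia.
  rewrite snd_idc ?fst_idc ?fst_src ?(comp_idl Cn) //; try lia.
  rewrite [snd_t (src i f)]tot_u // fst_src // totE; congr pair.
  by have := dis_idl HX (snd_t f) ik; rewrite tot_p // (src_idcK HC) //; lia.
- move=> i l f il lk; rewrite /= in lk; have ln := leDk _ lk; rewrite /= in lk; have ik : i <= k by lia.
  have e : tgt i (fst_t f) = src i (fst_t (idc l (tgt i f))).
    rewrite fst_idc ?fst_tgt //; last lia.
    rewrite (src_idc Cn) ?(idc_refl Cn) //; try lia; by arD.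
  apply: tot_eq; rewrite totE fst_comp ?snd_comp //; try lia.
  rewrite snd_idc ?fst_idc ?fst_tgt ?(comp_idr Cn) //; try lia.
  rewrite [snd_t (tgt i f)]tot_u // fst_tgt // totE; congr pair.
  by have := dis_idr HX (snd_t f) ik; rewrite tot_p // (tgt_idcK HC) //; lia.
- move=> i l l' f g il lk /tot_tgt_src e; rewrite /= in lk; have {}e := e ltac:(lia).
  have ln := leDk _ lk.
  have e1 : tgt i (idc l' (fst_t f)) = src i (idc l' (fst_t g)).
    by rewrite (tgt_idcK HC ln) ?(src_idcK HC ln) //; lia.
  apply: tot_eq; rewrite !totE !(fst_idc, snd_idc); try lia.
  rewrite !fst_comp ?snd_comp ?snd_idc ?fst_idc ?(idc_comp Cn) //; try lia.
- move=> i j l f f' g g' il lk /tot_tgt_src e1 /tot_tgt_src e2 /tot_tgt_src e3; rewrite /= in lk.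
  have {}e1 := e1 ltac:(lia); have {}e2 := e2 ltac:(lia); have {}e3 := e3 ltac:(lia).
  have ln := leDk _ lk.
  have d1 : tgt i (fst_t g) = src i (fst_t g').
    by rewrite -(tgt_src Cn (i := i) (j := j)) // -e1 -(src_src Cn (i := i) (j := j)) // -e2
      (tgt_tgt Cn) // (src_tgt Cn).
  have d2 : tgt j (compo i (fst_t f) (fst_t f')) = src j (compo i (fst_t g) (fst_t g')).
    by rewrite (tgt_comp_lt Cn) // (src_comp_lt Cn) // e1 e2.
  have d3 : tgt i (compo j (fst_t f) (fst_t g)) = src i (compo j (fst_t f') (fst_t g')).
    rewrite -(tgt_src Cn (i := i) (j := j)) // -(src_src Cn (i := i) (j := j)) // !(src_comp Cn) //; try lia; try exact: leDk.
    by rewrite (tgt_src Cn) // (src_src Cn).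
  have il' : i < l <= k.+1 by lia.
  have jl' : j < l <= k.+1 by lia.
  apply: tot_eq; rewrite !totE !fst_comp ?fst_comp //.
  rewrite !snd_comp ?fst_comp ?snd_comp // (exchange Cn) //.
  by congr pair; rewrite (dis_exch HX) //; try lia; apply: tot_snd_comp.
Qed.

Lemma tot_n1cat : is_n1cat (Some k.+1) tot.
Proof.
split; first exact: tot_ncat.
move=> j q j1 jk; rewrite /= in jk; have jj : j.-1 < j <= k.+1 by lia.
have jk1 : j.-1 <= k by lia.
have [e|ne] := eqVneq j k.+1; last first.
  have [g [ga gb gc gd]] : exists g, is_inverse (fst_t q) g.
    by apply: (proj2 HC) => //; arD.
  have jk2 : j <= k by lia.
  pose r : tot j := mk g (u (idc k g)) (idc k (fst_t q)).
  have er : fst_t r = g by rewrite /fst_t mkP //; apply: ok_u.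
  exists r; split; apply: tot_eq_lt => //.
  - by rewrite fst_src // fst_tgt // er.
  - by rewrite fst_src // fst_tgt // er.
  - rewrite fst_comp ?er ?fst_idc ?fst_src //; lia.
  - rewrite fst_comp ?er ?fst_idc ?fst_tgt //; lia.
subst j; rewrite /is_inverse [k.+1.-1]/=.
have [//|y [ya yb yc yd]] := dis_inv HX _ (snd_t q).
have pq : p (snd_t q) = fst_t q by rewrite tot_p // (idc_refl Cn).
rewrite pq in ya yb yc yd.
have ok : tot_ok (p y, y) by split=> /=; [rewrite (idc_refl Cn) | lia].
pose r : tot k.+1 := mk (p y) y (idc k (fst_t q)).
have er : fst_t r = p y by rewrite /fst_t mkP.
have er' : snd_t r = y by rewrite /snd_t mkP.
exists r; split.
- by apply: tot_eq_lt => //; rewrite fst_src // fst_tgt // er.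
- by apply: tot_eq_lt => //; rewrite fst_src // fst_tgt // er.
- apply: tot_eq; rewrite !totE fst_comp ?snd_comp ?er ?er' //.
  rewrite fst_idc ?snd_idc ?fst_src // ?[snd_t (src k q)]tot_u ?fst_src //; try lia.
  rewrite yc (idc_refl Cn) //; last arD.
  have := dis_comp HX (i := k) (x := snd_t q) (y := y) (leqnn _).
  by rewrite yc (dis_unit HX) pq ya => /(_ erefl) <-.
- apply: tot_eq; rewrite !totE fst_comp ?snd_comp ?er ?er' //.
  rewrite fst_idc ?snd_idc ?fst_tgt // ?[snd_t (tgt k q)]tot_u ?fst_tgt //; try lia.
  rewrite yd (idc_refl Cn) //; last arD.
  have := dis_comp HX (i := k) (x := y) (y := snd_t q) (leqnn _).
  by rewrite yd (dis_unit HX) pq yb => /(_ erefl) <-.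
Qed.

End Total.

(* The only consequence of freeness that is used: unlike [is_free_ext], it is
   readily transported along the reversal [op] of the 0-composition. *)
Definition generates (C : globcat) (k : nat) (G : Type) (inc : G -> C k.+1) : Prop :=
  forall (X : Type) (p : X -> C k.+1) (u : C k -> X) (m : nat -> X -> X -> X),
    displayed p u m -> (forall g, exists x, p x = inc g) ->
    exists r : C k.+1 -> X,
      [/\ forall f, p (r f) = f,
          forall a, r (idc k.+1 a) = u a &
          forall i f g, i <= k -> tgt i f = src i g ->
            r (compo i f g) = m i (r f) (r g)].

(** The chosen lifts of the generators induce a functor [H] to the total category. Followed by the
    projection it is the identity, by uniqueness, so the second component of [H] is the required
    section. *)
Lemma free_ext_generates (n : edim) (C : globcat) (k : nat) (G : cellext k C)
    (inc : G -> C k.+1) :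
  is_n1cat n C -> leD k.+1 n -> is_free_ext (fun (j : nat) (f : C j) => f) inc ->
  generates inc.
Proof.
move=> HC HK free X p u m HX lift; have Cn := proj1 HC.
have [phi phiP] : exists phi : G -> X, forall x, p (phi x) = inc x.
  exists (fun x => proj1_sig (constructive_indefinite_description _ (lift x))) => x.
  by case: constructive_indefinite_description.
have okphi x : @tot_ok C k X p u k.+1 (inc x, phi x).
  by split=> /=; [rewrite phiP (idc_refl Cn) | lia].
pose F j (f : C j) : tot HC HK HX j := mk HC HK HX f (u (idc k f)) (idc k f).
have Ffst j f : j <= k -> fst_t (F j f) = f.
  by move=> jk; rewrite /fst_t mkP //; apply: (ok_u HC HK HX).
pose phiD x : tot HC HK HX k.+1 := mk HC HK HX (inc x) (phi x) (gsrc x).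
have phiDf x : fst_t (phiD x) = inc x by rewrite /fst_t mkP.
have phiDs x : snd_t (phiD x) = phi x by rewrite /snd_t mkP.
have Ffun : is_functor k F.
  split=> /=.
  - move=> i j f ij; apply: tot_eq_lt; first lia.
    by rewrite fst_src ?Ffst //; lia.
  - move=> i j f ij; apply: tot_eq_lt; first lia.
    by rewrite fst_tgt ?Ffst //; lia.
  - move=> j l f jl; apply: tot_eq_lt; first lia.
    by rewrite fst_idc ?Ffst //; lia.
  - move=> i j f g ij e; apply: tot_eq_lt; first lia.
    by rewrite fst_comp ?Ffst //; lia.
have [x|x|H [[Hf HJ Hi] _]] := free_univ free (tot_n1cat HC HK HX) Ffun (phi := phiD).
- by apply: tot_eq_lt => //; rewrite fst_src // phiDf Ffst // (free_src free).
- by apply: tot_eq_lt => //; rewrite fst_tgt // phiDf Ffst // (free_tgt free).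
have HnK : is_n1cat (Some k.+1) C by exact: (free_n1cat free).
(* [K0] is the functor that the universal property gives for [C] itself; both the identity and the
   projection of [H] satisfy its characterisation, hence agree. *)
have [K0 [_ Kuniq]] := free_univ free HnK (free_functor free) (free_src free) (free_tgt free).
pose P j (f : C j) : C j := fst_t (H j f).
have PE j f : j <= k.+1 -> P j f = f.
  move=> jk; transitivity (K0 j f); last first.
    symmetry; apply: (Kuniq (fun _ f => f)) => //.
  apply: Kuniq => //.
  - split=> /=.
    + move=> i l h il; rewrite /P (fun_src Hf) // fst_src //; lia.
    + move=> i l h il; rewrite /P (fun_tgt Hf) // fst_tgt //; lia.
    + move=> i l h il; rewrite /P (fun_idc Hf) // fst_idc //; lia.
    + move=> i l h h' il e; rewrite /P (fun_comp Hf) // fst_comp //.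
      apply: (tot_tgt_src); first lia.
      by rewrite -(fun_tgt Hf) // -(fun_src Hf) // e.
  - by move=> l f' lk; rewrite /P HJ // Ffst.
  - by move=> x; rewrite /P Hi.
exists (fun f => snd_t (H k.+1 f)); split.
- by move=> f; rewrite (tot_p) // [fst_t _]PE // (idc_refl Cn).
- move=> a; have kk : k <= k.+1 <= k.+1 by rewrite leqnSn leqnn.
  rewrite (fun_idc Hf) // snd_idc //.
  by rewrite tot_u // [fst_t _]PE // (idc_refl Cn) //; arD.
- move=> i f g ik e; have kk : i < k.+1 <= k.+1 by rewrite ltnS ik leqnn.
  rewrite (fun_comp Hf) // snd_comp //.
  apply: (tot_tgt_src) => //.
  by rewrite -(fun_tgt Hf) // -(fun_src Hf) // e.
Qed.

(** * Reversing the 0-composition *)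

Definition op (C : globcat) : globcat := @GlobCat C
  (fun k i f => if i is j.+1 return C i then src j.+1 f else tgt 0 f)
  (fun k i f => if i is j.+1 return C i then tgt j.+1 f else src 0 f)
  (fun k l f => idc l f)
  (fun k i f g => if i is j.+1 then compo j.+1 f g else compo 0 g f).

Lemma op_ncat n C : is_ncat n C -> is_ncat n (op C).
Proof.
move=> Cn; split.
- by move=> [|i] [|j] k f ij kn //=; rewrite ?(src_src Cn) ?(tgt_src Cn).
- by move=> [|i] [|j] k f ij kn //=; rewrite ?(src_tgt Cn) ?(tgt_tgt Cn).
- by move=> [|i] [|j] k f ij kn //=; rewrite ?(tgt_src Cn) ?(src_src Cn).
- by move=> [|i] [|j] k f ij kn //=; rewrite ?(tgt_tgt Cn) ?(src_tgt Cn).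
- by move=> k f kn /=; rewrite (idc_refl Cn).
- by move=> k j l f kn h /=; rewrite (idc_idc Cn).
- by move=> k [|j] l f kn h /=; rewrite ?(src_idc Cn) ?(tgt_idc Cn).
- by move=> k [|j] l f kn h /=; rewrite ?(src_idc Cn) ?(tgt_idc Cn).
- by move=> [|i] k f g ik kn /= e; rewrite ?(src_comp Cn) ?(tgt_comp Cn).
- by move=> [|i] k f g ik kn /= e; rewrite ?(src_comp Cn) ?(tgt_comp Cn).
- by move=> [|i] [|j] k f g ik kn //= e; rewrite (src_comp_lt Cn).
- by move=> [|i] [|j] k f g ik kn //= e; rewrite (tgt_comp_lt Cn).
- by move=> [|i] k f g h ik kn /= e e'; rewrite (comp_assoc Cn).
- by move=> [|i] k f ik kn /=; rewrite ?(comp_idl Cn) ?(comp_idr Cn).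
- by move=> [|i] k f ik kn /=; rewrite ?(comp_idl Cn) ?(comp_idr Cn).
- by move=> [|i] k l f g ik kn /= e; rewrite (idc_comp Cn).
- by move=> [|i] [|j] k f f' g g' ik kn //= e1 e2 e3; rewrite (exchange Cn).
Qed.

Lemma op_n1cat n C : is_n1cat n C -> is_n1cat n (op C).
Proof.
move=> [Cn inv]; split; first exact: op_ncat.
by move=> [|[|k]] //= f _ kn; apply: inv.
Qed.

(** Swapping the arguments of [m 0] turns a displayed category over [op C] into one over [C], with
    the same sections. The inverses concern composition [k > 0], which is not reversed. *)
Lemma op_generates (C : globcat) k G (inc : G -> C k.+1) :
  generates inc -> generates (C := op C) inc.
Proof.
move=> gen X p u m HX lift.
pose m' i x y := if i is j.+1 then m j.+1 x y else m 0 y x.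
have [|r [r1 r2 r3]] := gen X p u m' _ lift.
  split.
  - exact: (dis_unit HX).
  - by move=> [|i] x y ik e; rewrite /m'; [exact: (dis_comp HX (i := 0)) | exact: (dis_comp HX (i := i.+1))].
  - move=> [|i] x y z ik e e'; rewrite /m'; last exact: (dis_assoc HX (i := i.+1)).
    by symmetry; apply: (dis_assoc HX (i := 0)).
  - by move=> [|i] x ik; rewrite /m'; [exact: (dis_idr HX (i := 0)) | exact: (dis_idl HX (i := i.+1))].
  - by move=> [|i] x ik; rewrite /m'; [exact: (dis_idl HX (i := 0)) | exact: (dis_idr HX (i := i.+1))].
  - by move=> [|i] a b ik e; rewrite /m'; [exact: (dis_unit_comp HX (i := 0)) | exact: (dis_unit_comp HX (i := i.+1))].
  - move=> [|i] [|j] // x x' y y' ij e1 e2 e3; rewrite /m'.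
      exact: (dis_exch HX (i := 0) (j := j.+1)).
    exact: (dis_exch HX (i := i.+1) (j := j.+1)).
  - case: k inc gen p u HX lift => // k inc gen p u HX lift _ x; exact: (dis_inv HX).
exists r; split=> // -[|i] f g ik e /=; first by rewrite r3.
exact: (r3 i.+1).
Qed.

(** * Families of fillers *)

Section Families.

Variables (A : ocat) (m : nat).
Local Notation K := (od A).
Implicit Types x y z w f g : A.

(* [sg] is the strategy on 1-cells and [h x] stands for [\hat x] on [m]-cells;
   [norm w], below, is [\hat w]. *)
Record hats (h sg : A -> A) : Prop := Hats {
  sg_s : forall w, dim 1 w -> so 1 (sg w) = w;
  sg_dim : forall w, dim 1 w -> dim 2 (sg w);
  sg_cell : forall x, dim 2 x -> to 1 (sg (so 1 x)) = to 1 (sg (to 1 x));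
  sg_norm : forall w, dim 1 w -> sg (to 1 (sg w)) = to 1 (sg w);
  sg_co : forall w v, dim 1 w -> dim 1 v -> to 0 w = so 0 v ->
    sg (w *_0 v) = (sg w *_0 v) *_1 sg (to 1 (sg w) *_0 v);
  h_dim : forall x, dim m x -> dim m (h x);
  h_s : forall i x, dim m x -> i < m -> so i (h x) = so i x;
  h_t : forall i x, dim m x -> i < m -> to i (h x) = to i x;
  h_par : forall x y, dim m x -> dim m y ->
    so m.-1 x = so m.-1 y -> to m.-1 x = to m.-1 y -> h x = h y;
  h_id : forall x, dim m.-1 x -> h x = x;
  h_co : forall i x y, 0 < i < m -> dim m x -> dim m y -> to i x = so i y ->
    h (x *_i y) = h x *_i h y;
  h_co0 : forall x y, dim m x -> dim m y -> to 0 x = so 0 y ->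
    h (x *_0 y) = (h x *_0 so 1 y) *_1 h (to 1 x *_0 y);
  h_sg : forall w, dim 1 w -> h (sg w) = sg w;
  h_2 : forall x, m = 2 -> dim 2 x -> h x = sg (so 1 x) *_1 invo 1 (sg (to 1 x)) }.

Hypotheses (mK : 1 < m < K).
Variables (h sg : A -> A).
Hypothesis (H : hats h sg).
Hypothesis (fill2 : forall x, 2 < m -> dim 2 x -> so 1 x = to 1 x ->
  exists y, so 2 y = x /\ to 2 y = so 1 x).

Definition norm w := to 1 (sg w).

Lemma norm_dim w : dim 1 (norm w).
Proof. by apply: dim_to; lia. Qed.

Lemma norm_norm w : dim 1 w -> norm (norm w) = norm w.
Proof. by move=> dw; rewrite /norm (sg_norm H) //; bd. Qed.

Lemma sg_sim w : dim 1 w -> sim 1 (sg w) w.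
Proof. by move=> dw; split; [rewrite (sg_s H) | lia]. Qed.

Lemma norm_t w : dim 1 w -> to 0 (norm w) = to 0 w.
Proof. by move=> dw; have sw := sg_sim dw; rewrite /norm; bd. Qed.

(** [sg w *_0 v] is a 2-cell from [w *_0 v] to [norm w *_0 v], and 1-cells joined by a 2-cell have
    the same normal form. *)
Lemma norm_co w v : dim 1 w -> dim 1 v -> to 0 w = so 0 v ->
  norm (norm w *_0 v) = norm (w *_0 v).
Proof.
move=> dw dv e; have sw := sg_sim dw; have dn := norm_dim w.
have d1 := sg_dim H dw.
have := sg_cell H (x := sg w *_0 v).
have -> : so 1 (sg w *_0 v) = w *_0 v by bd.
have -> : to 1 (sg w *_0 v) = norm w *_0 v.
  by rewrite /norm; bd.
rewrite /norm => ->; first by [].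
by apply: dim_co => //; [lia | bd | apply: dimW dv _; lia].
Qed.

(* [T w : w f -> \hat{w f}] for every 1-cell [w], compatible with the 2-cell
   [sg w : w -> \hat w]. *)
Definition fam f (T : A -> A) : Prop := forall w, dim 1 w -> to 0 w = so 0 f ->
  [/\ so m (T w) = w *_0 f, to m (T w) = h (w *_0 f) &
      T w *_1 (sg w *_0 to 1 f) = (sg w *_0 so 1 f) *_1 T (norm w)].

Lemma fam_sim f T w : fam f T -> dim 1 w -> to 0 w = so 0 f -> sim m (T w) (w *_0 f).
Proof. by move=> F dw e; have [a _ _] := F w dw e; split=> //; lia. Qed.

(** The two sides of the naturality condition are [sg w *_0 a] sequenced in its two possible
    orders. *)
Lemma fam_id a : dim m.-1 a -> fam a (fun w => w *_0 a).
Proof.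
move=> da w dw e.
have sw := sg_sim dw; have dn := norm_dim w.
have dsg := sg_dim H dw.
have dwa : dim m.-1 (w *_0 a).
  have [e1|ne] := eqVneq m.-1 1.
    by rewrite e1 in da *; apply: dim_co => //; lia.
  by apply: dim_co => //; [lia | apply: dimW dw _; lia].
have dwa' : dim m (w *_0 a) by apply: dimW dwa _; lia.
split; [bd | by rewrite (h_id H) //; bd |].
rewrite -{1}(sg_s H dw) -int_l //; [|lia|bd].
by rewrite int_r //; [lia | bd].
Qed.

Lemma fam_co i f g T U : 0 < i < m -> dim m f -> dim m g -> to i f = so i g ->
  fam f T -> fam g U -> fam (f *_i g) (fun w => T w *_i U w).
Proof.
move=> im df dg e FT FU w dw ew.
have s0 : so 0 (f *_i g) = so 0 f by bd.
have ewf : to 0 w = so 0 f by rewrite ew.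
have ewg : to 0 w = so 0 g by rewrite ewf; apply: comp_s0 e; lia.
have [a1 a2 a3] := FT w dw ewf; have [b1 b2 b3] := FU w dw ewg.
have st := fam_sim FT dw ewf; have su := fam_sim FU dw ewg.
have sw := sg_sim dw; have dn := norm_dim w; have dsg := sg_dim H dw.
have nw : to 1 (sg w) = norm w by [].
have ewf' : to 0 (norm w) = so 0 f by rewrite norm_t.
have ewg' : to 0 (norm w) = so 0 g by rewrite norm_t.
have st' := fam_sim FT dn ewf'; have su' := fam_sim FU dn ewg'.
have eTU : to i (T w) = so i (U w) by bd.
have dwf : dim m (w *_0 f).
  by apply: dim_co => //; [lia | apply: dimW dw _; lia].
have dwg : dim m (w *_0 g).
  by apply: dim_co => //; [lia | apply: dimW dw _; lia].
split.
- by rewrite sc_lt //; [rewrite a1 b1 wl_co //; [lia | apply: dimW dw _; lia] | lia].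
- rewrite tc_lt //; last lia.
  rewrite a2 b2 -(h_co H) //; last by bd.
  by rewrite wl_co //; [lia | apply: dimW dw _; lia].
(* For [i = 1] the two naturality squares are pasted; for [i > 1] the whiskers of [sg w] are
   identities for composition [i], and naturality follows from exchange. *)
have [e1|ne] := eqVneq i 1.
  subst i; rewrite tc_eq ?sc_eq //; [|lia..].
  have e2 : to 1 (U w) = so 1 (sg w *_0 to 1 g) by bd.
  rewrite coA ?b3 //; last lia.
  by rewrite -coA -?e ?a3 ?coA //; first [lia | bd].
have i2 : 1 < i by lia.
have iK : 1 < i < K by lia.
have -> : to 1 (f *_i g) = to 1 f by bd.
have -> : so 1 (f *_i g) = so 1 f by bd.
have d1 : dim i (sg w *_0 to 1 f).
  apply: dim_co; [lia | bd | apply: dimW dsg _; lia |].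
  by apply: (dimW (i := 1)); [apply: dim_to; lia | lia].
have d2 : dim i (sg w *_0 so 1 f).
  apply: dim_co; [lia | bd | apply: dimW dsg _; lia |].
  by apply: (dimW (i := 1)); [apply: dim_so; lia | lia].
have t1g : to 1 g = to 1 f by symmetry; apply: comp_t0 e; lia.
have s1g : so 1 g = so 1 f by symmetry; apply: comp_s0 e; lia.
rewrite -(co_dd _ d1); last lia.
rewrite -(co_dd _ d2); last lia.
rewrite -(co_exch (i := 1) (j := i)) //; try bd.
by rewrite -(co_exch (i := 1) (j := i)) //; bd.
Qed.

(** Naturality extends from [sg w] to [sg w *_0 u]: by [sg_co], the latter followed by
    [sg (norm w *_0 u)] is [sg (w *_0 u)]. Naturality is known for these two, and the common factor
    cancels. *)
Lemma fam_natu g U w u : dim m g -> fam g U -> dim 1 w -> dim 1 u ->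
  to 0 w = so 0 u -> to 0 u = so 0 g ->
  U (w *_0 u) *_1 (sg w *_0 u *_0 to 1 g) =
  (sg w *_0 u *_0 so 1 g) *_1 U (norm w *_0 u).
Proof.
move=> dg FU dw du ewu eug.
have dv : dim 1 (so 1 g) by apply: dim_so; lia.
have dv' : dim 1 (to 1 g) by apply: dim_to; lia.
have sw := sg_sim dw; have dn := norm_dim w; have dsg := sg_dim H dw.
have nw : to 1 (sg w) = norm w by [].
have enu : to 0 (norm w) = so 0 u by rewrite norm_t.
have dwu : dim 1 (w *_0 u) by apply: dim_co => //; lia.
have dnu : dim 1 (norm w *_0 u) by apply: dim_co => //; lia.
have e1 : to 0 (w *_0 u) = so 0 g by bd.
have e2 : to 0 (norm w *_0 u) = so 0 g by bd.
have [b1 b2 b3] := FU _ dwu e1; have [c1 c2 c3] := FU _ dnu e2.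
have su := fam_sim FU dwu e1; have su' := fam_sim FU dnu e2.
have nn := norm_co dw du ewu.
have dnn := norm_dim (w *_0 u).
have enn : to 0 (norm (w *_0 u)) = so 0 g by rewrite norm_t.
have [d1 d2 d3] := FU _ dnn enn; have su2 := fam_sim FU dnn enn.
have sgwu := sg_co H dw du ewu; rewrite -/(norm w) in sgwu.
have sx := sg_sim dwu; have sy := sg_sim dnu.
have ny : to 1 (sg (norm w *_0 u)) = norm (w *_0 u) by rewrite -nn.
have nx : to 1 (sg (w *_0 u)) = norm (w *_0 u) by [].
apply: (@co_injl _ 1 _ _ (sg (norm w *_0 u) *_0 to 1 g)); [lia | bd | bd |].
rewrite coA; [|lia|bd|bd].
rewrite [in RHS]coA; [|lia|bd|bd].
rewrite c3 nn -[in RHS]coA; [|lia|bd|bd].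
have e3 : to 1 (sg w *_0 u) = so 1 (sg (norm w *_0 u)) by bd.
rewrite -wr_co //; [|lia|bd].
rewrite -wr_co //; [|lia|bd].
by rewrite -sgwu b3.
Qed.

(** The target is given by [h_co0]. For naturality, [sg w] passes [U] by [fam_natu] with
    [u = to 1 f], then passes [T]. *)
Lemma fam_co0 f g T U : dim m f -> dim m g -> to 0 f = so 0 g ->
  fam f T -> fam g U ->
  fam (f *_0 g) (fun w => (T w *_0 so 1 g) *_1 U (w *_0 to 1 f)).
Proof.
move=> df dg e FT FU w dw ew.
have ewf : to 0 w = so 0 f by rewrite ew; bd.
have dt : dim 1 (to 1 f) by apply: dim_to; lia.
have dsu : dim 1 (so 1 f) by apply: dim_so; lia.
have dv : dim 1 (so 1 g) by apply: dim_so; lia.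
have dv' : dim 1 (to 1 g) by apply: dim_to; lia.
have dwu : dim 1 (w *_0 to 1 f) by apply: dim_co => //; [lia | bd].
have ewu : to 0 (w *_0 to 1 f) = so 0 g by bd.
have [a1 a2 a3] := FT w dw ewf; have [b1 b2 b3] := FU _ dwu ewu.
have st := fam_sim FT dw ewf; have su := fam_sim FU dwu ewu.
have sw := sg_sim dw; have dn := norm_dim w; have dsg := sg_dim H dw.
have nw : to 1 (sg w) = norm w by [].
have ewf' : to 0 (norm w) = so 0 f by rewrite norm_t.
have st' := fam_sim FT dn ewf'.
have dnu : dim 1 (norm w *_0 to 1 f) by apply: dim_co => //; [lia | bd].
have enu : to 0 (norm w *_0 to 1 f) = so 0 g by bd.
have su' := fam_sim FU dnu enu.
have [c1 c2 c3] := FU _ dnu enu.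
have dwf : dim m (w *_0 f).
  by apply: dim_co => //; [lia | apply: dimW dw _; lia].
have e1 : to 1 (T w *_0 so 1 g) = so 1 (U (w *_0 to 1 f)) by bd.
split.
- rewrite -[RHS]coA; [|sc..]; rewrite [RHS]int_r; [bd|sc..].
- have -> : to m (T w *_0 so 1 g *_1 U (w *_0 to 1 f)) =
      (to m (T w) *_0 so 1 g) *_1 to m (U (w *_0 to 1 f)) by bd.
  rewrite a2 b2 -[w *_0 (f *_0 g)]coA; [|sc..].
  rewrite [RHS](h_co0 H); [|sc..].
  by congr (_ *_1 h _); congr (_ *_0 _); bd.
have -> : so 1 (f *_0 g) = so 1 f *_0 so 1 g by bd.
have -> : to 1 (f *_0 g) = to 1 f *_0 to 1 g by bd.
rewrite -[sg w *_0 (to 1 f *_0 _)]coA; [|sc..].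
rewrite -[sg w *_0 (so 1 f *_0 _)]coA; [|sc..].
rewrite [LHS]coA; [|sc..].
rewrite (fam_natu dg FU); [|sc..].
rewrite -[LHS]coA; [|sc..].
rewrite -wr_co; [|sc..].
rewrite a3 wr_co; [|sc..].
by rewrite [LHS]coA; [|sc..].
Qed.

Lemma slide_id b x y : so 1 x = b -> to 1 x = b -> to 0 x = so 0 y ->
  (b *_0 y) *_1 (x *_0 to 1 y) = (x *_0 so 1 y) *_1 (b *_0 y).
Proof.
move=> e1 e2 e; have K1 : 1 < K by lia.
by move: (int_l K1 e) (int_r K1 e); rewrite e1 e2 => <-.
Qed.

(** As the 2-target of [Y] is the identity [b], exchange lets [Y] be performed before [V] in
    direction 2. There it meets only [b *_0 so 2 f], past which it slides by interchange
    ([slide_id]). *)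
Lemma slide_cap b f V Y : dim 1 b -> to 0 b = so 0 f ->
  so 2 V = b *_0 so 2 f -> so 1 Y = b -> to 1 Y = b -> to 2 Y = b ->
  V *_1 (Y *_0 to 1 f) = (Y *_0 so 1 f) *_1 V.
Proof.
move=> db ebf e2 sY tY t2Y.
have sV : sim 2 V (b *_0 so 2 f) by split=> //; lia.
have dt : dim 1 (to 1 f) by apply: dim_to; lia.
have ds : dim 1 (so 1 f) by apply: dim_so; lia.
have d2 : dim 2 (so 2 f) by apply: dim_so; lia.
have s0Y : so 0 Y = so 0 b by rewrite -sY; bd.
have t0Y : to 0 Y = to 0 b by rewrite -tY; bd.
have sVb : so 1 V = b *_0 so 1 f by bd.
have tVb : to 1 V = b *_0 to 1 f by bd.
have lhs : V *_1 (Y *_0 to 1 f) = ((b *_0 so 2 f) *_1 (Y *_0 to 1 f)) *_2 V.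
  have {2}-> : V = V *_1 (b *_0 to 1 f) by rewrite -tVb co_tr //; lia.
  rewrite co_exch; [|sc..].
  rewrite -e2 co_sl; [|sc..].
  have {1}-> : b *_0 to 1 f = to 2 (Y *_0 to 1 f) by bd.
  by rewrite co_tr; [|sc..].
have rhs : (Y *_0 so 1 f) *_1 V = ((Y *_0 so 1 f) *_1 (b *_0 so 2 f)) *_2 V.
  have {2}-> : V = (b *_0 so 1 f) *_1 V by rewrite -sVb co_sl //; lia.
  rewrite co_exch; [|sc..].
  rewrite -e2 co_sl; [|sc..].
  have {1}-> : b *_0 so 1 f = to 2 (Y *_0 so 1 f) by bd.
  by rewrite co_tr; [|sc..].
rewrite lhs rhs; congr (_ *_2 _).
have := @slide_id b Y (so 2 f) sY tY ltac:(bd).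
by rewrite ss_le ?ts_lt //; lia.
Qed.

Lemma slide_loop f T b Y : dim m f -> fam f T -> dim 1 b -> to 0 b = so 0 f ->
  so 1 Y = b -> to 1 Y = b -> (m = 2 -> to 2 Y = b) ->
  T b *_1 (Y *_0 to 1 f) = (Y *_0 so 1 f) *_1 T b.
Proof.
move=> df FT db ebf sY tY t2Y; have st := fam_sim FT db ebf.
have e2 : so 2 (T b) = b *_0 so 2 f by bd.
have [m2|m2] := eqVneq m 2; first exact: slide_cap e2 sY tY (t2Y m2).
have s0Y : so 0 Y = so 0 b by rewrite -sY; bd.
have t0Y : to 0 Y = to 0 b by rewrite -tY; bd.
(* [Z] contracts the loop [to 2 Y] to the identity of [b], so [slide_cap] applies to [Y *_2 Z]. The
   square of [Z] against [to 2 f] is an interchange, which allows [Z] to be cancelled at the end. *)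
have [|||Z [sZ tZ]] := fill2 (x := to 2 Y); [lia | apply: dim_to; lia | bd |].
have s1t2 : so 1 (to 2 Y) = b by bd.
rewrite s1t2 in tZ.
have s1Z : so 1 Z = b by rewrite -(@ss_le _ 1 2) ?sZ //; lia.
have t1Z : to 1 Z = b by rewrite -(@tt_le _ 1 2) ?tZ ?(dim_t db) //; lia.
have s0Z : so 0 Z = so 0 b by rewrite -s1Z; bd.
have t0Z : to 0 Z = to 0 b by rewrite -t1Z; bd.
have dt : dim 1 (to 1 f) by apply: dim_to; lia.
have ds : dim 1 (so 1 f) by apply: dim_so; lia.
have eYZ : to 2 Y = so 2 Z by rewrite sZ.
have := slide_cap (V := T b) (Y := Y *_2 Z) db ebf e2.
have s1tb : so 1 (T b) = b *_0 so 1 f by bd.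
have t1tb : to 1 (T b) = b *_0 to 1 f by bd.
have t2tb : to 2 (T b) = b *_0 to 2 f by bd.
move=> /(_ ltac:(bd) ltac:(bd) ltac:(bd)).
have dt2 : dim 2 (to 1 f) by apply: dimW dt _; lia.
have ds2 : dim 2 (so 1 f) by apply: dimW ds _; lia.
rewrite wr_co; [|sc..].
rewrite wr_co; [|sc..].
have -> : T b *_1 ((Y *_0 to 1 f) *_2 (Z *_0 to 1 f)) =
    (T b *_1 (Y *_0 to 1 f)) *_2 ((b *_0 to 2 f) *_1 (Z *_0 to 1 f)).
  by rewrite (co_exch (i := 1)); [rewrite -t2tb co_tr //; lia|sc..].
have -> : ((Y *_0 so 1 f) *_2 (Z *_0 so 1 f)) *_1 T b =
    ((Y *_0 so 1 f) *_1 T b) *_2 ((Z *_0 so 1 f) *_1 (b *_0 to 2 f)).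
  by rewrite (co_exch (i := 1)); [rewrite -t2tb co_tr //; lia|sc..].
have -> : (b *_0 to 2 f) *_1 (Z *_0 to 1 f) = (Z *_0 so 1 f) *_1 (b *_0 to 2 f).
  have := @slide_id b Z (to 2 f) s1Z t1Z ltac:(bd).
  by rewrite st_lt ?tt_le //; lia.
have := @slide_id b (to 2 Y) (to 2 f) ltac:(bd) ltac:(bd) ltac:(bd).
rewrite st_lt ?tt_le //; try lia.
by move=> e; apply: co_injl; [lia|sc..].
Qed.

(** The endpoints [p] and [q] of [U w] along dimension 1 are joined by [w *_0 so 2 g], hence have a
    common normal form [b]. Naturality carries [T p] and [T q] to the same [T b], and [U w] to a
    loop [X] at [b]; the claim becomes [slide_loop] for [X]. *)
Lemma fam_slide f g T U w : dim m f -> dim m g -> to 0 g = so 0 f ->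
  fam f T -> fam g U -> dim 1 w -> to 0 w = so 0 g ->
  T (w *_0 so 1 g) *_1 (U w *_0 to 1 f) = (U w *_0 so 1 f) *_1 T (w *_0 to 1 g).
Proof.
move=> df dg e FT FU dw ew.
have dt : dim 1 (to 1 g) by apply: dim_to; lia.
have ds : dim 1 (so 1 g) by apply: dim_so; lia.
have dt' : dim 1 (to 1 f) by apply: dim_to; lia.
have ds' : dim 1 (so 1 f) by apply: dim_so; lia.
have dp : dim 1 (w *_0 so 1 g) by apply: dim_co => //; [lia | bd].
have dq : dim 1 (w *_0 to 1 g) by apply: dim_co => //; [lia | bd].
have epf : to 0 (w *_0 so 1 g) = so 0 f by bd.
have eqf : to 0 (w *_0 to 1 g) = so 0 f by bd.
have d2 : dim 2 (w *_0 so 2 g).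
  by apply: dim_co; [lia | bd | apply: dimW dw _; lia | apply: dim_so; lia].
have nq : norm (w *_0 to 1 g) = norm (w *_0 so 1 g).
  have := sg_cell H d2.
  have -> : so 1 (w *_0 so 2 g) = w *_0 so 1 g by bd.
  have -> : to 1 (w *_0 so 2 g) = w *_0 to 1 g by bd.
  by rewrite -!/(norm _) => ->.
have [p1 p2 p3] := FT _ dp epf; have [q1 q2 q3] := FT _ dq eqf.
set p := w *_0 so 1 g in dp epf nq p1 p2 p3 *.
set q := w *_0 to 1 g in dq eqf nq q1 q2 q3 *.
have ep : p = w *_0 so 1 g by [].
have eq : q = w *_0 to 1 g by [].
clearbody p q; rewrite nq in q3.
have np : to 1 (sg p) = norm p by [].
have nq' : to 1 (sg q) = norm p by rewrite -nq.
have db : dim 1 (norm p) by apply: norm_dim.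
have ebf : to 0 (norm p) = so 0 f by rewrite norm_t.
set b := norm p in nq p3 q3 np nq' db ebf *; clearbody b.
have [u1 u2 u3] := FU _ dw ew; have su := fam_sim FU dw ew.
have sUp : so 1 (U w) = p by bd.
have tUq : to 1 (U w) = q by bd.
have sp := sg_sim dp; have sq := sg_sim dq.
have s1p : so 1 (sg p) = p by exact: (sg_s H).
have s1q : so 1 (sg q) = q by exact: (sg_s H).
have sTp := fam_sim FT dp epf; have sTq := fam_sim FT dq eqf.
have sTb := fam_sim FT db ebf.
pose X := invo 1 (sg p) *_1 (U w *_1 sg q).
have sX : so 1 X = b by rewrite /X; bd.
have tX : to 1 X = b by rewrite /X; bd.
have UX : U w *_1 sg q = sg p *_1 X.
  rewrite /X -coA; [|sc..]; rewrite co_xV; [|lia].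
  have -> : so 1 (sg p) = so 1 (U w *_1 sg q) by bd.
  by rewrite co_sl //; lia.
have t0X : to 0 X = so 0 f by rewrite -ebf -tX; bd.
have s0X : so 0 X = so 0 b by rewrite -sX; bd.
(* When [m = 2], the target of [U w] is [h (w *_0 g)], which [h_2] writes as
   [sg p *_1 invo 1 (sg q)]; conjugation by [sg p] and [sg q] makes it an identity. *)
have loop : T b *_1 (X *_0 to 1 f) = (X *_0 so 1 f) *_1 T b.
  apply: slide_loop => // m2.
  have dg2 : dim 2 g by rewrite -m2.
  have dwg : dim 2 (w *_0 g) by apply: dim_co => //; [lia | apply: dimW dw _; lia].
  have t2U : to 2 (U w) = sg p *_1 invo 1 (sg q).
    have {1}-> : 2 = m by [].
    by rewrite u2 (h_2 H) //; congr (sg _ *_1 invo 1 (sg _)); bd.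
  have dsp := sg_dim H dp; have dsq := sg_dim H dq.
  have -> : to 2 X = invo 1 (sg p) *_1 (to 2 (U w) *_1 sg q).
    by rewrite /X; bd.
  rewrite t2U coA; [|sc..]; rewrite co_Vx; [|lia].
  have -> : to 1 (sg q) = to 1 (sg p) by bd.
  by rewrite co_tr ?co_Vx //; lia.
apply: (@co_injl _ 1 _ _ (sg q *_0 to 1 f)); [lia | bd | bd |].
rewrite [LHS]coA; [|sc..].
rewrite -wr_co; [|sc..].
rewrite UX wr_co; [|sc..].
rewrite -[LHS]coA; [|sc..].
rewrite p3 [LHS]coA; [|sc..].
rewrite loop -[LHS]coA; [|sc..].
rewrite -wr_co; [|sc..].
rewrite -UX wr_co; [|sc..].
by rewrite [RHS]coA ?q3 -?[RHS]coA //; sc.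
Qed.

(** The target is correct because [h] preserves [m.-1]-composites and fixes identities, hence
    commutes with inverses. *)
Lemma fam_inv f T : dim m f -> fam f T ->
  fam (invo m.-1 f) (fun w => invo m.-1 (T w)).
Proof.
move=> df FT w dw ew.
have mp : 0 < m.-1 < K by lia.
have ewf : to 0 w = so 0 f by rewrite ew; bd.
have [a1 a2 a3] := FT _ dw ewf; have st := fam_sim FT dw ewf.
have dn := norm_dim w; have enf : to 0 (norm w) = so 0 f by rewrite norm_t.
have [b1 b2 b3] := FT _ dn enf; have sn := fam_sim FT dn enf.
have sw := sg_sim dw; have dsg := sg_dim H dw.
have nw : to 1 (sg w) = norm w by [].
have dwf : dim m (w *_0 f).
  by apply: dim_co => //; [lia | apply: dimW dw _; lia].
have dwm : dim m.-1 w by apply: dimW dw _; lia.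
have winv : w *_0 invo m.-1 f = invo m.-1 (w *_0 f).
  by rewrite invo_co ?(invo_id _ dwm) //; lia.
split.
- by rewrite s_invo_lt ?a1 //; lia.
- rewrite t_invo_lt ?a2 //; try lia.
  rewrite winv; apply: invo_eq => //.
  have dV : dim m (invo m.-1 (w *_0 f)) by apply: dim_invo => //; lia.
  split; rewrite ?(h_s H) ?(h_t H) ?s_invo ?t_invo //; try lia.
  - rewrite -(h_co H) ?co_xV ?(h_id H) //; try lia; last by rewrite s_invo.
    by apply: dim_so; lia.
  - rewrite -(h_co H) ?co_Vx ?(h_id H) //; try lia; last by rewrite t_invo.
    by apply: dim_to; lia.
(* For [m = 2] inversion reverses the naturality square, whence a cancellation; for [m > 2] the
   whiskers of [sg w] are their own [m.-1]-inverses. *)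
have [m2|m2] := eqVneq m 2.
  have m1 : m.-1 = 1 by rewrite m2.
  rewrite m1 s_invo ?t_invo; [|lia..].
  apply: (@co_injl _ 1 _ _ (T (norm w))); [lia|bd|bd|].
  rewrite [LHS]coA; [|sc..].
  rewrite -a3 -[LHS]coA; [|sc..].
  rewrite co_Vx; [|lia].
  rewrite [RHS]coA; [|sc..].
  rewrite co_Vx; [|lia].
  have -> : to 1 (T w) = so 1 (sg w *_0 to 1 f) by bd.
  have -> : to 1 (T (norm w)) = to 1 (sg w *_0 to 1 f) by bd.
  by rewrite co_sl ?co_tr //; lia.
have -> : to 1 (invo m.-1 f) = to 1 f by bd.
have -> : so 1 (invo m.-1 f) = so 1 f by bd.
have dm : 1 < m.-1 by lia.
have d1 : dim m.-1 (sg w *_0 to 1 f).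
  apply: dim_co; [lia | bd | apply: dimW dsg _; lia |].
  by apply: (dimW (i := 1)); [apply: dim_to; lia | lia].
have d2 : dim m.-1 (sg w *_0 so 1 f).
  apply: dim_co; [lia | bd | apply: dimW dsg _; lia |].
  by apply: (dimW (i := 1)); [apply: dim_so; lia | lia].
have iK : 1 < m.-1 < K by lia.
have c1 : to 1 (T w) = so 1 (sg w *_0 to 1 f) by bd.
have c2 : to 1 (sg w *_0 so 1 f) = so 1 (T (norm w)) by bd.
rewrite -[sg w *_0 to 1 f](invo_id mp d1) -[sg w *_0 so 1 f](invo_id mp d2).
rewrite -(invo_co iK _ c1); last lia.
by rewrite -(invo_co iK _ c2) ?a3 //; lia.
Qed.

(** This is [h] applied to the interchange identity [e1] between [sg w] and [f], since [h] fixes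
    every whisker [sg w *_0 u]. *)
Lemma h_nat w f : dim m f -> dim 1 w -> to 0 w = so 0 f ->
  h (w *_0 f) *_1 (sg w *_0 to 1 f) = (sg w *_0 so 1 f) *_1 h (norm w *_0 f).
Proof.
move=> df dw e; have sw := sg_sim dw; have dsg := sg_dim H dw.
have nw : to 1 (sg w) = norm w by []; have dn := norm_dim w.
have dt : dim 1 (to 1 f) by apply: dim_to; lia.
have ds : dim 1 (so 1 f) by apply: dim_so; lia.
have dwm : dim m w by apply: dimW dw _; lia.
have dnm : dim m (norm w) by apply: dimW dn _; lia.
have dsm : dim m (sg w) by apply: dimW dsg _; lia.
have enf : to 0 (norm w) = so 0 f by rewrite norm_t.
have hsu u : dim 1 u -> to 0 w = so 0 u -> h (sg w *_0 u) = sg w *_0 u.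
  move=> du eu; have dum : dim m u by apply: dimW du _; lia.
  rewrite (h_co0 H) //; last bd.
  have enu : to 0 (norm w) = so 0 u by rewrite norm_t.
  rewrite (h_sg H) // (h_id H); last first.
    rewrite nw; have [m2|m2] := eqVneq m.-1 1.
      by rewrite m2; apply: dim_co => //; lia.
    by apply: dim_co; [lia | done | apply: dimW dn _; lia | apply: dimW du _; lia].
  rewrite (dim_s du) ?nw; last lia.
  have -> : norm w *_0 u = to 1 (sg w *_0 u) by bd.
  by rewrite co_tr //; lia.
have e1 : (w *_0 f) *_1 (sg w *_0 to 1 f) = (sg w *_0 so 1 f) *_1 (norm w *_0 f).
  have := @int_r _ (sg w) f ltac:(lia) ltac:(bd).
  by rewrite (@int_l _ (sg w) f ltac:(lia) ltac:(bd)) (sg_s H).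
have := f_equal h e1.
have d1 u : dim 1 u -> to 0 w = so 0 u -> dim m (sg w *_0 u).
  by move=> du eu; apply: dim_co => //; [lia | bd | apply: dimW du _; lia].
rewrite (h_co H (i := 1)); [|lia| by apply: dim_co => //; lia | by apply: d1 => //; bd |bd].
rewrite (h_co H (i := 1)); [|lia| by apply: d1 => //; bd | by apply: dim_co => //; lia |bd].
by rewrite !hsu //; bd.
Qed.

(** A filler is chosen at each normal form only, then transported to [w] along [sg w]. As [sg] is
    trivial on normal forms, the transported family takes the chosen values there, which gives
    naturality. *)
Lemma fam_ex f : dim m f ->
  (forall x y, dim m x -> dim m y -> so m.-1 x = so m.-1 y -> to m.-1 x = to m.-1 y ->
    exists z, so m z = x /\ to m z = y) ->
  exists T, fam f T.
Proof.
move=> df fill.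
have mp : m.-1 < m by lia.
have ex w : exists z, dim 1 w -> to 0 w = so 0 f ->
    so m z = norm w *_0 f /\ to m z = h (norm w *_0 f).
  case: (classic (dim 1 w /\ to 0 w = so 0 f)) => [[dw e]|nw]; last first.
    by exists f => dw e; case: nw.
  have dn := norm_dim w.
  have enf : to 0 (norm w) = so 0 f by rewrite norm_t.
  have dnf : dim m (norm w *_0 f).
    by apply: dim_co => //; [lia | apply: dimW dn _; lia].
  have [||||z zP] := fill (norm w *_0 f) (h (norm w *_0 f)) => //.
  - exact: (h_dim H).
  - by rewrite (h_s H).
  - by rewrite (h_t H).
  by exists z.
have [th thP] : exists th : A -> A, forall w, dim 1 w -> to 0 w = so 0 f ->
    so m (th w) = norm w *_0 f /\ to m (th w) = h (norm w *_0 f).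
  exists (fun w => proj1_sig (constructive_indefinite_description _ (ex w))) => w.
  by case: constructive_indefinite_description.
exists (fun w => (sg w *_0 so 1 f) *_1 (th (norm w) *_1 invo 1 (sg w *_0 to 1 f))) => w dw e.
have dn := norm_dim w; have sw := sg_sim dw; have dsg := sg_dim H dw.
have nw : to 1 (sg w) = norm w by []; have nn := norm_norm dw.
have dt : dim 1 (to 1 f) by apply: dim_to; lia.
have ds : dim 1 (so 1 f) by apply: dim_so; lia.
have enf : to 0 (norm w) = so 0 f by rewrite norm_t.
have [t1 t2] := thP _ dn enf; rewrite nn in t1 t2.
have dnf : dim m (norm w *_0 f).
  by apply: dim_co => //; [lia | apply: dimW dn _; lia].
have dwf : dim m (w *_0 f).
  by apply: dim_co => //; [lia | apply: dimW dw _; lia].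
have stt : sim m (th (norm w)) (norm w *_0 f) by split=> //; lia.
have d1 : dim m (sg w *_0 to 1 f).
  by apply: dim_co; [lia | bd | apply: dimW dsg _; lia | apply: dimW dt _; lia].
have d2 : dim m (sg w *_0 so 1 f).
  by apply: dim_co; [lia | bd | apply: dimW dsg _; lia | apply: dimW ds _; lia].
have dV : dim m (invo 1 (sg w *_0 to 1 f)) by apply: dim_invo => //; lia.
(* The transport of [y] is the unique solution [x] of the naturality equation; the source and the
   target of the family are identified by exhibiting solutions. *)
have solve x y : to 1 x = so 1 (sg w *_0 to 1 f) ->
    to 1 (sg w *_0 so 1 f) = so 1 y -> to 1 y = to 1 (sg w *_0 to 1 f) ->
    x *_1 (sg w *_0 to 1 f) = (sg w *_0 so 1 f) *_1 y ->
    (sg w *_0 so 1 f) *_1 (y *_1 invo 1 (sg w *_0 to 1 f)) = x.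
  move=> e1 e2 e3 e4; rewrite -coA; [|lia|done|by rewrite s_invo //; lia].
  rewrite -e4 coA; [|lia|done|by rewrite s_invo //; lia].
  by rewrite co_xV -?e1 ?co_tr //; lia.
have e1 : (w *_0 f) *_1 (sg w *_0 to 1 f) = (sg w *_0 so 1 f) *_1 (norm w *_0 f).
  have := @int_r _ (sg w) f ltac:(lia) ltac:(bd).
  by rewrite (@int_l _ (sg w) f ltac:(lia) ltac:(bd)) (sg_s H).
split.
- by rewrite -[RHS](solve _ (norm w *_0 f)) //; bd.
- rewrite -[RHS](solve _ (h (norm w *_0 f))); first last.
  + exact: h_nat.
  + by rewrite (h_t H) //; [bd | lia].
  + by rewrite (h_s H) //; [bd | lia].
  + by rewrite (h_t H) //; [bd | lia].
  by bds; rewrite t2.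
have -> : sg (norm w) = norm w by exact: (sg_norm H).
rewrite coA; [|sc..]; rewrite coA; [|sc..].
rewrite co_Vx; [|lia]; congr (_ *_1 _).
rewrite nn.
have -> : norm w *_0 so 1 f = so 1 (th (norm w)) by bd.
have -> : to 1 (sg w *_0 to 1 f) = to 1 (th (norm w)) by bd.
have dnt : dim 1 (norm w *_0 to 1 f) by apply: dim_co => //; [lia|bd].
rewrite (invo_id _ dnt); last lia.
have -> : norm w *_0 to 1 f = to 1 (th (norm w)) by bd.
by rewrite co_tr ?co_sl //; lia.
Qed.

Definition sel (P : Prop) (x y : A) : A :=
  if excluded_middle_informative P then x else y.

Lemma selT P x y : P -> sel P x y = x.
Proof. by rewrite /sel; case: excluded_middle_informative. Qed.

Lemma selF P x y : ~ P -> sel P x y = y.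
Proof. by rewrite /sel; case: excluded_middle_informative. Qed.

Definition left_of f w : Prop := dim 1 w /\ to 0 w = so 0 f.

(* The second condition makes equality of families extensional on the
   1-cells that are not composable with [f]. *)
Definition famN f T : Prop := fam f T /\ forall w, ~ left_of f w -> T w = f.

Definition fone a w := sel (left_of a w) (w *_0 a) a.

Definition fop i f T g U w :=
  sel (left_of f w)
    (if i == 0 then (T w *_0 so 1 g) *_1 U (w *_0 to 1 f) else T w *_i U w)
    (f *_i g).

Lemma famN_eq f T U : famN f T -> famN f U ->
  (forall w, left_of f w -> T w = U w) -> T = U.
Proof.
move=> [_ hT] [_ hU] e; apply: functional_extensionality => w.
by case: (classic (left_of f w)) => hw; [exact: e | rewrite hT // hU].
Qed.

Lemma fam_ext f T U : (forall w, left_of f w -> T w = U w) ->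
  fam f T -> fam f U.
Proof.
move=> e FT w dw ew; have [a b c] := FT w dw ew.
by rewrite -!e //; split=> //; [exact: norm_dim | rewrite norm_t].
Qed.

Lemma famN_sel f T : fam f T -> famN f (fun w => sel (left_of f w) (T w) f).
Proof.
move=> FT; split=> [|w nw]; last by rewrite selF.
by apply: fam_ext FT => w hw; rewrite selT.
Qed.

Lemma left_of_so f g w : so 0 f = so 0 g -> left_of f w = left_of g w.
Proof. by rewrite /left_of => ->. Qed.

Lemma left_of_co i f g w : i < m -> to i f = so i g -> left_of (f *_i g) w = left_of f w.
Proof.
move=> im e; apply: left_of_so; case: i => [|i] in im e *; bd.
Qed.

Lemma famN_one a : dim m.-1 a -> famN a (fone a).
Proof. by move=> da; apply: famN_sel; apply: fam_id. Qed.

Lemma famN_op i f g T U : i < m -> dim m f -> dim m g -> to i f = so i g ->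
  famN f T -> famN g U -> famN (f *_i g) (fop i f T g U).
Proof.
move=> im df dg e [FT _] [FU _]; split; last first.
  by move=> w; rewrite left_of_co // => nw; rewrite /fop selF.
apply: (@fam_ext _ (fun w => if i == 0 then (T w *_0 so 1 g) *_1 U (w *_0 to 1 f)
    else T w *_i U w)).
  by move=> w; rewrite left_of_co // => hw; rewrite /fop selT.
by case: i im e => [|i] im e /=; [exact: fam_co0 | exact: fam_co].
Qed.

Lemma left_of_next f g w : to 0 f = so 0 g -> left_of f w -> left_of g (w *_0 to 1 f).
Proof.
move=> e [dw ew]; have dt : dim 1 (to 1 f) by apply: dim_to; lia.
by split; [apply: dim_co; [lia|bd|done|done] | bd].
Qed.

Lemma fop_leftS i f T g U w : i != 0 -> left_of f w ->
  fop i f T g U w = T w *_i U w.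
Proof. by move=> i0 hw; rewrite /fop selT // (negPf i0). Qed.

Lemma fop_left0 f T g U w : left_of f w ->
  fop 0 f T g U w = (T w *_0 so 1 g) *_1 U (w *_0 to 1 f).
Proof. by move=> hw; rewrite /fop selT. Qed.

Lemma fop_assoc i f g x T U V : i < m -> dim m f -> dim m g -> dim m x ->
  to i f = so i g -> to i g = so i x -> famN f T -> famN g U -> famN x V ->
  fop i (f *_i g) (fop i f T g U) x V = fop i f T (g *_i x) (fop i g U x V).
Proof.
move=> im df dg dx e1 e2 NT NU NV.
have iK : i < K by lia.
have e12 : to i (f *_i g) = so i x by rewrite tc_eq.
have e21 : to i f = so i (g *_i x) by rewrite sc_eq.
have di y z : dim m y -> dim m z -> to i y = so i z -> dim m (y *_i z).
  by move=> dy dz e; apply: dim_co => //; lia.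
apply: (@famN_eq (f *_i g *_i x)).
- by apply: famN_op => //; [exact: di | exact: famN_op].
- by rewrite coA //; apply: famN_op => //; [exact: di | exact: famN_op].
move=> w; rewrite left_of_co // left_of_co // => hw.
have [dw ew] := hw; have [[FT _] [FU _] [FV _]] := And3 NT NU NV.
have st := fam_sim FT dw ew.
have [i0|i0] := eqVneq i 0; last first.
  have e0 : so 0 f = so 0 g by apply: comp_s0 e1; lia.
  have e0' : so 0 g = so 0 x by apply: comp_s0 e2; lia.
  have hwg : left_of g w by rewrite -(left_of_so _ e0).
  rewrite !(fop_leftS _ _ _ i0) ?left_of_co //.
  have su := fam_sim FU (proj1 hwg) (proj2 hwg).
  have ewx : to 0 w = so 0 x by rewrite ew e0.
  have sv := fam_sim FV dw ewx.
  have dwi : dim i w by apply: dimW dw _; lia.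
  by rewrite coA //; bd.
subst i; have hwg := left_of_next e1 hw.
rewrite !fop_left0 ?left_of_co //=.
have [dwu ewu] := hwg.
have su := fam_sim FU dwu ewu.
have hwx := left_of_next e2 hwg; have [dwx ewx] := hwx.
have sv := fam_sim FV dwx ewx.
have dt : dim 1 (to 1 f) by apply: dim_to; lia.
have dt' : dim 1 (to 1 g) by apply: dim_to; lia.
have ds : dim 1 (so 1 g) by apply: dim_so; lia.
have ds' : dim 1 (so 1 x) by apply: dim_so; lia.
have -> : to 1 (f *_0 g) = to 1 f *_0 to 1 g by bd.
have -> : so 1 (g *_0 x) = so 1 g *_0 so 1 x by bd.
rewrite -[w *_0 (_ *_0 _)]coA; [|sc..].
rewrite -[T w *_0 (_ *_0 _)]coA; [|sc..].
rewrite wr_co; [|sc..].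
by rewrite coA; sc.
Qed.

Lemma fop_idl i f T : i < m -> dim m f -> famN f T ->
  fop i (so i f) (fone (so i f)) f T = T.
Proof.
move=> im df NT; have iK : i < K by lia.
have e0 : to i (so i f) = so i f by bd.
have d0 : dim i (so i f) by apply: dim_so.
have d1 : dim m.-1 (so i f) by apply: dimW d0 _; lia.
have dm : dim m (so i f) by apply: dimW d0 _; lia.
have h1 : so i f *_i f = f by rewrite co_sl.
apply: (@famN_eq f) => //.
  by rewrite -{1}h1; apply: famN_op => //; apply: famN_one.
have es : so 0 (so i f) = so 0 f by bd.
move=> w hw; have [dw ew] := hw; have [FT _] := NT.
have hw' : left_of (so i f) w by rewrite (left_of_so _ es).
have st := fam_sim FT dw ew.
have [i0|i0] := eqVneq i 0; last first.
  rewrite fop_leftS // /fone selT //.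
  have dwi : dim i w by apply: dimW dw _; lia.
  have -> : w *_0 so i f = so i (T w) by bd.
  by rewrite co_sl.
subst i; rewrite fop_left0 // /fone selT //.
have -> : to 1 (so 0 f) = so 0 f by bd.
rewrite -ew co_tr; [|lia].
have -> : w *_0 so 1 f = so 1 (T w) by bd.
by rewrite co_sl //; lia.
Qed.

Lemma fop_idr i f T : i < m -> dim m f -> famN f T ->
  fop i f T (to i f) (fone (to i f)) = T.
Proof.
move=> im df NT; have iK : i < K by lia.
have e0 : to i f = so i (to i f) by bd.
have d0 : dim i (to i f) by apply: dim_to.
have d1 : dim m.-1 (to i f) by apply: dimW d0 _; lia.
have dm : dim m (to i f) by apply: dimW d0 _; lia.
have h1 : f *_i to i f = f by rewrite co_tr.
apply: (@famN_eq f) => //.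
  by rewrite -{1}h1; apply: famN_op => //; apply: famN_one.
move=> w hw; have [dw ew] := hw; have [FT _] := NT.
have st := fam_sim FT dw ew.
have [i0|i0] := eqVneq i 0; last first.
  rewrite fop_leftS // /fone.
  have es : so 0 (to i f) = so 0 f by bd.
  have dwi : dim i w by apply: dimW dw _; lia.
  rewrite selT; last by rewrite (left_of_so _ es).
  have -> : w *_0 to i f = to i (T w) by bd.
  by rewrite co_tr.
subst i; rewrite fop_left0 // /fone selT; last by apply: left_of_next; [bd | done].
have dt : dim 1 (to 1 f) by apply: dim_to; lia.
have -> : so 1 (to 0 f) = to 0 f by bd.
have h2 : to 0 f = to 0 (T w) by bd.
rewrite {1}h2 co_tr; [|lia].
have -> : w *_0 to 1 f *_0 to 0 f = to 1 (T w).
  have -> : to 0 f = to 0 (w *_0 to 1 f) by bd.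
  by rewrite co_tr //; bd.
by rewrite co_tr //; lia.
Qed.

Lemma fone_co i a b : i < m.-1 -> dim m.-1 a -> dim m.-1 b -> to i a = so i b ->
  fone (a *_i b) = fop i a (fone a) b (fone b).
Proof.
move=> im da db e; have iK : i < K by lia.
have dam : dim m a by apply: dimW da _; lia.
have dbm : dim m b by apply: dimW db _; lia.
have dab : dim m.-1 (a *_i b) by apply: dim_co => //; lia.
apply: (@famN_eq (a *_i b)); first exact: famN_one.
  by apply: famN_op => //; [lia | exact: famN_one | exact: famN_one].
move=> w hw; rewrite {1}/fone selT //; move: hw; rewrite left_of_co //; last lia.
move=> hw; have [dw ew] := hw.
have [i0|i0] := eqVneq i 0; last first.
  rewrite fop_leftS // /fone.
  have e0 : so 0 a = so 0 b by apply: comp_s0 e; lia.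
  rewrite !selT -?(left_of_so _ e0) //.
  by rewrite wl_co //; [lia | apply: dimW dw _; lia].
subst i; have hwb := left_of_next e hw; rewrite fop_left0 // /fone !selT //.
have dt : dim 1 (to 1 a) by apply: dim_to; lia.
rewrite -coA; [|sc..]; rewrite int_r; [|sc..].
by congr (_ *_1 _); congr (_ *_0 _); bd.
Qed.

(** For [i > 0] this is exchange, applied at each [w]. For [i = 0] the composite of families is a
    whisker followed by a [1]-composition: if [j > 1], exchange between 1 and [j] suffices; if
    [j = 1], the two middle factors occur in opposite orders on the two sides, and [fam_slide] swaps
    them. *)
Lemma fop_exch i j f f' g g' T T' U U' : i < j < m ->
  dim m f -> dim m f' -> dim m g -> dim m g' ->
  to j f = so j g -> to j f' = so j g' -> to i f = so i f' ->
  famN f T -> famN f' T' -> famN g U -> famN g' U' ->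
  fop j (f *_i f') (fop i f T f' T') (g *_i g') (fop i g U g' U') =
  fop i (f *_j g) (fop j f T g U) (f' *_j g') (fop j f' T' g' U').
Proof.
move=> ij df df' dg dg' e e' ei NT NT' NU NU'.
have iK : i < K by lia.
have jK : j < K by lia.
have sg0 : so i f = so i g by apply: comp_s0 e; lia.
have tg0 : to i f = to i g by apply: comp_t0 e; lia.
have sg0' : so i f' = so i g' by apply: comp_s0 e'; lia.
have eg : to i g = so i g' by congruence.
have e1 : to j (f *_i f') = so j (g *_i g') by bd.
have e2 : to i (f *_j g) = so i (f' *_j g') by bd.
have d1 : dim m (f *_i f') by apply: dim_co => //; lia.
have d2 : dim m (g *_i g') by apply: dim_co => //; lia.
have d3 : dim m (f *_j g) by apply: dim_co => //; lia.
have d4 : dim m (f' *_j g') by apply: dim_co => //; lia.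
have ijK : i < j < K by lia.
apply: (@famN_eq ((f *_i f') *_j (g *_i g'))).
- by apply: famN_op => //; first [lia | by apply: famN_op => //; lia].
- by rewrite co_exch //; apply: famN_op => //; first [lia | by apply: famN_op => //; lia].
move=> w; rewrite left_of_co //; [|lia]; rewrite left_of_co //; [|lia].
move=> hw; have [dw ew] := hw.
have [FT _] := NT; have [FT' _] := NT'; have [FU _] := NU; have [FU' _] := NU'.
have s0g : so 0 f = so 0 g by apply: comp_s0 e; lia.
have s0g' : so 0 f' = so 0 g' by apply: comp_s0 e'; lia.
have hwg : left_of g w by rewrite -(left_of_so _ s0g).
have st := fam_sim FT dw ew; have su := fam_sim FU dw (proj2 hwg).
have j0 : j != 0 by lia.
rewrite (fop_leftS _ _ _ j0); [|by rewrite left_of_co //; lia].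
have [i0|i0] := eqVneq i 0; last first.
  have s0f' : so 0 f = so 0 f' by apply: comp_s0 ei; lia.
  have hwf' : left_of f' w by rewrite -(left_of_so _ s0f').
  have hwg' : left_of g' w by rewrite -(left_of_so _ s0g').
  rewrite !(fop_leftS _ _ _ i0) ?left_of_co //; try lia.
  rewrite !(fop_leftS _ _ _ j0) //.
  have st' := fam_sim FT' dw (proj2 hwf'); have su' := fam_sim FU' dw (proj2 hwg').
  have ewf := proj2 hwf'; have ewg := proj2 hwg; have ewg' := proj2 hwg'.
  have dwi : dim i w by apply: dimW dw _; lia.
  have dwj : dim j w by apply: dimW dw _; lia.
  by rewrite co_exch //; bd.
subst i; have hwf' := left_of_next ei hw; have hwg' := left_of_next eg hwg.
rewrite !fop_left0 ?left_of_co //; try lia.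
have dt : dim 1 (to 1 f) by apply: dim_to; lia.
have dt' : dim 1 (to 1 g) by apply: dim_to; lia.
have ds : dim 1 (so 1 f') by apply: dim_so; lia.
have ds' : dim 1 (so 1 g') by apply: dim_so; lia.
have st' := fam_sim FT' (proj1 hwf') (proj2 hwf').
have su' := fam_sim FU' (proj1 hwg') (proj2 hwg').
have ewg := proj2 hwg; have ewf' := proj2 hwf'; have ewg' := proj2 hwg'.
have [j1|j1] := eqVneq j 1; last first.
  have t1 : to 1 (f *_j g) = to 1 f by bd.
  have t2 : to 1 f = to 1 g by apply: comp_t0 e; lia.
  have s1 : so 1 (f' *_j g') = so 1 f' by bd.
  have s2 : so 1 f' = so 1 g' by apply: comp_s0 e'; lia.
  rewrite t1 s1 !(fop_leftS _ _ _ j0) //.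
  have dj : dim j (so 1 f') by apply: dimW ds _; lia.
  have dwj : dim j w by apply: dimW dw _; lia.
  have dtj : dim j (to 1 f) by apply: dimW dt _; lia.
  rewrite wr_co; [|sc..].
  rewrite -t2 -s2 in su' *.
  by rewrite (co_exch (i := 1)); sc.
subst j.
have t1 : to 1 (f *_1 g) = to 1 g by bd.
have s1 : so 1 (f' *_1 g') = so 1 f' by bd.
have wg : left_of f' (w *_0 to 1 g).
  by have := left_of_next (f := g) (g := f') _ hwg; apply; rewrite -tg0 ei.
rewrite t1 s1 !(fop_leftS _ _ _ j0) //.
rewrite wr_co; [|sc..].
have sw := fam_sim FT' (proj1 wg) (proj2 wg).
have := fam_slide df' dg _ FT' FU (proj1 hwg) (proj2 hwg).
have -> : w *_0 so 1 g = w *_0 to 1 f by rewrite e.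
have e3 : to 0 g = so 0 f' by congruence.
move=> /(_ e3); rewrite e' => sl.
rewrite -[LHS]coA; [|sc..].
rewrite [X in X *_1 _]coA; [|sc..].
rewrite sl -[X in X *_1 _]coA; [|sc..].
by rewrite coA; sc.
Qed.

Lemma fop_inv f T : dim m f -> famN f T -> exists U,
  [/\ famN (invo m.-1 f) U,
      fop m.-1 f T (invo m.-1 f) U = fone (so m.-1 f) &
      fop m.-1 (invo m.-1 f) U f T = fone (to m.-1 f)].
Proof.
move=> df NT; have [FT _] := NT.
have mp : 0 < m.-1 < K by lia.
have m0 : m.-1 != 0 by lia.
have mm : m.-1 < m by lia.
have dV : dim m (invo m.-1 f) by apply: dim_invo => //; lia.
have NU := famN_sel (fam_inv df FT).
set U := fun w => _ in NU.
have e1 : to m.-1 f = so m.-1 (invo m.-1 f) by bd.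
have e2 : to m.-1 (invo m.-1 f) = so m.-1 f by bd.
have s0 : so 0 (invo m.-1 f) = so 0 f by bd.
exists U; split=> //.
- have N := famN_op mm df dV e1 NT NU; rewrite co_xV // in N.
  apply: (famN_eq N); first by apply: famN_one; apply: dim_so; lia.
  move=> w hw; have s1 : so 0 (so m.-1 f) = so 0 f by bd.
  have hw1 : left_of f w by rewrite -(left_of_so _ s1).
  have hw2 : left_of (invo m.-1 f) w by rewrite (left_of_so _ s0).
  rewrite fop_leftS // /U /fone !selT // co_xV //.
  have [dw ew] := hw1; have st := fam_sim FT dw ew.
  have dwi : dim m.-1 w by apply: dimW dw _; lia.
  by bd.
- have N := famN_op mm dV df e2 NU NT; rewrite co_Vx // in N.
  apply: (famN_eq N); first by apply: famN_one; apply: dim_to; lia.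
  move=> w hw; have s1 : so 0 (to m.-1 f) = so 0 f by bd.
  have hw1 : left_of f w by rewrite -(left_of_so _ s1).
  have hw2 : left_of (invo m.-1 f) w by rewrite (left_of_so _ s0).
  rewrite fop_leftS // /U /fone !selT // co_Vx //.
  have [dw ew] := hw1; have st := fam_sim FT dw ew.
  have dwi : dim m.-1 w by apply: dimW dw _; lia.
  by bd.
Qed.

End Families.

(* A left strategy in dimension [k], extended to all cells through their
   [k]-dimensional identities.  For [k > 1], [st_co0] is the left rule since
   [so 1 (sg y) = so 1 y] and [to 1 (sg x) = to 1 x]; for [k = 1] these are [y]
   and the representative of [x]. *)
Record strat (A : ocat) (k : nat) (sg : A -> A) : Prop := Strat {
  st_s : forall x, dim k x -> so k (sg x) = x;
  st_dim : forall x, k.+1 < od A -> dim k x -> dim k.+1 (sg x);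
  st_cell : forall x, (k.+1 < od A -> dim k.+1 x) ->
    to k (sg (so k x)) = to k (sg (to k x));
  st_norm : forall x, dim k x -> sg (to k (sg x)) = to k (sg x);
  st_co : forall i x y, 0 < i < k -> dim k x -> dim k y -> to i x = so i y ->
    sg (x *_i y) = sg x *_i sg y;
  st_co0 : forall x y, dim k x -> dim k y -> to 0 x = so 0 y ->
    sg (x *_0 y) = (sg x *_0 so 1 (sg y)) *_1 sg (to 1 (sg x) *_0 y) }.

(** * The normal form of a cell of dimension k+1, from a strategy in dimension k *)

Section Hat.

Variables (A : ocat) (k : nat) (sg1 sg : A -> A).
Local Notation K := (od A).
Hypotheses (k0 : 0 < k) (kK : k.+1 < K).
Hypotheses (S1 : strat 1 sg1) (Sk : strat k sg) (k1 : k = 1 -> sg = sg1).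

Definition hatA x : A := sg (so k x) *_k invo k (sg (to k x)).

Lemma sgk_sim x : dim k x -> sim k (sg x) x.
Proof. by move=> d; split; [apply: st_s | lia]. Qed.

Lemma sgk_par x : dim k.+1 x -> to k (sg (so k x)) = to k (sg (to k x)).
Proof. by move=> dx; apply: (st_cell Sk). Qed.

Lemma hatA_comp x : dim k.+1 x -> to k (sg (so k x)) = so k (invo k (sg (to k x))).
Proof. by move=> dx; rewrite s_invo -?sgk_par //; lia. Qed.

Lemma hatA_dim x : dim k.+1 x -> dim k.+1 (hatA x).
Proof.
move=> dx; apply: dim_co; [lia | exact: hatA_comp | |].
  by apply: (st_dim Sk) => //; apply: dim_so; lia.
by apply: dim_invo; [lia | lia |]; apply: (st_dim Sk) => //; apply: dim_to; lia.
Qed.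

Lemma hatA_sim x : dim k.+1 x -> so k (hatA x) = so k x.
Proof.
by move=> dx; rewrite sc_eq ?hatA_comp ?(st_s Sk) //; [apply: dim_so; lia | lia].
Qed.

Lemma hatA_tim x : dim k.+1 x -> to k (hatA x) = to k x.
Proof.
move=> dx; rewrite tc_eq ?hatA_comp //; [|lia].
by rewrite t_invo ?(st_s Sk) //; [apply: dim_to; lia | lia].
Qed.

Lemma hatA_s i x : dim k.+1 x -> i < k.+1 -> so i (hatA x) = so i x.
Proof.
move=> dx ik; rewrite -(@ss_le _ i k) ?hatA_sim ?ss_le //; lia.
Qed.

Lemma hatA_t i x : dim k.+1 x -> i < k.+1 -> to i (hatA x) = to i x.
Proof.
move=> dx ik; rewrite -(@tt_le _ i k) ?hatA_tim ?tt_le //; lia.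
Qed.

Lemma hatA_id x : dim k x -> hatA x = x.
Proof.
move=> dx; rewrite /hatA (dim_s dx) ?(dim_t dx) ?co_xV ?(st_s Sk) //; lia.
Qed.

Lemma hatA_co i x y : 0 < i < k.+1 -> dim k.+1 x -> dim k.+1 y -> to i x = so i y ->
  hatA (x *_i y) = hatA x *_i hatA y.
Proof.
move=> ik dx dy e.
have dsx : dim k (so k x) by apply: dim_so; lia.
have dsy : dim k (so k y) by apply: dim_so; lia.
have dtx : dim k (to k x) by apply: dim_to; lia.
have dty : dim k (to k y) by apply: dim_to; lia.
have h1 := sgk_sim dsx; have h2 := sgk_sim dsy.
have h3 := sgk_sim dtx; have h4 := sgk_sim dty.
have p1 := sgk_par dx; have p2 := sgk_par dy.
have kV : 0 < k < K by lia.
(* For [i = k] the inverse of [sg] at the common boundary cancels against [sg] at that boundary; for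
   [i < k] exchange suffices. *)
have [ek|nk] := eqVneq i k.
  subst i; rewrite /hatA sc_eq ?tc_eq //; try lia.
  rewrite [RHS]coA; [|sc..].
  rewrite -[invo k _ *_k (sg (so k y) *_k _)]coA; [|sc..].
  rewrite e co_Vx //.
  have -> : to k (sg (so k y)) = so k (invo k (sg (to k y))) by bd.
  by rewrite co_sl //; lia.
rewrite /hatA sc_lt ?tc_lt //; try lia.
rewrite !(st_co Sk) //; try lia; try bd.
rewrite invo_co; [|sc..].
by rewrite co_exch; sc.
Qed.

(** For [k > 1] inverses commute with whiskering and exchange regroups the factors. For [k = 1] the
    right side contains [sg (to 1 x *_0 so 1 y)]; expanding it by the left rule produces
    [sg (to 1 x) *_0 so 1 y], which cancels the inverse contained in [hatA x]. *)
Lemma hatA_co0 x y : dim k.+1 x -> dim k.+1 y -> to 0 x = so 0 y ->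
  hatA (x *_0 y) = (hatA x *_0 so 1 y) *_1 hatA (to 1 x *_0 y).
Proof.
move=> dx dy e.
have dsx : dim k (so k x) by apply: dim_so; lia.
have dsy : dim k (so k y) by apply: dim_so; lia.
have dtx : dim k (to k x) by apply: dim_to; lia.
have dty : dim k (to k y) by apply: dim_to; lia.
have h1 := sgk_sim dsx; have h2 := sgk_sim dsy.
have h3 := sgk_sim dtx; have h4 := sgk_sim dty.
have p1 := sgk_par dx; have p2 := sgk_par dy.
have kV : 0 < k < K by lia.
have ex : dim 1 (to 1 x) by apply: dim_to; lia.
have dv : dim 1 (so 1 y) by apply: dim_so; lia.
have dxk : dim k (to 1 x) by apply: dimW ex _; lia.
have d1 : dim k (to 1 x *_0 so k y).
  by apply: dim_co; [lia | bd | done | done].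
have d2 : dim k (to 1 x *_0 to k y).
  by apply: dim_co; [lia | bd | done | done].
have h5 := sgk_sim d1; have h6 := sgk_sim d2.
have p3 := @sgk_par (to 1 x *_0 y).
have e1 : so k (to 1 x *_0 y) = to 1 x *_0 so k y by bd.
have e2 : to k (to 1 x *_0 y) = to 1 x *_0 to k y by bd.
have dxy : dim k.+1 (to 1 x *_0 y).
  by apply: dim_co; [lia | bd | apply: dimW ex _; lia | done].
have {}p3 := p3 dxy; rewrite e1 e2 in p3.
rewrite {1}/hatA sc_lt ?tc_lt //; try lia.
rewrite [sg (so k x *_0 so k y)](st_co0 Sk) //; [|bd].
rewrite [sg (to k x *_0 to k y)](st_co0 Sk) //; [|bd].
have [ek|nk] := eqVneq k 1; last first.
  have -> : so 1 (sg (so k y)) = so 1 y by bd.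
  have -> : so 1 (sg (to k y)) = so 1 y by bd.
  have -> : to 1 (sg (so k x)) = to 1 x by bd.
  have -> : to 1 (sg (to k x)) = to 1 x by bd.
  rewrite invo_co; [|sc..].
  rewrite invo_co; [|sc..].
  have dvk : dim k (so 1 y) by apply: dimW dv _; lia.
  rewrite (invo_id _ dvk); [|lia].
  rewrite co_exch; [|sc..].
  by rewrite -wr_co ?[in RHS]/hatA ?e1 ?e2; sc.
rewrite [in RHS]/hatA e1 e2.
rewrite ek in dsx dsy dtx dty h1 h2 h3 h4 p1 p2 d1 d2 h5 h6 p3 *.
have Sk1 : strat 1 sg by rewrite -ek.
have -> : so 1 (sg (so 1 y)) = so 1 y by bd.
have K1 : 0 < 1 < K by lia.
have eS : sg (to 1 x *_0 so 1 y) =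
    (sg (to 1 x) *_0 so 1 y) *_1 sg (to 1 (sg (so 1 x)) *_0 so 1 y).
  rewrite (st_co0 Sk1) //; last bd.
  by rewrite p1; congr (_ *_1 _); congr (_ *_0 _); bd.
have eQ : sg (to 1 x *_0 to 1 y) =
    (sg (to 1 x) *_0 so 1 (sg (to 1 y))) *_1 sg (to 1 (sg (to 1 x)) *_0 to 1 y).
  by rewrite (st_co0 Sk1) //; bd.
rewrite -eQ eS wr_co; [|sc..].
have du : dim 1 (to 1 (sg (so 1 x))) by apply: dim_to; lia.
have dus : dim 1 (to 1 (sg (so 1 x)) *_0 so 1 y).
  by apply: dim_co; [lia | bd | done | done].
have hs : so 1 (sg (to 1 (sg (so 1 x)) *_0 so 1 y)) = to 1 (sg (so 1 x)) *_0 so 1 y.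
  exact: (st_s Sk1).
have ht : to 1 (sg (to 1 (sg (so 1 x)) *_0 so 1 y)) = to 1 (sg (to 1 x *_0 to 1 y)).
  by rewrite -p3 eS tc_eq; sc.
rewrite [LHS]coA; [|sc..].
rewrite [RHS]coA; [|sc..].
congr (_ *_1 _).
rewrite -[RHS]coA; [|sc..].
congr (_ *_1 _); rewrite -[RHS]coA; [|sc..].
rewrite -wr_co; [|sc..].
rewrite co_Vx //.
have -> : to 1 (sg (to 1 x)) *_0 so 1 y =
    so 1 (sg (to 1 (sg (so 1 x)) *_0 so 1 y)) by rewrite hs p1.
by rewrite co_sl //; lia.
Qed.

Lemma strat_hats : hats k.+1 hatA sg1.
Proof.
have K2 : 2 < K by lia.
split.
- exact: (st_s S1).
- by move=> w; apply: (st_dim S1).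
- by move=> x dx; apply: (st_cell S1).
- exact: (st_norm S1).
- move=> w v dw dv e; rewrite (st_co0 S1) //; congr ((_ *_0 _) *_1 _).
  exact: (st_s S1).
- exact: hatA_dim.
- exact: hatA_s.
- exact: hatA_t.
- by move=> x y dx dy; rewrite /hatA /= => -> ->.
- exact: hatA_id.
- exact: hatA_co.
- exact: hatA_co0.
(* For [k = 1] the normal form of [sg1 w] is [sg1 w] followed by the inverse of [sg1] at a normal
   form, which is trivial. For [k > 1], [sg1 w] is an identity among the [k.+1]-cells. *)
- move=> w dw; have [ek|nk] := eqVneq k 1; last first.
    by apply: hatA_id; apply: dimW (st_dim S1 _ dw) _; lia.
  have d1 : dim 1 (to 1 (sg1 w)) by apply: dim_to; lia.
  rewrite /hatA ek (k1 ek) (st_s S1) // (st_norm S1) //.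
  by rewrite (invo_id _ d1) ?co_tr //; lia.
- by move=> x [ek] dx; rewrite /hatA ek (k1 ek).
Qed.

End Hat.

(** * Cells of every dimension as cells of the ambient presentation *)

Section Embed.

Variables (n : edim) (C : globcat) (HC : is_n1cat n C) (K : nat) (HK : leD K n).
Local Notation A := (amb HC HK).

Definition em j (a : C j) : A := idc K a.

Lemma em_so i j (a : C j) : i < j <= K -> so i (em a) = em (src i a).
Proof. by move=> ij; rewrite /so /= (src_idcK HC). Qed.

Lemma em_to i j (a : C j) : i < j <= K -> to i (em a) = em (tgt i a).
Proof. by move=> ij; rewrite /to /= (tgt_idcK HC). Qed.

Lemma em_dim j (a : C j) : j < K -> dim j (em a).
Proof.
move=> jK; rewrite /dim /so /= (src_idcK_ge HC) //; last lia.
by rewrite (idcK_idc HC) //; lia.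
Qed.

Lemma em_co i j (a b : C j) : i < j <= K -> tgt i a = src i b ->
  em (compo i a b) = em a *_i em b.
Proof. by move=> ij e; rewrite /em (idcK_comp HC). Qed.

Lemma em_inj j (a b : C j) : j <= K -> em a = em b -> a = b.
Proof. exact: (idcK_inj HC). Qed.

Lemma em_src j (x : A) : j < K -> dim j x -> em (src j x) = x.
Proof. by []. Qed.

Lemma src_em j (a : C j) : j < K -> src j (em a) = a.
Proof.
move=> jK; rewrite /em (src_idcK_ge HC) //; last lia.
by rewrite (idc_refl (proj1 HC)) //; arD.
Qed.

Lemma em_idc i j (a : C i) : i <= j <= K -> em (idc j a) = em a.
Proof. by move=> ij; rewrite /em (idcK_idc HC). Qed.

Lemma em_comp i j (a b : C j) : i < j <= K -> to i (em a) = so i (em b) ->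
  tgt i a = src i b.
Proof. by move=> ij; rewrite em_to ?em_so // => /em_inj; apply; lia. Qed.

Lemma comp_em i j (a b : C j) : i < j <= K -> tgt i a = src i b ->
  to i (em a) = so i (em b).
Proof. by move=> ij e; rewrite em_to ?em_so ?e. Qed.

End Embed.

(** * A compatible choice of families over all cells *)

Section Step.

Variables (n : edim) (C : globcat) (HC : is_n1cat n C) (k : nat).
Hypotheses (k0 : 0 < k) (HK : leD k.+2 n).
Local Notation A := (amb HC HK).
Variables (G : Type) (inc : G -> C k.+1).
Hypothesis gen : generates inc.
Variables (h sg : A -> A).
Hypothesis (H : hats k.+1 h sg).
Hypothesis (fill2 : forall x : A, 2 < k.+1 -> dim 2 x -> so 1 x = to 1 x ->
  exists y : A, so 2 y = x /\ to 2 y = so 1 x).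
Hypothesis (fill : forall x y : A, dim k.+1 x -> dim k.+1 y ->
  so k x = so k y -> to k x = to k y ->
  exists z : A, so k.+1 z = x /\ to k.+1 z = y).

Let mK : 1 < k.+1 < od A.
Proof. by rewrite /=; lia. Qed.

Local Notation e := (@em n C HC k.+2 HK _).

Definition fok (q : C k.+1 * (A -> A)) : Prop := famN k.+1 h sg (e q.1) q.2.

Definition fcell : Type := {q | fok q}.

Definition fc_cell (x : fcell) : C k.+1 := (sval x).1.
Definition fc_fam (x : fcell) : A -> A := (sval x).2.

Lemma fc_N (x : fcell) : famN k.+1 h sg (e (fc_cell x)) (fc_fam x).
Proof. exact: (proj2_sig x). Qed.

Lemma fc_eq (x y : fcell) : fc_cell x = fc_cell y -> fc_fam x = fc_fam y -> x = y.
Proof.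
case: x y => [[f T] p] [[g U] q]; rewrite /fc_cell /fc_fam /= => ef eT.
by subst; rewrite (proof_irrelevance _ p q).
Qed.

Lemma fc_unit_proof (a : C k) :
  fok (idc k.+1 a, fone (e a)).
Proof.
rewrite /fok /= em_idc; last lia.
by apply: (famN_one mK H); apply: em_dim; lia.
Qed.

Definition fc_unit (a : C k) : fcell := exist fok _ (fc_unit_proof a).

Definition fc_pair i (x y : fcell) : C k.+1 * (A -> A) :=
  (compo i (fc_cell x) (fc_cell y),
   fop i (e (fc_cell x)) (fc_fam x) (e (fc_cell y)) (fc_fam y)).

(** The fallback [x] makes the operation total; by [fc_compE] it is never reached on composable
    pairs. *)
Definition fc_comp i (x y : fcell) : fcell :=
  match excluded_middle_informative (fok (fc_pair i x y)) with
  | left p => exist fok _ p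
  | right _ => x
  end.

Lemma fc_dim (x : fcell) : dim k.+1 (e (fc_cell x)).
Proof. exact: em_dim. Qed.

Lemma fc_compE i x y : i <= k -> tgt i (fc_cell x) = src i (fc_cell y) ->
  sval (fc_comp i x y) = fc_pair i x y.
Proof.
move=> ik ec; rewrite /fc_comp; case: excluded_middle_informative => // -[]; rewrite /fok /=.
rewrite em_co //; last lia.
apply: (famN_op mK H) => //; try exact: fc_N; try exact: fc_dim.
by apply: comp_em => //; lia.
Qed.

Lemma fc_cellE i x y : i <= k -> tgt i (fc_cell x) = src i (fc_cell y) ->
  fc_cell (fc_comp i x y) = compo i (fc_cell x) (fc_cell y).
Proof. by move=> ik ec; rewrite {1}/fc_cell fc_compE. Qed.

Lemma fc_famE i x y : i <= k -> tgt i (fc_cell x) = src i (fc_cell y) ->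
  fc_fam (fc_comp i x y) =
  fop i (e (fc_cell x)) (fc_fam x) (e (fc_cell y)) (fc_fam y).
Proof. by move=> ik ec; rewrite {1}/fc_fam fc_compE. Qed.

Lemma fc_displayed : displayed fc_cell fc_unit fc_comp.
Proof.
have Cn := proj1 HC.
have cc := fc_cellE; have ff := fc_famE.
have kn : leD k.+1 n by arD.
have ce i (x y : fcell) : i <= k -> tgt i (fc_cell x) = src i (fc_cell y) ->
    to i (e (fc_cell x)) = so i (e (fc_cell y)).
  by move=> ik; apply: comp_em; lia.
split=> //.
- move=> i x y z ik e1 e2.
  have e5 : tgt i (compo i (fc_cell x) (fc_cell y)) = src i (fc_cell z).
    by rewrite (tgt_comp Cn).
  have e6 : tgt i (fc_cell x) = src i (compo i (fc_cell y) (fc_cell z)).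
    by rewrite (src_comp Cn).
  have e3 : tgt i (fc_cell (fc_comp i x y)) = src i (fc_cell z) by rewrite cc.
  have e4 : tgt i (fc_cell x) = src i (fc_cell (fc_comp i y z)) by rewrite cc.
  apply: fc_eq; first by rewrite !cc // (comp_assoc Cn).
  rewrite !ff // !cc // !em_co //; try lia.
  by apply: (fop_assoc mK H); first [done | exact: ce | exact: fc_dim | exact: fc_N].
- move=> i x ik.
  have e1 : tgt i (fc_cell (fc_unit (idc k (src i (fc_cell x))))) = src i (fc_cell x).
    rewrite /fc_cell /= (idc_idc Cn) //; last lia.
    by rewrite (tgt_idc Cn) ?(idc_refl Cn) //; first [lia|arD].
  apply: fc_eq.
    by rewrite cc // /fc_cell /= (idc_idc Cn) ?(comp_idl Cn) //; lia.
  rewrite ff // {1}/fc_cell /= em_idc; last lia.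
  rewrite {1}/fc_fam /= em_idc; last lia.
  rewrite -em_so; last lia.
  by apply: (fop_idl mK H) => //; [exact: fc_dim | exact: fc_N].
- move=> i x ik.
  have e1 : tgt i (fc_cell x) = src i (fc_cell (fc_unit (idc k (tgt i (fc_cell x))))).
    rewrite /fc_cell /= (idc_idc Cn) //; last lia.
    by rewrite (src_idc Cn) ?(idc_refl Cn) //; first [lia|arD].
  apply: fc_eq.
    by rewrite cc // /fc_cell /= (idc_idc Cn) ?(comp_idr Cn) //; lia.
  rewrite ff // [fc_cell (fc_unit _)]/fc_cell /= em_idc; last lia.
  rewrite [fc_fam (fc_unit _)]/fc_fam /= em_idc; last lia.
  rewrite -em_to; last lia.
  by apply: (fop_idr mK H) => //; [exact: fc_dim | exact: fc_N].
- move=> i a b ik ab.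
  have e1 : tgt i (fc_cell (fc_unit a)) = src i (fc_cell (fc_unit b)).
    by rewrite /fc_cell /= (tgt_idcK HC kn) ?(src_idcK HC kn) //; lia.
  have ik' : i <= k by lia.
  apply: fc_eq; first by rewrite cc // /fc_cell /= (idc_comp Cn) //; lia.
  rewrite ff // /fc_fam /fc_cell /= !em_idc ?em_co //; try lia.
  apply: (fone_co mK H) => //; try (apply: em_dim; lia).
  by apply: comp_em => //; lia.
- move=> i j x x' y y' ij e1 e2 e3.
  have ik : i <= k by lia.
  have jk : j <= k by lia.
  have d1 : tgt i (fc_cell y) = src i (fc_cell y').
    apply: (@em_comp n C HC k.+2 HK); first lia.
    rewrite -(@comp_t0 _ j i _ _ _ (ce _ _ _ jk e1)); last by rewrite /=; lia.
    rewrite -(@comp_s0 _ j i _ _ _ (ce _ _ _ jk e2)); last by rewrite /=; lia.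
    exact: ce.
  have d4 : tgt j (compo i (fc_cell x) (fc_cell x')) =
      src j (compo i (fc_cell y) (fc_cell y')).
    by rewrite (tgt_comp_lt Cn) // (src_comp_lt Cn) // e1 e2.
  have d2 : tgt j (fc_cell (fc_comp i x x')) = src j (fc_cell (fc_comp i y y')).
    by rewrite !cc.
  have d5 : tgt i (compo j (fc_cell x) (fc_cell y)) =
      src i (compo j (fc_cell x') (fc_cell y')).
    rewrite -(tgt_src Cn (i := i) (j := j)) // -(src_src Cn (i := i) (j := j)) //.
    rewrite !(src_comp Cn) //; try lia.
    by rewrite (tgt_src Cn) // (src_src Cn).
  have d3 : tgt i (fc_cell (fc_comp j x y)) = src i (fc_cell (fc_comp j x' y')).
    by rewrite !cc.
  apply: fc_eq; first by rewrite !cc // (exchange Cn).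
  rewrite !ff // !cc // !em_co //; try lia.
  by apply: (fop_exch mK H fill2); try exact: fc_dim; try exact: fc_N; try exact: ce; lia.
- move=> _ x.
  have [U [NU U1 U2]] := fop_inv mK H (fc_dim x) (fc_N x).
  rewrite [k.+1.-1]/= in NU U1 U2.
  have kk : k < k.+1 <= k.+2 by lia.
  have [g [ga gb gc gd]] := HC.2 k.+1 (fc_cell x) k0 kn.
  rewrite /= in ga gb gc gd.
  have eg : e g = invo k (e (fc_cell x)).
    symmetry; apply: invo_eq; first by rewrite /=; lia.
    split.
    + by rewrite em_so ?em_to ?ga //; lia.
    + by rewrite em_so ?em_to ?gb //; lia.
    + by rewrite -em_co ?ga // gc em_so ?em_idc //; lia.
    + by rewrite -em_co ?gb // gd em_to ?em_idc //; lia.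
  rewrite -eg in NU U1 U2.
  pose y : fcell := exist fok (g, U) NU.
  exists y; split=> //; apply: fc_eq; rewrite ?cc ?ff //=.
  + by rewrite {1}/fc_fam U1 em_so //; lia.
  + by rewrite {1}/fc_fam U2 em_to //; lia.
Qed.

(** [fam_ex] provides a family over each generator, and generation extends this choice to a section
    of [fc_displayed]; the last three clauses are its compatibility with units and compositions. *)
Lemma fam_section : exists T : C k.+1 -> A -> A,
  [/\ forall f, fam k.+1 h sg (e f) (T f),
      forall (a : C k) w, left_of (e a) w -> T (idc k.+1 a) w = w *_0 e a,
      forall i f g w, 0 < i <= k -> tgt i f = src i g -> left_of (e f) w ->
        T (compo i f g) w = T f w *_i T g w &
      forall f g w, tgt 0 f = src 0 g -> left_of (e f) w ->
        T (compo 0 f g) w = (T f w *_0 so 1 (e g)) *_1 T g (w *_0 to 1 (e f))].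
Proof.
have [|r [r1 r2 r3]] := gen fc_displayed.
  move=> x.
  have [T FT] := fam_ex mK H (em_dim HC HK (inc x) ltac:(lia)) fill.
  by exists (exist fok (inc x, _) (famN_sel mK H FT)).
exists (fun f => fc_fam (r f)); split.
- by move=> f; have [F _] := fc_N (r f); rewrite -{1}(r1 f).
- by move=> a w hw; rewrite r2 /fc_fam /= /fone selT.
- move=> i f g w ik ec hw; rewrite r3 ?fc_famE ?r1 //; try lia.
  by apply: fop_leftS => //; lia.
- move=> f g w ec hw; rewrite r3 ?fc_famE ?r1 //.
  exact: fop_left0.
Qed.

End Step.

(** * Correction on the normal forms *)

Section Correction.

Variables (A : ocat) (m : nat) (h sg tau : A -> A).
Hypotheses (mK : 1 < m < od A) (Km : od A = m.+1) (H : hats m h sg).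
Hypothesis tau_s : forall x, dim m x -> so m (tau x) = x.
Hypothesis tau_t : forall x, dim m x -> to m (tau x) = h x.
Hypothesis tau_id : forall x, dim m.-1 x -> tau x = x.
Hypothesis tau_co : forall i x y, 0 < i < m -> dim m x -> dim m y ->
  to i x = so i y -> tau (x *_i y) = tau x *_i tau y.
Hypothesis tau_co0 : forall x y, dim m x -> dim m y -> to 0 x = so 0 y ->
  tau (x *_0 y) = (tau x *_0 so 1 y) *_1 tau (to 1 x *_0 y).

(* The correction by [tau (h x)] makes [tau] trivial on the cells [h x]. *)
Definition corr x : A := tau x *_m invo m (tau (h x)).

Lemma tau_sim x : dim m x -> sim m (tau x) x.
Proof. by move=> dx; split; [exact: tau_s | lia]. Qed.

Lemma hh x : dim m x -> h (h x) = h x.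
Proof.
move=> dx; apply: (h_par H) => //; first exact: (h_dim H).
- by rewrite (h_s H) //; lia.
- by rewrite (h_t H) //; lia.
Qed.

Lemma corr_c x : dim m x -> to m (tau x) = so m (invo m (tau (h x))).
Proof. by move=> dx; rewrite tau_t // s_invo ?tau_t ?hh //; [exact: (h_dim H) | lia]. Qed.

Lemma corr_tt x : dim m x -> to m (tau x) = to m (tau (h x)).
Proof. by move=> dx; rewrite !tau_t ?hh //; exact: (h_dim H). Qed.

Lemma corr_s x : dim m x -> so m (corr x) = x.
Proof. by move=> dx; rewrite sc_eq ?corr_c ?tau_s //; lia. Qed.

Lemma corr_t x : dim m x -> to m (corr x) = h x.
Proof.
move=> dx; rewrite tc_eq ?corr_c //; last lia.
by rewrite t_invo ?tau_s //; [exact: (h_dim H) | lia].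
Qed.

Lemma corr_sim x : dim m x -> sim m (corr x) x.
Proof. by move=> dx; split; [exact: corr_s | lia]. Qed.

(** [tau] commutes with whiskering on the right by the 1-cell [so 1 y], since the other factor of
    the left rule is then [tau] of a 1-cell, which is trivial. The correction terms thus obey the
    same rule as [tau], and exchange between 1 and [m] separates them. *)
Lemma corr_co0 x y : dim m x -> dim m y -> to 0 x = so 0 y ->
  corr (x *_0 y) = (corr x *_0 so 1 y) *_1 corr (to 1 x *_0 y).
Proof.
move=> dx dy e.
have du : dim 1 (to 1 x) by apply: dim_to; lia.
have dv : dim 1 (so 1 y) by apply: dim_so; lia.
have dum : dim m (to 1 x) by apply: dimW du _; lia.
have dvm : dim m (so 1 y) by apply: dimW dv _; lia.
have duy : dim m (to 1 x *_0 y) by apply: dim_co => //; [lia|bd].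
have dhx := h_dim H dx; have dhuy := h_dim H duy.
have s1h : so 1 (h x) = so 1 x by apply: (h_s H) => //; lia.
have t1h : to 1 (h x) = to 1 x by apply: (h_t H) => //; lia.
have t0h : to 0 (h x) = to 0 x by apply: (h_t H) => //; lia.
have s0h : so 0 (h x) = so 0 x by apply: (h_s H) => //; lia.
have s1h' : so 1 (h (to 1 x *_0 y)) = to 1 x *_0 so 1 y.
  by rewrite (h_s H) //; [bd|lia].
have t1h' : to 1 (h (to 1 x *_0 y)) = to 1 x *_0 to 1 y.
  by rewrite (h_t H) //; [bd|lia].
have dhv : dim m (h x *_0 so 1 y) by apply: dim_co => //; [lia|bd].
have st := tau_sim dx; have st1 := tau_sim dhx.
have st2 := tau_sim duy; have st3 := tau_sim dhuy.
have duv : dim 1 (to 1 x *_0 so 1 y) by apply: dim_co => //; [lia|bd].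
have tv : tau (h x *_0 so 1 y) = tau (h x) *_0 so 1 y.
  rewrite tau_co0 //; last bd.
  rewrite [tau (to 1 (h x) *_0 _)]tau_id; last by rewrite t1h; apply: dimW duv _; lia.
  have -> : so 1 (so 1 y) = so 1 y by bd.
  have -> : to 1 (h x) *_0 so 1 y = to 1 (tau (h x) *_0 so 1 y) by bd.
  by rewrite co_tr //; lia.
have c1 := corr_tt dx; have c2 := corr_tt duy.
rewrite /corr tau_co0 // (h_co0 H) // [tau (_ *_1 _)]tau_co //; [|lia|bd].
rewrite tv invo_co; [|sc..].
rewrite invo_co; [|sc..].
rewrite (invo_id _ dvm); last lia.
rewrite wr_co; [|sc..].
by rewrite (co_exch (i := 1)) //; sc.
Qed.

Lemma corr_strat : strat m corr.
Proof.
split.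
- exact: corr_s.
- by move=> x; rewrite Km ltnn.
- move=> x _; have mm : m < od A by lia.
  rewrite !corr_t; [|exact: dim_to|exact: dim_so].
  by apply: (h_par H); [exact: dim_so | exact: dim_to | bd | bd].
- move=> x dx; have dhx := h_dim H dx.
  by rewrite corr_t // /corr hh // co_xV ?tau_s //; lia.
- move=> i x y im dx dy e; have dhx := h_dim H dx; have dhy := h_dim H dy.
  have eh : to i (h x) = so i (h y) by rewrite (h_t H) ?(h_s H) //; lia.
  have st := tau_sim dx; have st1 := tau_sim dhx.
  have su := tau_sim dy; have su1 := tau_sim dhy.
  have c1 := corr_tt dx; have c2 := corr_tt dy.
  rewrite /corr tau_co // (h_co H) // tau_co // invo_co; [|sc..].
  by rewrite co_exch; sc.
- move=> x y dx dy e; rewrite corr_co0 //.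
  have sx := corr_sim dx; have sy := corr_sim dy.
  by congr ((_ *_0 _) *_1 corr (_ *_0 _)); bd.
Qed.

End Correction.

(** The counterpart of [strat] on graded cells. A level is built in the ambient whose dimension is
    one above its own and used again in larger ones, so it needs a form independent of the
    ambient. *)
Record good (C : globcat) (k : nat) (sigma : C k -> C k.+1) : Prop := Good {
  gd_src : forall f, src k (sigma f) = f;
  gd_cell : forall F : C k.+1, tgt k (sigma (src k F)) = tgt k (sigma (tgt k F));
  gd_norm : forall f, sigma (tgt k (sigma f)) = idc k.+1 (tgt k (sigma f));
  gd_comp : forall i f g, 0 < i < k -> tgt i f = src i g ->
    sigma (compo i f g) = compo i (sigma f) (sigma g);
  gd_comp0 : forall f g, tgt 0 f = src 0 g ->
    sigma (compo 0 f g) =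
    compo 1 (compo 0 (sigma f) (idc k.+1 (src 1 (sigma g) : C 1)))
      (sigma (compo 0 (idc k (tgt 1 (sigma f) : C 1)) g)) }.

(** * Transfer of strategies between the graded and the one-sorted forms *)

Section Lift.

Variables (n : edim) (C : globcat) (HC : is_n1cat n C) (K : nat) (HK : leD K n).
Local Notation A := (amb HC HK).
Local Notation e := (@em n C HC K HK _).

Definition lift k (sigma : C k -> C k.+1) : A -> A := fun x => e (sigma (src k x)).

Lemma em_ex k (x : A) : k.+1 <= K -> (k.+1 < K -> dim k.+1 x) ->
  exists F : C k.+1, x = e F.
Proof.
move=> kK dx; have [ek|nk] := eqVneq k.+1 K; last first.
  by exists (src k.+1 x); rewrite em_src //; [lia | apply: dx; lia].
move: x {dx}; rewrite /em /= -ek => x; exists x.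
by rewrite (idc_refl (proj1 HC)) // ek.
Qed.

Lemma liftE k (sigma : C k -> C k.+1) f : k < K -> lift sigma (e f) = e (sigma f).
Proof. by move=> kK; rewrite /lift src_em. Qed.

Lemma good_strat k sigma : 0 < k < K -> good sigma -> strat k (@lift k sigma).
Proof.
move=> kK gs; have Cn := proj1 HC; have oA : od A = K by [].
have kK' : k < K by lia.
have kk : k < k.+1 <= K by lia.
have kn : leD k.+1 n by arD.
split => //.
- by move=> x dx; rewrite -(em_src kK' dx) liftE // em_so ?(gd_src gs).
- by move=> x kK1 dx; apply: em_dim.
- move=> x dx; have [F ->] := em_ex kK' dx.
  have e1 := em_so HC HK F kk; have e2 := em_to HC HK F kk.
  by rewrite e1 e2 !liftE // !em_to // (gd_cell gs).
- move=> x dx; rewrite -(em_src kK' dx) liftE // em_to // liftE // (gd_norm gs).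
  by rewrite em_idc //; lia.
- move=> i x y ik dx dy; rewrite -(em_src kK' dx) -(em_src kK' dy) => ec.
  have iK : i < k <= K by lia.
  have ec' := em_comp iK ec.
  rewrite -em_co // !liftE // (gd_comp gs) // em_co //; first lia.
  have ik' : i < k < k.+1 by lia.
  rewrite -(tgt_src Cn (sigma (src k x)) ik') // -(src_src Cn (sigma (src k y)) ik') //.
  by rewrite !(gd_src gs).
- move=> x y dx dy; rewrite -(em_src kK' dx) -(em_src kK' dy).
  move: (src k x : C k) (src k y : C k) => f g {dx dy x y} ec.
  have k0 : 0 < k <= K by lia.
  have ec' := em_comp k0 ec.
  rewrite -em_co // !liftE // (gd_comp0 gs) //.
  set a := e (sigma f); set b := e (sigma g).
  have da : dim k (e f) by apply: em_dim.
  have db : dim k (e g) by apply: em_dim.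
  have sa : sim k a (e f) by split=> //; rewrite /a em_so // (gd_src gs).
  have sb : sim k b (e g) by split=> //; rewrite /b em_so // (gd_src gs).
  have K1 : 1 < k.+1 <= K by lia.
  have ev : e (idc k.+1 (src 1 (sigma g) : C 1)) = so 1 b.
    by rewrite em_idc ?em_so //; lia.
  have eu : e (idc k (tgt 1 (sigma f) : C 1)) = to 1 a.
    by rewrite em_idc ?em_to //; lia.
  have c1 : tgt 0 (idc k (tgt 1 (sigma f) : C 1)) = src 0 g.
    by apply: (@em_comp n C HC K HK _ _ _ _ k0); rewrite eu; bd.
  have c2 : tgt 0 (sigma f) = src 0 (idc k.+1 (src 1 (sigma g) : C 1)).
    apply: (@em_comp n C HC K HK); first lia.
    by rewrite ev -/a; bd.
  set R := sigma (compo 0 _ g).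
  have eR : so k (e R) = to 1 a *_0 e g.
    by rewrite em_so // (gd_src gs) em_co // eu.
  have sR : sim k (e R) (to 1 a *_0 e g) by split.
  have c3 : tgt 1 (compo 0 (sigma f) (idc k.+1 (src 1 (sigma g) : C 1))) = src 1 R.
    apply: (@em_comp n C HC K HK _ _ _ _ K1); rewrite em_co //.
    by rewrite ev -/a; bd.
  rewrite em_co // em_co //.
  by rewrite ev -eu -em_co // liftE.
Qed.

End Lift.

Section Lower.

Variables (n : edim) (C : globcat) (HC : is_n1cat n C) (m : nat) (HK : leD m.+1 n).
Local Notation A := (amb HC HK).
Local Notation e := (@em n C HC m.+1 HK _).
Variables (sg : A -> A) (m0 : 0 < m) (Hs : strat m sg).

Lemma em_top (x : A) : e (x : C m.+1) = x.
Proof. by rewrite /em /= (idc_refl (proj1 HC)). Qed.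

Lemma strat_good : good (fun f : C m => sg (e f) : C m.+1).
Proof.
have mm : m < m.+1 by []; have oA : od A = m.+1 by [].
have dm (f : C m) : dim m (e f) by apply: em_dim.
have es (x : A) i : i < m.+1 -> e (src i x : C i) = so i x.
  by [].
have et (x : A) i : i < m.+1 -> e (tgt i x : C i) = to i x.
  by [].
split.
- by move=> f; apply: (@em_inj n C HC m.+1 HK) => //; rewrite es // (st_s Hs).
- move=> F; apply: (@em_inj n C HC m.+1 HK) => //.
  by rewrite !et // !es // (st_cell Hs) // oA ltnn.
- by move=> f; rewrite et // (st_norm Hs).
- move=> i f g im ec; rewrite em_co //; last lia.
  by rewrite (st_co Hs) //; apply: comp_em => //; lia.
- move=> f g ec.
  have m1 : 0 < m <= m.+1 by lia.
  rewrite em_co // (st_co0 Hs) //; last exact: comp_em.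
  rewrite -[compo 1 _ _]em_top.
  set a := sg (e f); set b := sg (e g).
  have sa : sim m a (e f) by split=> //; apply: (st_s Hs).
  have sb : sim m b (e g) by split=> //; apply: (st_s Hs).
  have da := dm f; have db := dm g.
  have ec0 : to 0 (e f) = so 0 (e g) by apply: comp_em.
  have ev : e (idc m.+1 (src 1 b : C 1)) = so 1 b by rewrite em_idc ?es //; lia.
  have eu : e (idc m (tgt 1 a : C 1)) = to 1 a by rewrite em_idc ?et //; lia.
  have c1 : tgt 0 (idc m (tgt 1 a : C 1)) = src 0 g.
    by apply: (@em_comp n C HC m.+1 HK _ _ _ _ m1); rewrite eu; bd.
  have m2 : 0 < m.+1 <= m.+1 by lia.
  have m3 : 1 < m.+1 <= m.+1 by lia.
  have c2 : tgt 0 (a : C m.+1) = src 0 (idc m.+1 (src 1 b : C 1)).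
    apply: (@em_comp n C HC m.+1 HK) => //.
    by rewrite ev em_top; bd.
  set R : C m.+1 := sg (e (compo 0 _ g)).
  have eR : e R = sg (to 1 a *_0 e g) by rewrite em_top /R em_co ?eu.
  have sR : sim m (e R) (to 1 a *_0 e g).
    split=> //; rewrite eR (st_s Hs) // -eu -em_co //.
  have c3 : tgt 1 (compo 0 (a : C m.+1) (idc m.+1 (src 1 b : C 1))) = src 1 R.
    apply: (@em_comp n C HC m.+1 HK _ _ _ _ m3); rewrite em_co //.
    by rewrite ev em_top; bd.
  by rewrite em_co // em_co // ev em_top eR.
Qed.

End Lower.

Lemma invertP (n : edim) (C : globcat) (HC : is_n1cat n C) k (k0 : 0 < k) (a : C k.+1) :
  leD k.+1 n -> is_inverse a (invert a).
Proof. by move=> kn; apply: epsilon_spec; apply: (proj2 HC). Qed.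

Lemma em_invert (n : edim) (C : globcat) (HC : is_n1cat n C) (K : nat) (HK : leD K n)
    k (a : C k.+1) :
  0 < k < K -> em HC HK (invert a) = invo k (em HC HK a).
Proof.
move=> kK; have k0 : 0 < k by lia.
have [ga gb gc gd] := invertP HC k0 a ltac:(arD).
rewrite /= in ga gb gc gd.
symmetry; apply: invo_eq => //.
have kk : k < k.+1 <= K by lia.
have kk' : k.+1 <= k.+1 <= K by lia.
split; rewrite ?em_so ?em_to ?ga ?gb // -em_co ?ga ?gb // ?gc ?gd em_idc //; lia.
Qed.

(** * Raising a strategy by one dimension *)

Section NextLevel.

Variables (n : edim) (C : globcat) (HC : is_n1cat n C) (k : nat).
Hypotheses (k0 : 0 < k) (HK : leD k.+2 n).
Variables (G : Type) (inc : G -> C k.+1).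
Hypothesis gen : generates inc.
Hypothesis fillers : forall j, 1 < j <= k.+1 -> forall f g : C j,
  parallel f g -> exists F : C j.+1, src j F = f /\ tgt j F = g.
Variables (sigma1 : C 1 -> C 2) (sigma : C k -> C k.+1).
Hypotheses (g1 : good sigma1) (gk : good sigma).
Local Notation A := (amb HC HK).
Local Notation e := (@em n C HC k.+2 HK _).
Hypothesis k1 : k = 1 -> @lift n C HC k.+2 HK _ sigma = @lift n C HC k.+2 HK _ sigma1.

Lemma next_level : exists sigma' : C k.+1 -> C k.+2,
  good sigma' /\ forall f, tgt k.+1 (sigma' f) =
    compo k (sigma (src k f)) (invert (sigma (tgt k f))).
Proof.
have Cn := proj1 HC; have oA : od A = k.+2 by [].
have S1 : strat 1 (@lift n C HC k.+2 HK _ sigma1) by apply: good_strat => //; lia.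
have Sk : strat k (@lift n C HC k.+2 HK _ sigma) by apply: good_strat => //; lia.
have kK : k.+1 < od A by [].
have HH := strat_hats k0 kK S1 Sk k1.
set h := hatA k _ in HH.
have mK : 1 < k.+1 < od A by rewrite /=; lia.
have par j (f g : C j) : 0 < j <= k.+1 -> src j.-1 f = src j.-1 g ->
    tgt j.-1 f = tgt j.-1 g -> parallel f g.
  move=> jk e1 e2 i ij; have jn : leD j n by arD.
  have [ei|ni] := eqVneq i j.-1; first by rewrite ei.
  rewrite -(src_src Cn (i := i) (j := j.-1)) //; try lia.
  rewrite -(src_src Cn (i := i) (j := j.-1) g) //; try lia.
  rewrite -(tgt_tgt Cn (i := i) (j := j.-1)) //; try lia.
  rewrite -(tgt_tgt Cn (i := i) (j := j.-1) g) //; try lia.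
  by rewrite e1 e2.
have fillA j (x y : A) : 1 < j <= k.+1 -> dim j x -> dim j y ->
    so j.-1 x = so j.-1 y -> to j.-1 x = to j.-1 y ->
    exists z : A, so j z = x /\ to j z = y.
  move=> jk dx dy; have jK : j < k.+2 by lia.
  rewrite -(em_src jK dx) -(em_src jK dy).
  rewrite !em_so ?em_to; try lia.
  move=> /em_inj e1 /em_inj e2.
  have [|F [Fs Ft]] := fillers jk (f := src j x) (g := src j y).
    by apply: par; [lia | apply: e1; lia | apply: e2; lia].
  exists (e F); rewrite em_so ?em_to ?Fs ?Ft //; lia.
have fill2 (x : A) : 2 < k.+1 -> dim 2 x -> so 1 x = to 1 x ->
    exists y : A, so 2 y = x /\ to 2 y = so 1 x.
  move=> k2 dx ex; have d1 : dim 1 (so 1 x) by apply: dim_so; rewrite /=; lia.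
  have d2 : dim 2 (so 1 x) by apply: dimW d1 _; rewrite /=; lia.
  apply: (@fillA 2) => //; rewrite [2.-1]/= -?ex; bd.
have fillm (x y : A) : dim k.+1 x -> dim k.+1 y -> so k x = so k y -> to k x = to k y ->
    exists z : A, so k.+1 z = x /\ to k.+1 z = y.
  by move=> dx dy e1 e2; apply: fillA => //; lia.
have [T [T1 T2 T3 T4]] := fam_section k0 gen HH fill2 fillm.
have mk : k.+1 < k.+2 by [].
(* [so 0 x] is the identity 1-cell on the 0-source of [x], so this is the value of the family at $w
   = 1$. *)
pose tau (x : A) : A := T (src k.+1 x) (so 0 x).
have tauE (f : C k.+1) : tau (e f) = T f (so 0 (e f)) by rewrite /tau src_em.
have lf (f : C k.+1) : left_of (e f) (so 0 (e f)).
  by split; [apply: dimW (dim_so _ _) _; rewrite /=; lia | bd].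
have d0 (x : A) : dim 1 (so 0 x) by apply: dimW (dim_so _ _) _; rewrite /=; lia.
have tau_s x : dim k.+1 x -> so k.+1 (tau x) = x.
  move=> dx; have [] := T1 (src k.+1 x) (so 0 x); rewrite ?em_src //; try bd.
  by move=> -> _ _; rewrite co_sl.
have tau_t x : dim k.+1 x -> to k.+1 (tau x) = h x.
  move=> dx; have [] := T1 (src k.+1 x) (so 0 x); rewrite ?em_src //; try bd.
  by move=> _ -> _; rewrite co_sl.
have tau_id x : dim k x -> tau x = x.
  move=> dx; have kk : k < k.+2 by lia.
  rewrite -(em_src kk dx); move: (src k x : C k) => a.
  have ea : e (idc k.+1 a) = e a by rewrite em_idc //; lia.
  rewrite -{1}ea tauE T2 ea; last by rewrite -ea; apply: lf.
  by rewrite co_sl.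
have tau_co i x y : 0 < i < k.+1 -> dim k.+1 x -> dim k.+1 y ->
    to i x = so i y -> tau (x *_i y) = tau x *_i tau y.
  move=> ik dx dy; rewrite -(em_src mk dx) -(em_src mk dy).
  move: (src k.+1 x : C k.+1) (src k.+1 y : C k.+1) => f g ec.
  have ik' : i < k.+1 <= k.+2 by lia.
  have ec' := em_comp ik' ec.
  rewrite -em_co // !tauE em_co //.
  have -> : so 0 (e f *_i e g) = so 0 (e f) by bd.
  rewrite T3 //; congr (_ *_i T g _); apply: comp_s0 ec; rewrite /=; lia.
have tau_co0 x y : dim k.+1 x -> dim k.+1 y -> to 0 x = so 0 y ->
    tau (x *_0 y) = (tau x *_0 so 1 y) *_1 tau (to 1 x *_0 y).
  move=> dx dy; rewrite -(em_src mk dx) -(em_src mk dy).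
  move: (src k.+1 x : C k.+1) (src k.+1 y : C k.+1) => f g ec {dx dy x y}.
  have k2 : 0 < k.+1 <= k.+2 by lia.
  have ec' := em_comp k2 ec.
  (* The section gives the left rule with [T g (to 1 (e f'))] as second factor. Taking for [f'] the
     identity on the 1-target of [f], where [tau] is trivial, identifies that factor with
     [tau (to 1 (e f) *_0 e g)]. *)
  have key (f' : C k.+1) : tgt 0 f' = src 0 g ->
      tau (e f' *_0 e g) = (tau (e f') *_0 so 1 (e g)) *_1 T g (to 1 (e f')).
    move=> ec1; have ec2 := comp_em HC HK k2 ec1.
    rewrite -em_co // !tauE em_co //.
    have -> : so 0 (e f' *_0 e g) = so 0 (e f') by bd.
    rewrite T4 //; congr (_ *_1 T g _).
    have -> : so 0 (e f') = so 0 (to 1 (e f')) by bd.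
    by rewrite co_sl.
  rewrite key //; congr (_ *_1 _).
  have eu : to 1 (e f) = e (idc k.+1 (tgt 1 f : C 1)).
    by rewrite em_idc ?em_to //; lia.
  have du : dim 1 (to 1 (e f)) by apply: dim_to; rewrite /=; lia.
  have dg : dim k.+1 (e g) by apply: em_dim.
  rewrite [in RHS]eu key; last by apply: (@em_comp n C HC k.+2 HK _ _ _ _ k2); rewrite -eu; bd.
  rewrite -eu tau_id; last by apply: dimW du _; rewrite /=; lia.
  have -> : to 1 (to 1 (e f)) = to 1 (e f) by bd.
  have gs : so 1 (T g (to 1 (e f))) = to 1 (e f) *_0 so 1 (e g).
    have lg : to 0 (to 1 (e f)) = so 0 (e g) by bd.
    have st := fam_sim mK (T1 g) du lg; bd.
  by rewrite -gs co_sl.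
pose cor := corr k.+1 h tau.
have CS : strat k.+1 cor.
  exact: (corr_strat mK _ HH tau_s tau_t tau_id tau_co tau_co0).
exists (fun f => cor (e f)); split; first exact: strat_good.
move=> f; apply: (@em_inj n C HC k.+2 HK) => //.
have df : dim k.+1 (e f) by apply: em_dim.
have -> : e (tgt k.+1 (cor (e f) : C k.+2)) = to k.+1 (cor (e f)) by [].
rewrite (corr_t mK oA HH tau_s tau_t) // /h /hatA.
have kk : k < k.+1 <= k.+2 by lia.
have kk2 : k < k.+2 by lia.
have kk3 : 0 < k < k.+2 by lia.
have kn : leD k.+1 n by arD.
have [si _] := invertP HC k0 (sigma (tgt k f)) kn.
rewrite em_so // em_to // !liftE // -em_invert // -em_co //.
by rewrite si (gd_cell gk).
Qed.

End NextLevel.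

(** * Dimension 1 *)

Section Fam1.

Variables (A : ocat) (h : A -> A).
Local Notation K := (od A).
Implicit Types f g x y w : A.
Hypotheses (K1 : 1 < K) (h_dim1 : forall x, dim 1 x -> dim 1 (h x)).
Hypothesis h_inv : forall F, h (so 1 F) = h (to 1 F).
Hypothesis h_cell : forall x, dim 1 x -> exists F, so 1 F = x /\ to 1 F = h x.

Lemma h1_s x : dim 1 x -> so 0 (h x) = so 0 x.
Proof. by move=> dx; have [F [<- <-]] := h_cell dx; bd. Qed.

Lemma h1_t x : dim 1 x -> to 0 (h x) = to 0 x.
Proof. by move=> dx; have [F [<- <-]] := h_cell dx; bd. Qed.

Lemma h1_h x : dim 1 x -> h (h x) = h x.
Proof. by move=> dx; have [F [eF tF]] := h_cell dx; rewrite -{1}tF -h_inv eF. Qed.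

Lemma h1_co x y : dim 1 x -> dim 1 y -> to 0 x = so 0 y ->
  h (h x *_0 y) = h (x *_0 y).
Proof.
move=> dx dy e; have [F [sF tF]] := h_cell dx.
have c : to 0 F = so 0 y by rewrite -e -sF; bd.
have := h_inv (F *_0 y).
have -> : so 1 (F *_0 y) = x *_0 y by bd.
by have -> : to 1 (F *_0 y) = h x *_0 y by bd.
Qed.

(* [T w : \hat{w} f -> \hat{w f}], for every 1-cell [w]. *)
Definition fam1 f (T : A -> A) : Prop := forall w,
  (left_of f w -> [/\ so 1 (T w) = h w *_0 f, to 1 (T w) = h (w *_0 f) & T (h w) = T w])
  /\ (~ left_of f w -> T w = f).

Definition fone1 a w := sel (left_of a w) (h w) a.

Definition fop1 (f : A) (T : A -> A) g (U : A -> A) w :=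
  sel (left_of f w) ((T w *_0 g) *_1 U (w *_0 f)) (f *_0 g).

Lemma fam1_eq f T U : fam1 f T -> fam1 f U ->
  (forall w, left_of f w -> T w = U w) -> T = U.
Proof.
move=> hT hU e; apply: functional_extensionality => w.
by case: (classic (left_of f w)) => hw; [exact: e | rewrite (hT w).2 // (hU w).2].
Qed.

Lemma left_h f w : left_of f w -> left_of f (h w).
Proof. by move=> [dw e]; split; [exact: h_dim1 | rewrite h1_t]. Qed.

Lemma left_co f g w : to 0 f = so 0 g -> left_of (f *_0 g) w = left_of f w.
Proof.
have K0 : 0 < K by lia.
by move=> e; apply: left_of_so; rewrite sc_eq.
Qed.

Lemma left_next1 f g w : dim 1 f -> to 0 f = so 0 g -> left_of f w -> left_of g (w *_0 f).
Proof. by move=> df e [dw ew]; split; [apply: dim_co | bd]. Qed.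

Lemma fam1_one a : dim 0 a -> fam1 a (fone1 a).
Proof.
have K0 : 0 < K by lia.
move=> da w; split=> [hw|nw]; last by rewrite /fone1 selF.
have [dw ew] := hw; have e0 : so 0 a = a by bd.
have t0 : to 0 w = a by rewrite ew.
rewrite /fone1 selT // selT; last exact: left_h.
have dh := h_dim1 dw; have th := h1_t dw.
have -> : h w *_0 a = h w by rewrite -t0 -th co_tr.
have -> : w *_0 a = w by rewrite -t0 co_tr.
by rewrite h1_h //; split=> //; bd.
Qed.

(** The composite depends on [w] only through [h w] because [U] is evaluated at [h w *_0 f] and at
    [w *_0 f], which have the same normal form by [h1_co]. *)
Lemma fam1_op f g T U : dim 1 f -> dim 1 g -> to 0 f = so 0 g ->
  fam1 f T -> fam1 g U -> fam1 (f *_0 g) (fop1 f T g U).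
Proof.
move=> df dg e FT FU w; split; rewrite (left_co _ e) => hw; last by rewrite /fop1 selF.
have hwg := left_next1 df e hw.
have [a1 a2 a3] := (FT w).1 hw; have [b1 b2 b3] := (FU _).1 hwg.
have hw' := left_h hw; have hwg' := left_next1 df e hw'.
have [c1 c2 c3] := (FU _).1 hwg'.
have [dw ew] := hw; have dh := h_dim1 dw; have th := h1_t dw; have sh := h1_s dw.
have st : sim 1 (T w) (h w *_0 f) by split.
have dwf : dim 1 (w *_0 f) by apply: dim_co.
have dhwf := h_dim1 dwf; have thwf := h1_t dwf.
have st0 : to 0 (h w) = so 0 f by congruence.
have t0 : to 0 (T w) = so 0 g by bd.
have su : sim 1 (U (w *_0 f)) (h (w *_0 f) *_0 g) by split.
have K0 : 0 < K by lia.
have cT : to 1 (T w *_0 g) = so 1 (U (w *_0 f)) by rewrite b1; bd.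
rewrite /fop1 selT // selT //; split.
- by rewrite sc_eq //; bds; rewrite ?coA //; bd.
- by rewrite tc_eq // b2 coA.
- by rewrite a3 -c3 h1_co // b3.
Qed.

Lemma fop1_left f T g U w : left_of f w ->
  fop1 f T g U w = (T w *_0 g) *_1 U (w *_0 f).
Proof. by move=> hw; rewrite /fop1 selT. Qed.

Lemma fop1_assoc f g x T U V : dim 1 f -> dim 1 g -> dim 1 x ->
  to 0 f = so 0 g -> to 0 g = so 0 x -> fam1 f T -> fam1 g U -> fam1 x V ->
  fop1 (f *_0 g) (fop1 f T g U) x V = fop1 f T (g *_0 x) (fop1 g U x V).
Proof.
move=> df dg dx e1 e2 FT FU FV; have K0 : 0 < K by lia.
have e12 : to 0 (f *_0 g) = so 0 x by bd.
have e21 : to 0 f = so 0 (g *_0 x) by bd.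
have dfg : dim 1 (f *_0 g) by apply: dim_co.
have dgx : dim 1 (g *_0 x) by apply: dim_co.
apply: (@fam1_eq (f *_0 g *_0 x)).
- by apply: fam1_op => //; apply: fam1_op.
- by rewrite coA //; apply: fam1_op => //; apply: fam1_op.
move=> w; rewrite left_co // left_co // => hw.
have hwg := left_next1 df e1 hw; have hwx := left_next1 dg e2 hwg.
rewrite !fop1_left //; last by rewrite left_co.
have [a1 a2 a3] := (FT w).1 hw; have [b1 b2 b3] := (FU _).1 hwg.
have [c1 c2 c3] := (FV _).1 hwx.
have [dw ew] := hw; have dh := h_dim1 dw; have th := h1_t dw; have sh := h1_s dw.
have [dwg ewg] := hwg; have [dwx ewx] := hwx.
have dhg := h_dim1 dwg; have thg := h1_t dwg.
have dhx := h_dim1 dwx; have thx := h1_t dwx.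
have st : sim 1 (T w) (h w *_0 f) by split.
have su : sim 1 (U (w *_0 f)) (h (w *_0 f) *_0 g) by split.
have sv : sim 1 (V (w *_0 f *_0 g)) (h (w *_0 f *_0 g) *_0 x) by split.
have st0 : to 0 (h w) = so 0 f by congruence.
have su0 : to 0 (h (w *_0 f)) = so 0 g by congruence.
rewrite -[w *_0 (f *_0 g)]coA //.
rewrite -[T w *_0 (_ *_0 _)]coA //; [|bd].
rewrite wr_co; [|sc..].
by rewrite coA; sc.
Qed.

Lemma fop1_idl f T : dim 1 f -> fam1 f T -> fop1 (so 0 f) (fone1 (so 0 f)) f T = T.
Proof.
move=> df FT; have K0 : 0 < K by lia.
have d0 : dim 0 (so 0 f) by apply: dim_so.
have d1 : dim 1 (so 0 f) by apply: dimW d0 _.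
have e0 : to 0 (so 0 f) = so 0 f by bd.
have h1 : so 0 f *_0 f = f by rewrite co_sl.
apply: (@fam1_eq f) => //; first by rewrite -{1}h1; apply: fam1_op => //; apply: fam1_one.
move=> w hw; have es : so 0 (so 0 f) = so 0 f by bd.
have hw' : left_of (so 0 f) w by rewrite (left_of_so _ es).
have [dw ew] := hw; have [a1 a2 a3] := (FT w).1 hw.
rewrite fop1_left // /fone1 selT //.
by rewrite -ew co_tr // -a1 co_sl.
Qed.

Lemma fop1_idr f T : dim 1 f -> fam1 f T -> fop1 f T (to 0 f) (fone1 (to 0 f)) = T.
Proof.
move=> df FT; have K0 : 0 < K by lia.
have d0 : dim 0 (to 0 f) by apply: dim_to.
have d1 : dim 1 (to 0 f) by apply: dimW d0 _.
have e0 : to 0 f = so 0 (to 0 f) by bd.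
have h1 : f *_0 to 0 f = f by rewrite co_tr.
apply: (@fam1_eq f) => //; first by rewrite -{1}h1; apply: fam1_op => //; apply: fam1_one.
move=> w hw; have hw' := left_next1 df e0 hw.
have [dw ew] := hw; have [a1 a2 a3] := (FT w).1 hw.
have dh := h_dim1 dw; have th := h1_t dw.
have st : sim 1 (T w) (h w *_0 f) by split.
have st0 : to 0 (h w) = so 0 f by congruence.
rewrite fop1_left // /fone1 selT //.
have {1}-> : to 0 f = to 0 (T w) by bd.
by rewrite co_tr // -a2 co_tr.
Qed.

Lemma fam1_ex f : dim 1 f -> exists T, fam1 f T.
Proof.
move=> df; have K0 : 0 < K by lia.
have ex w : exists z, left_of f w -> so 1 z = h w *_0 f /\ to 1 z = h (h w *_0 f).
  case: (classic (left_of f w)) => hw; last by exists f.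
  have [dh eh] := left_h hw.
  have [|F] := h_cell (x := h w *_0 f); first by apply: dim_co.
  by exists F.
have [th thP] : exists th : A -> A, forall w, left_of f w ->
    so 1 (th w) = h w *_0 f /\ to 1 (th w) = h (h w *_0 f).
  exists (fun w => proj1_sig (constructive_indefinite_description _ (ex w))) => w.
  by case: constructive_indefinite_description.
exists (fun w => sel (left_of f w) (th (h w)) f) => w; split=> [hw|nw]; last by rewrite selF.
have hw' := left_h hw; rewrite !selT //.
have [dw ew] := hw.
by have [t1 t2] := thP _ hw'; rewrite t1 t2 h1_h // h1_co.
Qed.

End Fam1.

Section LevelOne.

Variables (n : edim) (C : globcat) (HC : is_n1cat n C) (HK : leD 2 n).
Variables (G : Type) (inc : G -> C 1).
Hypothesis gen : generates inc.
Variable h1 : C 1 -> C 1.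
Hypothesis h1_inv : forall F : C 2, h1 (src 1 F) = h1 (tgt 1 F).
Hypothesis h1_cell : forall u : C 1, exists F : C 2, src 1 F = u /\ tgt 1 F = h1 u.
Hypothesis h1_id : forall x : C 0, h1 (idc 1 x) = idc 1 x.
Local Notation A := (amb HC HK).
Local Notation e := (@em n C HC 2 HK _).

Let hA (x : A) : A := e (h1 (src 1 x)).

Let hAE (f : C 1) : hA (e f) = e (h1 f).
Proof. by rewrite /hA src_em. Qed.

Let hA_dim (x : A) : dim 1 x -> dim 1 (hA x).
Proof. by move=> _; apply: em_dim. Qed.

Let hA_inv (F : A) : hA (so 1 F) = hA (to 1 F).
Proof. by rewrite -(em_top F) em_so ?em_to // !hAE h1_inv. Qed.

Let hA_cell (x : A) : dim 1 x -> exists F : A, so 1 F = x /\ to 1 F = hA x.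
Proof.
move=> dx; have K1 : 1 < 2 by []; rewrite -(em_src K1 dx).
have [F [sF tF]] := h1_cell (src 1 x).
by exists (e F); rewrite em_so ?em_to // sF tF hAE.
Qed.

Let hA_unit (x : A) : dim 0 x -> hA x = x.
Proof.
move=> dx; have K0 : 0 < 2 by []; rewrite -(em_src K0 dx).
by rewrite -(em_idc HC HK (j := 1)) // hAE h1_id.
Qed.

Definition fok1 (q : C 1 * (A -> A)) : Prop := fam1 hA (e q.1) q.2.
Definition fcell1 : Type := {q | fok1 q}.
Definition fc1 (x : fcell1) : C 1 := (sval x).1.
Definition ff1 (x : fcell1) : A -> A := (sval x).2.

Lemma ff1_N (x : fcell1) : fam1 hA (e (fc1 x)) (ff1 x).
Proof. exact: (proj2_sig x). Qed.

Lemma fcell1_eq (x y : fcell1) : fc1 x = fc1 y -> ff1 x = ff1 y -> x = y.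
Proof.
case: x y => [[f T] p] [[g U] q]; rewrite /fc1 /ff1 /= => ef eT.
by subst; rewrite (proof_irrelevance _ p q).
Qed.

Lemma unit1_proof (a : C 0) : fok1 (idc 1 a, fone1 hA (e a)).
Proof. by rewrite /fok1 /= em_idc //; apply: fam1_one => //; apply: em_dim. Qed.

Definition unit1 (a : C 0) : fcell1 := exist fok1 _ (unit1_proof a).

Definition comp1 (x y : fcell1) : fcell1 :=
  match excluded_middle_informative
    (fok1 (compo 0 (fc1 x) (fc1 y), fop1 (e (fc1 x)) (ff1 x) (e (fc1 y)) (ff1 y))) with
  | left p => exist fok1 _ p
  | right _ => x
  end.

Lemma comp1E x y : tgt 0 (fc1 x) = src 0 (fc1 y) ->
  sval (comp1 x y) =
  (compo 0 (fc1 x) (fc1 y), fop1 (e (fc1 x)) (ff1 x) (e (fc1 y)) (ff1 y)).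
Proof.
move=> ec; rewrite /comp1; case: excluded_middle_informative => // -[]; rewrite /fok1 /=.
rewrite em_co //; apply: fam1_op => //; try exact: em_dim; try exact: ff1_N.
exact: comp_em.
Qed.

Lemma fc1E x y : tgt 0 (fc1 x) = src 0 (fc1 y) ->
  fc1 (comp1 x y) = compo 0 (fc1 x) (fc1 y).
Proof. by move=> ec; rewrite {1}/fc1 comp1E. Qed.

Lemma ff1E x y : tgt 0 (fc1 x) = src 0 (fc1 y) ->
  ff1 (comp1 x y) = fop1 (e (fc1 x)) (ff1 x) (e (fc1 y)) (ff1 y).
Proof. by move=> ec; rewrite {1}/ff1 comp1E. Qed.

(** Over 1-cells the only composition is the one along 0, so exchange holds vacuously and no
    analogue of [fam_slide] arises. *)
Lemma displayed1 : displayed fc1 unit1 (fun _ => comp1).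
Proof.
have Cn := proj1 HC; have n1 : leD 1 n by arD.
have ce (x y : fcell1) : tgt 0 (fc1 x) = src 0 (fc1 y) ->
    to 0 (e (fc1 x)) = so 0 (e (fc1 y)) by apply: comp_em.
have de (x : fcell1) : dim 1 (e (fc1 x)) by apply: em_dim.
split=> //.
- by move=> [|i] //= x y _; apply: fc1E.
- move=> [|i] //= x y z _ e1 e2.
  have e5 : tgt 0 (compo 0 (fc1 x) (fc1 y)) = src 0 (fc1 z) by rewrite (tgt_comp Cn).
  have e6 : tgt 0 (fc1 x) = src 0 (compo 0 (fc1 y) (fc1 z)) by rewrite (src_comp Cn).
  have e3 : tgt 0 (fc1 (comp1 x y)) = src 0 (fc1 z) by rewrite fc1E.
  have e4 : tgt 0 (fc1 x) = src 0 (fc1 (comp1 y z)) by rewrite fc1E.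
  apply: fcell1_eq; first by rewrite !fc1E // (comp_assoc Cn).
  rewrite !ff1E // !fc1E // !em_co //.
  by apply: fop1_assoc; first [done | exact: hA_dim | exact: ce | exact: de | exact: ff1_N].
- move=> [|i] //= x _.
  have e1 : tgt 0 (fc1 (unit1 (idc 0 (src 0 (fc1 x))))) = src 0 (fc1 x).
    rewrite /fc1 /= (idc_idc Cn) // (tgt_idc Cn) ?(idc_refl Cn) //; exact: (leD_trans (j := 1)).
  apply: fcell1_eq; first by rewrite fc1E // /fc1 /= (idc_idc Cn) ?(comp_idl Cn).
  rewrite ff1E // {1}/fc1 /= em_idc // {1}/ff1 /= em_idc // -em_so //.
  by apply: (@fop1_idl A hA); first [done | exact: hA_dim | exact: de | exact: ff1_N].
- move=> [|i] //= x _.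
  have e1 : tgt 0 (fc1 x) = src 0 (fc1 (unit1 (idc 0 (tgt 0 (fc1 x))))).
    rewrite /fc1 /= (idc_idc Cn) // (src_idc Cn) ?(idc_refl Cn) //; exact: (leD_trans (j := 1)).
  apply: fcell1_eq; first by rewrite fc1E // /fc1 /= (idc_idc Cn) ?(comp_idr Cn).
  rewrite ff1E // [fc1 (unit1 _)]/fc1 /= em_idc // [ff1 (unit1 _)]/ff1 /= em_idc // -em_to //.
  by apply: (@fop1_idr A hA); first [done | exact: hA_dim | exact: de | exact: ff1_N].
- by move=> i j x x' y y' ij; lia.
Qed.

Lemma level_one : exists sigma : C 1 -> C 2,
  good sigma /\ forall u, tgt 1 (sigma u) = h1 u.
Proof.
have oA : od A = 2 by [].
have [|r [r1 r2 r3]] := gen displayed1.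
  move=> x; have dx : dim 1 (e (inc x)) by apply: em_dim.
  have [T FT] := @fam1_ex A hA isT hA_dim hA_inv hA_cell _ dx.
  by exists (exist fok1 (inc x, _) FT).
pose tau (f : C 1) : A := ff1 (r f) (so 0 (e f)).
have N f : fam1 hA (e f) (ff1 (r f)) by have := ff1_N (r f); rewrite r1.
have lf (f : C 1) : left_of (e f) (so 0 (e f)).
  by split; [apply: dimW (dim_so _ _) _ | bd].
have h0 (x : A) : hA (so 0 x) = so 0 x by apply: hA_unit; apply: dim_so.
have df (f : C 1) : dim 1 (e f) by apply: em_dim.
have tau_s f : so 1 (tau f) = e f.
  by have [[//|-> _ _] _] := N f (so 0 (e f)); rewrite h0 co_sl.
have tau_t f : to 1 (tau f) = e (h1 f).
  by have [[//|_ -> _] _] := N f (so 0 (e f)); rewrite co_sl // hAE.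
have hh f : h1 (h1 f) = h1 f.
  apply: (@em_inj n C HC 2 HK) => //; rewrite -!hAE.
  exact: (h1_h hA_inv hA_cell).
(* The same correction as in higher dimensions, with [h1] in the role of the normal form. *)
pose sg (x : A) : A := tau (src 1 x) *_1 invo 1 (tau (h1 (src 1 x))).
have sgE f : sg (e f) = tau f *_1 invo 1 (tau (h1 f)) by rewrite /sg src_em.
have sg_c f : to 1 (tau f) = so 1 (invo 1 (tau (h1 f))).
  by rewrite s_invo // !tau_t hh.
have sg_s (f : C 1) : so 1 (sg (e f)) = e f by rewrite sgE sc_eq ?tau_s.
have sg_t (f : C 1) : to 1 (sg (e f)) = e (h1 f) by rewrite sgE tc_eq // t_invo // tau_s.
have ex (x : A) : dim 1 x -> exists f : C 1, x = e f.
  by move=> dx; exists (src 1 x); rewrite em_src.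
have S : strat 1 sg.
  split.
  - by move=> x dx; have [f ->] := ex x dx.
  - by rewrite oA.
  - move=> F _; rewrite -(em_top F) em_so // em_to // !sg_t; congr e.
    exact: h1_inv.
  - by move=> x /ex[f ->]; rewrite sg_t sgE hh co_xV // tau_s.
  - by move=> i x y; lia.
  - move=> x y /ex[f ->] /ex[g ->] ec.
    have c01 : 0 < 1 <= 2 by [].
    have ec' := @em_comp n C HC 2 HK _ _ _ _ c01 ec.
    have dhf := df (h1 f).
    have th : to 0 (e (h1 f)) = so 0 (e g) by rewrite -hAE (@h1_t A hA isT hA_cell).
    have ech := @em_comp n C HC 2 HK _ _ _ _ c01 th.
    rewrite sg_s sg_t -!em_co // !sgE.
    have key (f' : C 1) : tgt 0 f' = src 0 g ->
        tau (compo 0 f' g) = (tau f' *_0 e g) *_1 ff1 (r g) (e f').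
      move=> c; have c' := comp_em HC HK c01 c.
      rewrite /tau (r3 0) // ff1E ?r1 // em_co //.
      have -> : so 0 (e f' *_0 e g) = so 0 (e f') by bd.
      by rewrite fop1_left // co_sl.
    rewrite key // key //.
    have lg : left_of (e g) (e f) by [].
    have [[//|a1 a2 a3] _] := N g (e f).
    (* By [hc] and [a3], the second factors in [key] for [f] and for [h1 f] agree, and so do their
       corrections; what remains of [tau (h1 f)] cancels against the correction of [sg (e f)]. *)
    have hc : h1 (compo 0 (h1 f) g) = h1 (compo 0 f g).
      apply: (@em_inj n C HC 2 HK) => //; rewrite -!hAE !em_co // -hAE.
      by apply: (@h1_co A hA isT hA_inv hA_cell).
    rewrite hc -(hAE f) a3.
    have sf : sim 1 (tau f) (e f) by split.
    have sf' : sim 1 (tau (h1 f)) (e (h1 f)) by split.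
    have tf := tau_t f; have tf' := tau_t (h1 f); rewrite hh in tf'.
    have dg := df g; have df1 := df f.
    rewrite hAE in a1.
    have cc : to 1 (ff1 (r g) (e f)) = so 1 (invo 1 (tau (h1 (compo 0 f g)))).
      by rewrite s_invo // tau_t hh a2 -em_co // hAE.
    rewrite wr_co; [|sc..].
    rewrite [LHS]coA; [|sc..].
    rewrite [RHS]coA; [|sc..].
    congr (_ *_1 _).
    rewrite -[RHS]coA; [|sc..].
    rewrite -[_ *_1 (tau (h1 f) *_0 e g *_1 _)]coA; [|sc..].
    rewrite -wr_co; [|sc..].
    rewrite co_Vx // tf' -em_co //.
    have -> : e (compo 0 (h1 f) g) = so 1 (ff1 (r g) (e f)) by rewrite a1 em_co.
    by rewrite co_sl.
exists (fun f => sg (e f)); split; first exact: strat_good.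
move=> u; apply: (@em_inj n C HC 2 HK) => //.
by rewrite -sg_t.
Qed.

End LevelOne.

(** * Assembling all dimensions *)

Lemma ltD_leD k n : ltD k n = leD k.+1 n.
Proof. by case: n. Qed.

Lemma dependent_choice (A : nat -> Type) (Good : forall m, A m -> Prop)
    (R : forall m, A m -> A m.+1 -> Prop) (a0 : A 0) :
  Good 0 a0 -> (forall m a, Good m a -> exists b, Good m.+1 b /\ R m a b) ->
  exists s : forall m, A m, s 0 = a0 /\ forall m, Good m (s m) /\ R m (s m) (s m.+1).
Proof.
move=> g0 step.
pose nxt m (a : {a : A m | Good m a}) :=
  constructive_indefinite_description _ (step m (sval a) (proj2_sig a)).
pose s m : {a : A m | Good m a} := nat_rect (fun m => {a : A m | Good m a})
  (exist _ a0 g0) (fun m a => exist _ (sval (nxt m a)) (proj1 (proj2_sig (nxt m a)))) m.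
exists (fun m => sval (s m)); split=> // m; split; first exact: (proj2_sig (s m)).
exact: (proj2 (proj2_sig (nxt m (s m)))).
Qed.

(* The hypotheses and the conclusion, apart from the left rule in [good], are
   invariant under [op]. *)
Lemma left_strategy_exists (n : edim) (C : globcat) (h1 : C 1 -> C 1) :
  is_n1cat n C -> leD 2 n ->
  (forall k, ltD k n -> exists (G : Type) (inc : G -> C k.+1), generates inc) ->
  (forall j, 1 < j -> ltD j n -> forall f g : C j, parallel f g ->
    exists F : C j.+1, src j F = f /\ tgt j F = g) ->
  (forall F : C 2, h1 (src 1 F) = h1 (tgt 1 F)) ->
  (forall u : C 1, exists F : C 2, src 1 F = u /\ tgt 1 F = h1 u) ->
  (forall x : C 0, h1 (idc 1 x) = idc 1 x) ->
  exists sigma : forall k, C k -> C k.+1,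
    [/\ forall k, 0 < k -> ltD k n -> good (sigma k),
        forall u, tgt 1 (sigma 1 u) = h1 u &
        forall k, 0 < k -> ltD k.+1 n -> forall f : C k.+1,
          tgt k.+1 (sigma k.+1 f) =
          compo k (sigma k (src k f)) (invert (sigma k (tgt k f)))].
Proof.
move=> HC n2 gen fill hinv hcell hid.
have [G0 [inc0 gen0]] : exists (G : Type) (inc : G -> C 1), generates inc.
  by apply: gen; rewrite ltD_leD; arD.
have [sigma1 [gs1 ts1]] := level_one HC n2 gen0 hinv hcell hid.
(* Level [m] is dimension [m.+1]. At level 0 the predicate demands equality with [sigma1], not mere
   goodness, because [next_level] asks that its two strategies coincide when [k = 1]. *)
pose Good m : (C m.+1 -> C m.+2) -> Prop :=
  match m return (C m.+1 -> C m.+2) -> Prop with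
  | 0 => fun a => a = sigma1
  | m'.+1 => fun a => ltD m'.+2 n -> good a
  end.
pose R m (a : C m.+1 -> C m.+2) (b : C m.+2 -> C m.+3) : Prop := ltD m.+2 n ->
  forall f, tgt m.+2 (b f) = compo m.+1 (a (src m.+1 f)) (invert (a (tgt m.+1 f))).
have [|m a Ga|s [s0 sP]] := @dependent_choice (fun m => C m.+1 -> C m.+2) Good R sigma1.
- by [].
(* Beyond [n] nothing is demanded, and the identity is a default value. *)
- case: (boolP (ltD m.+2 n)) => mn; last first.
    exists (fun f => idc m.+3 f); split; last by move=> h; rewrite h in mn.
    by move=> h; rewrite h in mn.
  have [G [inc gi]] : exists (G : Type) (inc : G -> C m.+2), generates inc.
    by apply: gen; move: mn; rewrite !ltD_leD; apply: leD_trans; lia.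
  have HK : leD m.+3 n by rewrite -ltD_leD.
  have fl j : 1 < j <= m.+2 -> forall f g : C j, parallel f g ->
      exists F : C j.+1, src j F = f /\ tgt j F = g.
    move=> jm; apply: fill; first lia.
    by rewrite ltD_leD; apply: leD_trans HK; lia.
  have ga : good a.
    have mn1 : ltD m.+1 n by rewrite ltD_leD; apply: leD_trans HK; lia.
    case: m a Ga mn1 {mn gi inc fl HK G} => [|m] a Ga mn1; first by rewrite Ga.
    exact: Ga.
  have [|b [gb tb]] := @next_level n C HC m.+1 isT HK G inc gi fl sigma1 a gs1 ga.
    by case: m a Ga {mn gi inc fl ga} HK => [|m] a Ga // HK _; rewrite Ga.
  by exists b; split=> [h|h].
exists (fun k => match k return C k -> C k.+1 with 0 => idc 1 | m.+1 => s m end); split.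
- case=> [|[|m]] // _ mn; first by rewrite s0.
  by have [g _] := sP m.+1; apply: g.
- by rewrite s0.
- by case=> [|m] // _ mn f; have [_ r] := sP m; apply: r.
Qed.

(** The closure conditions make the cells satisfying [P] a displayed category, with the subtype
    projection as [p]; a section of it puts every cell in [P]. *)
Lemma generates_ind (n : edim) (C : globcat) (k : nat) (G : Type) (inc : G -> C k.+1)
    (P : C k.+1 -> Prop) :
  is_n1cat n C -> leD k.+1 n -> generates inc ->
  (forall x, P (inc x)) -> (forall a : C k, P (idc k.+1 a)) ->
  (forall i f g, i <= k -> tgt i f = src i g -> P f -> P g -> P (compo i f g)) ->
  (forall f g, 0 < k -> is_inverse f g -> P f -> P g) ->
  forall f, P f.
Proof.
move=> HC kn gen Pinc Pid Pco Pinv; have Cn := proj1 HC.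
pose X := {f : C k.+1 | P f}.
pose m i (x y : X) : X :=
  match excluded_middle_informative (P (compo i (sval x) (sval y))) with
  | left p => exist P _ p
  | right _ => x
  end.
have mE i x y : i <= k -> tgt i (sval x) = src i (sval y) ->
    sval (m i x y) = compo i (sval x) (sval y).
  move=> ik e; rewrite /m; case: excluded_middle_informative => //; case.
  by apply: Pco => //; [exact: (proj2_sig x) | exact: (proj2_sig y)].
have Xeq (x y : X) : sval x = sval y -> x = y.
  case: x y => [f p] [g q] /= e; subst g; by rewrite (proof_irrelevance _ p q).
pose u a : X := exist P _ (Pid a).
have [||r [r1 _ _]] := gen X (fun x => sval x) u m; first last.
- by move=> f; rewrite -(r1 f); exact: (proj2_sig (r f)).
- by move=> x; exists (exist P _ (Pinc x)).
split=> //.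
- move=> i x y z ik e1 e2; apply: Xeq.
  have e5 : tgt i (compo i (sval x) (sval y)) = src i (sval z) by rewrite (tgt_comp Cn).
  have e6 : tgt i (sval x) = src i (compo i (sval y) (sval z)) by rewrite (src_comp Cn).
  by rewrite !mE // ?mE // (comp_assoc Cn).
- move=> i x ik; have ikk : i <= k <= k.+1 by lia.
  have e : idc k.+1 (idc k (src i (sval x))) = idc k.+1 (src i (sval x)).
    by rewrite (idc_idc Cn).
  apply: Xeq; rewrite mE //= e ?(comp_idl Cn) //.
  by rewrite (tgt_idc Cn) ?(idc_refl Cn) //; first [lia|arD].
- move=> i x ik; have ikk : i <= k <= k.+1 by lia.
  have e : idc k.+1 (idc k (tgt i (sval x))) = idc k.+1 (tgt i (sval x)).
    by rewrite (idc_idc Cn).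
  apply: Xeq; rewrite mE //= e ?(comp_idr Cn) //.
  by rewrite (src_idc Cn) ?(idc_refl Cn) //; first [lia|arD].
- move=> i a b ik e; have ikk : i < k <= k.+1 by lia.
  apply: Xeq; rewrite mE /=; [by rewrite (idc_comp Cn) | lia |].
  by rewrite (tgt_idcK HC kn) ?(src_idcK HC kn) //; lia.
- move=> i j x x' y y' ij e1 e2 e3; apply: Xeq.
  have ik : i <= k by lia.
  have jk : j <= k by lia.
  have ij' : i < j < k.+1 by lia.
  have d1 : tgt i (sval y) = src i (sval y').
    rewrite -(tgt_src Cn (sval y) ij') // -e1 -(src_src Cn (sval y') ij') // -e2.
    by rewrite (tgt_tgt Cn) // (src_tgt Cn).
  have d4 : tgt j (compo i (sval x) (sval x')) = src j (compo i (sval y) (sval y')).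
    by rewrite (tgt_comp_lt Cn) // (src_comp_lt Cn) // e1 e2.
  have d5 : tgt i (compo j (sval x) (sval y)) = src i (compo j (sval x') (sval y')).
    rewrite -(tgt_src Cn (compo j (sval x) (sval y)) ij') //.
    rewrite -(src_src Cn (compo j (sval x') (sval y')) ij') // !(src_comp Cn) //; try lia.
    by rewrite (tgt_src Cn) // (src_src Cn).
  by rewrite !mE // ?mE // (exchange Cn).
- move=> k0 x; have [g ig] := HC.2 k.+1 (sval x) k0 kn.
  have [ga gb gc gd] := ig.
  exists (exist P g (Pinv _ _ k0 ig (proj2_sig x))); split=> //; apply: Xeq.
    by rewrite mE.
  by rewrite mE.
Qed.

(** * Polygraphs *)

Section Polygraph.

Variables (n : edim) (S : polygraph n) (s : section S).
Hypothesis n2 : leD 2 n.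

Let HC : is_n1cat n S := top_n1cat S.
Let Sn : is_ncat n S := proj1 HC.

Lemma polygraph_generates k : ltD k n -> generates (@incl n S k).
Proof.
move=> kn; apply: (free_ext_generates HC); first by rewrite -ltD_leD.
exact: top_free.
Qed.

(** Each rule of the congruence is realised by an operation on 2-cells: generator, identity,
    inverse, and the compositions along 1 and 0. *)
Lemma congr_cell u v : Defs.congr1 (gens S 1) u v ->
  exists F : S 2, src 1 F = u /\ tgt 1 F = v.
Proof.
have n1 : ltD 1 n by rewrite ltD_leD.
elim=> {u v}.
- by move=> x; exists (incl x); rewrite (free_src (top_free S n1)) (free_tgt (top_free S n1)).
- by move=> u; exists (idc 2 u); rewrite (src_idc Sn) ?(tgt_idc Sn) ?(idc_refl Sn) //; arD.
- move=> u v _ [F [<- <-]]; have [G [ga gb _ _]] := HC.2 2 F isT n2.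
  by exists G.
- move=> u v w _ [F [Fs Ft]] _ [G [Gs Gt]]; exists (compo 1 F G).
  by rewrite (src_comp Sn) ?(tgt_comp Sn) // Ft Gs.
- move=> u u' v v' e _ [F [Fs Ft]] _ [G [Gs Gt]]; exists (compo 0 F G).
  have e' : tgt 0 F = src 0 G.
    by rewrite -(tgt_src Sn (i := 0) (j := 1)) // -(src_src Sn (i := 0) (j := 1) G) // Fs Gs.
  by rewrite (src_comp_lt Sn) ?(tgt_comp_lt Sn) // Fs Ft Gs Gt.
Qed.

Lemma cell_congr (F : S 2) : Defs.congr1 (gens S 1) (src 1 F) (tgt 1 F).
Proof.
have n1 : ltD 1 n by rewrite ltD_leD.
have nn1 : leD 1 n by arD.
move: F; apply: (generates_ind HC n2 (polygraph_generates n1)).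
- move=> x; rewrite (free_src (top_free S n1)) (free_tgt (top_free S n1)).
  exact: congr1_gen.
- by move=> a; rewrite (src_idc Sn) ?(tgt_idc Sn) //; apply: congr1_refl.
- move=> [|[|i]] // F G _ e PF PG.
    rewrite (src_comp_lt Sn) // (tgt_comp_lt Sn) //; apply: congr1_comp => //.
    by rewrite (tgt_src Sn) // (src_src Sn).
  rewrite (src_comp Sn) // (tgt_comp Sn) //.
  by apply: congr1_trans PF _; rewrite e.
- by move=> F G _ [/= -> -> _ _]; apply: congr1_sym.
Qed.

(** Classes are predicates packed with a proof, so their equality rests on extensionality and proof
    irrelevance. *)
Lemma pclass_eq (u v : S 1) : Defs.congr1 (gens S 1) u v -> pclass u = pclass v.
Proof.
move=> uv; rewrite /pclass.
have e : Defs.congr1 (gens S 1) u = Defs.congr1 (gens S 1) v.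
  apply: functional_extensionality => w; apply: propositional_extensionality; split.
    exact: congr1_trans (congr1_sym uv).
  exact: congr1_trans uv.
move: (ex_intro _ u _) (ex_intro _ v _); rewrite e => p q.
by rewrite (proof_irrelevance _ p q).
Qed.

Lemma hat1_inv (F : S 2) : hat1 s (src 1 F) = hat1 s (tgt 1 F).
Proof. by rewrite /hat1 (pclass_eq (cell_congr F)). Qed.

Lemma hat1_cell (u : S 1) : exists F : S 2, src 1 F = u /\ tgt 1 F = hat1 s u.
Proof.
apply: congr_cell; have := rep_class s (pclass u).
move=> /(f_equal (fun a : pcell S => sval a u)) /= e.
apply: congr1_sym; change (Defs.congr1 (gens S 1) (rep s (pclass u)) u).
by rewrite e; apply: congr1_refl.
Qed.

Lemma hat1_id (x : S 0) : hat1 s (idc 1 x) = idc 1 x.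
Proof. exact: rep_id. Qed.

(** The free category carried by [S] is itself one of the models over which [homotopy_basis]
    quantifies, with the identity as comparison functor. *)
Lemma acyclic_fill j (f g : S j) : acyclic S -> 1 < j -> ltD j n -> parallel f g ->
  exists F : S j.+1, src j F = f /\ tgt j F = g.
Proof. by move=> ac j1 jn; apply: (ac j j1 jn); apply: top_free. Qed.

Lemma acyclic_left : acyclic S -> left_normalising s.
Proof.
move=> ac.
have [|||||||sigma [gs ts hs]] := @left_strategy_exists n S (hat1 s); first last.
- have tgtE k (f : S k) : 0 < k -> ltD k n -> tgt k (sigma k f) = hat s sigma f.
    by case: k f => [|[|k]] f k0 kn; first [done | exact: ts | exact: hs].
  exists sigma; split; first split.
  + by move=> k f k0 kn; apply: (gd_src (gs k k0 kn)).
  + exact: tgtE.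
  + by move=> k f k0 kn; rewrite -tgtE // (gd_norm (gs k k0 kn)).
  + move=> i k f g ik kn e; have k0 : 0 < k by lia.
    by rewrite (gd_comp (gs k k0 kn)).
  + move=> u v n1 e; rewrite (gd_comp0 (gs 1 isT n1)) // ts (gd_src (gs 1 isT n1)).
    by rewrite (idc_refl Sn) //; arD.
  + move=> k f g k1 kn e u' v; have k0 : 0 < k by lia.
    have kn' : leD k.+1 n by rewrite -ltD_leD.
    rewrite (gd_comp0 (gs k k0 kn)) //.
    have k2 : 1 < k < k.+1 by lia.
    rewrite -(src_src Sn (sigma k g) k2) // -(tgt_src Sn (sigma k f) k2) //.
    by rewrite !(gd_src (gs k k0 kn)).
- exact: hat1_id.
- exact: hat1_cell.
- exact: hat1_inv.
- by move=> j j1 jn f g; apply: acyclic_fill.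
- by move=> k kn; exists (gens S k), (@incl n S k); apply: polygraph_generates.
- exact: n2.
- exact: HC.
Qed.

(** A left strategy of [op S] is read in [S] as a right one. Splitting on the dimensions lets the
    case distinctions in [op] reduce: only boundaries and composites along 0 have changed. *)
Lemma acyclic_right : acyclic S -> right_normalising s.
Proof.
move=> ac.
have [|||||||sigma [gs ts hs]] := @left_strategy_exists n (op S) (hat1 s); first last.
- have tgtE k (f : S k) : 0 < k -> ltD k n -> tgt k (sigma k f) = hat s sigma f.
    by case: k f => [|[|k]] f k0 kn; first [done | exact: ts | exact: hs].
  exists sigma; split; first split.
  + by case=> // k f k0 kn; apply: (gd_src (gs k.+1 k0 kn)).
  + by case=> // k f k0 kn; exact: (tgtE k.+1 f k0 kn).
  + case=> // k f k0 kn; have := gd_norm (gs k.+1 k0 kn) f.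
    by rewrite (tgtE k.+1 f).
  + case=> // i [|k] // f g ik kn e.
    exact: (gd_comp (gs k.+1 isT kn) (i := i.+1)).
  + move=> u v n1 e; have := @gd_comp0 _ _ _ (gs 1 isT n1) v u (esym e).
    have := ts v; have := gd_src (gs 1 isT n1) u; rewrite /= => -> -> ->.
    by rewrite (idc_refl Sn) //; arD.
  + case=> // k f g k1 kn e u v'.
    have kn' : leD k.+2 n by rewrite -ltD_leD.
    have := @gd_comp0 _ _ _ (gs k.+1 isT kn) g f (esym e); rewrite /=.
    have k2 : 1 < k.+1 < k.+2 by lia.
    have sf := gd_src (gs k.+1 isT kn) f; have sg := gd_src (gs k.+1 isT kn) g.
    rewrite /= in sf sg.
    rewrite -(src_src Sn (sigma k.+1 f) k2) // sf.
    by rewrite -(tgt_src Sn (sigma k.+1 g) k2) // sg.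
- exact: hat1_id.
- exact: hat1_cell.
- exact: hat1_inv.
- case=> // j j1 jn f g pfg; apply: acyclic_fill => //.
  by case=> [|i] ij; [have [] := pfg 0 ij | have [] := pfg i.+1 ij].
- move=> k kn; exists (gens S k), (@incl n S k).
  by apply: op_generates; apply: polygraph_generates.
- exact: n2.
- exact: op_n1cat.
Qed.

End Polygraph.

Lemma normalising_acyclic (n : edim) (S : polygraph n) (s : section S) :
  normalising s -> acyclic S.
Proof.
move=> [sigma st] k k1 kn E J inc free f g pfg.
have HC := top_n1cat S; have Sn := proj1 HC.
(* The filler is formed in the model carried by [S]; [H] transports it to the arbitrary model
   [E]. *)
have [H [[Hf HJ _] _]] := free_univ (top_free S kn) (free_n1cat free)
  (free_functor free) (free_src free) (free_tgt free).
have k0 : 0 < k by lia.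
have nk : leD k.+1 n by rewrite -ltD_leD.
have e : tgt k (sigma k f) = tgt k (sigma k g).
  rewrite !(strat_tgt st) //; case: k k1 kn f g pfg {E J inc free H Hf HJ k0 nk} => [|[|k]] // _ _ f g pfg.
  by have [e1 e2] := pfg k.+1 (leqnn _); rewrite /hat e1 e2.
have [ga gb gc gd] := invertP HC k0 (sigma k g) nk.
rewrite /= in ga gb.
exists (H k.+1 (compo k (sigma k f) (invert (sigma k g)))).
have kk : k < k.+1 <= k.+1 by lia.
rewrite -(fun_src Hf) // -(fun_tgt Hf) //.
rewrite (src_comp Sn) // ?(tgt_comp Sn) // ?ga ?gb //.
by rewrite !(strat_src st) // !HJ.
Qed.

Theorem theorem3p3p6 (n : edim) (hn : leD 1 n) (S : polygraph n) (s : section S) :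
  (acyclic S <-> normalising s) /\
  (acyclic S <-> left_normalising s) /\
  (acyclic S <-> right_normalising s).
Proof.
have fromL : left_normalising s -> normalising s by case=> sigma [st _ _]; exists sigma.
have fromR : right_normalising s -> normalising s by case=> sigma [st _ _]; exists sigma.
have toLR : acyclic S -> left_normalising s /\ right_normalising s.
  move=> ac; case: (boolP (leD 2 n)) => n2.
    by split; [exact: acyclic_left | exact: acyclic_right].
  (* When [n] is less than 2 there is no [k] with $1 \le k < n$, so every law of a strategy is
     vacuous and any assignment serves. *)
  have no k : 0 < k -> ltD k n -> False.
    move=> k0; rewrite ltD_leD => kn; case/negP: n2; apply: leD_trans kn; lia.
  have nok k : 1 < k -> ltD k n -> False by move=> k1; apply: no; lia.
  have noi i k : 0 < i < k -> ltD k n -> False by move=> k1; apply: no; lia.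
  have st : is_strategy s (fun k f => idc k.+1 f).
    split=> [k f k0 /(no k k0)[]|k f k0 /(no k k0)[]|k f k0 /(no k k0)[]|].
    by move=> i k f g ik /(noi i k ik)[].
  split; exists (fun k f => idc k.+1 f); split=> //.
  - by move=> u v /(no 1 isT)[].
  - by move=> k f g k1 /(nok k k1)[].
  - by move=> u v /(no 1 isT)[].
  - by move=> k f g k1 /(nok k k1)[].
split; [|split]; split.
- by move=> /toLR[/fromL].
- exact: normalising_acyclic.
- by move=> /toLR[].
- by move=> /fromL; apply: normalising_acyclic.
- by move=> /toLR[].
- by move=> /fromR; apply: normalising_acyclic.
Qed.
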